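(* Assume that the system $\dot X(t)=\sum_{k=1}^m u_k(t)S_kX(t)$ on $\mathrm{U}(n)$ is controllable and let $T>0$. Given arbitrary $X_0,X_{goal}\in\mathrm U(n)$, one may always construct $X_1\in\mathrm U(n)$ such that both $X_1X_0^\dagger$ and $X_{goal}X_1^\dagger$ belong to $\mathcal W$. Consider, for the initial condition $X(0)=X_0$, the following piecewise-smooth control law in two steps, using either the deterministic or the stochastic local control laws defined in the context. Step one: starting at time $0$, apply the local control law for the pair $(Y_0,Y_{goal})=(X_0,X_1)$. Then there exists $L\in\mathbb N$ big enough such that $X_{goal}X(LT)^\dagger\in\mathcal W$. Step two: at the instant $\overline t=LT$, switch to the local control law for the pair $(Y_0,Y_{goal})=(X(LT),X_{goal})$. This control policy solves the $T$-sampling stabilization problem, that is, $\lim_{j\to\infty}X(jT)=X_{goal}$ (almost surely, together with the existence of $L$ in Step one, if the stochastic laws are used).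
   Context: Fix $n\ge 1$. $\mathrm{U}(n)$ is the group of $n\times n$ unitary matrices and $\mathfrak u(n)$ its (real) Lie algebra of skew-Hermitian matrices; $X^\dagger$ is the conjugate transpose. Consider the driftless right-invariant system $\dot X(t)=\sum_{k=1}^m u_k(t)S_kX(t)$, with state $X\in\mathrm U(n)$, controls $u_k\in\mathbb R$ and fixed $S_1,\dots,S_m\in\mathfrak u(n)$. Controllable means that the Lie algebra generated by $S_1,\dots,S_m$ equals $\mathfrak u(n)$. Set $\mathcal W=\{W\in\mathrm U(n):\det(I+W)\ne 0\}$ and $\omega=2\pi/T$. The $T$-sampling stabilization problem for an initial condition and a goal state $X_{goal}$ is to find a control law $u=u(X,t)$ such that $\lim_{j\to\infty}X(jT)=X_{goal}$ for the closed-loop system. Local control law for a pair $(Y_0,Y_{goal})\in\mathrm U(n)^2$ with $R:=Y_{goal}Y_0^\dagger\in\mathcal W$, started at a time $t_0\in\{0,T,2T,\dots\}$ at which the state of the system equals $Y_0$: denote the state by $Y(t)$ and put $\Xi(t)=Y(t)Y_0^\dagger$ (so $\Xi(t_0)=I$, and $\Xi$ satisfies the same differential equation). Fix gains $f_1,\dots,f_m>0$ and let $\overline X$ solve $\dot{\overline X}=\sum_k\overline u_k(t)S_k\overline X$, $\overline X(t_0)=R$. For $t\ge t_0$ apply $$u_k=\overline u_k(t)+f_k\,\mathrm{Tr}\left(\Xi(\overline X^\dagger(t)\Xi-I)(\overline X^\dagger(t)\Xi+I)^{-3}\overline X^\dagger(t)S_k\right),\quad k=1,\dots,m.$$ Deterministic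 version: $\overline u_k(t)=\sum_{\ell=1}^M a_{k,\ell}\sin(\ell\omega t)$ with an integer $M>0$ big enough and a fixed $\mathbf a=(a_{k,\ell})\in\mathbb R^{mM}$ that is admissible, i.e. such that the closed-loop solution satisfies $\lim_{t\to\infty}\overline X^\dagger(t)\Xi(t)=I$; $M$ is taken big enough that the set of non-admissible $\mathbf a$ is closed with zero Lebesgue measure in $\mathbb R^{mM}$ (such an $M$ exists for every $R\in\mathcal W$). Stochastic version: $\overline u_k(t)=\sum_{\ell=1}^M a^j_{k,\ell}\sin(\ell\omega t)$ for $t\in[jT,(j+1)T)$, where $\mathbf a_j=(a^j_{k,\ell})$ are independent random vectors uniformly distributed on $[-\tfrac{a_{max}}2,\tfrac{a_{max}}2]^{mM}$ for a fixed $a_{max}>0$ (independent of everything before time $jT$), with $M$ big enough that $\Xi(jT)\to R$ almost surely (such an $M$ exists for every $R\in\mathcal W$). *)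

(* Defs.v *)
From HB Require Import structures.
From mathcomp Require Import all_boot all_order all_algebra.
From mathcomp Require Import complex.
From mathcomp Require Import all_classical all_reals all_analysis.
Set Implicit Arguments.
Unset Strict Implicit.
Unset Printing Implicit Defensive.
Import Order.TTheory GRing.Theory Num.Theory.
Import numFieldNormedType.Exports.
Local Open Scope classical_set_scope.
Local Open Scope ring_scope.
Local Open Scope complex_scope.
Local Open Scope sesquilinear_scope.

(* [complex.Re] and [complex.Im] are R-valued, unlike the notations 'Re and 'Im;
   limits and derivatives in C^(n x n) are taken coordinatewise through them. *)
Definition cmx_cvg (R : realType) (n : nat) (I : Type) (F : set_system I)
    (X : I -> 'M[R[i]]_n) (A : 'M[R[i]]_n) : Prop :=
  forall i j,
    complex.Re (X s i j) @[s --> F] --> complex.Re (A i j) /\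
    complex.Im (X s i j) @[s --> F] --> complex.Im (A i j).

Definition cmx_continuous_from (R : realType) (n : nat) (t0 : R)
    (X : R -> 'M[R[i]]_n) : Prop :=
  forall i j,
    {within `[t0, +oo[, continuous (fun t => complex.Re (X t i j))} /\
    {within `[t0, +oo[, continuous (fun t => complex.Im (X t i j))}.

Definition cmx_is_derive (R : realType) (n : nat) (X : R -> 'M[R[i]]_n) (t : R)
    (D : 'M[R[i]]_n) : Prop :=
  forall i j,
    is_derive t (1 : R) (fun s => complex.Re (X s i j)) (complex.Re (D i j)) /\
    is_derive t (1 : R) (fun s => complex.Im (X s i j)) (complex.Im (D i j)).

Definition skew_hermitian (R : realType) (n : nat) : set 'M[R[i]]_n :=
  [set A | A^t* = - A].

Definition lie_subalgebra (R : realType) (n : nat) (L : set 'M[R[i]]_n) : Prop :=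
  [/\ L 0,
      forall A B, L A -> L B -> L (A + B),
      forall (c : R) A, L A -> L (c%:C *: A) &
      forall A B, L A -> L B -> L (A *m B - B *m A)].

Definition lie_generated (R : realType) (n m : nat) (S : 'I_m -> 'M[R[i]]_n) :
    set 'M[R[i]]_n :=
  smallest (@lie_subalgebra R n) (range S).

Definition controllable (R : realType) (n m : nat) (S : 'I_m -> 'M[R[i]]_n) :
    Prop :=
  lie_generated S = @skew_hermitian R n.

Definition in_W (R : realType) (n : nat) (W : 'M[R[i]]_n) : Prop :=
  W \is unitarymx /\ \det (1%:M + W) != 0.

(* Solutions on [t0, +oo[ of X' = sum_k v_k(t, X) S_k X in U(n).  The controls
   may jump at multiples of T, where the equation is not required pointwise but
   X must be continuous; when v is continuous there as well, the equation at
   those times follows. *)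
Definition solves (R : realType) (n m : nat) (S : 'I_m -> 'M[R[i]]_n) (T t0 : R)
    (v : R -> 'M[R[i]]_n -> 'I_m -> R) (X0 : 'M[R[i]]_n)
    (X : R -> 'M[R[i]]_n) : Prop :=
  [/\ X t0 = X0,
      cmx_continuous_from t0 X,
      forall t, t0 <= t -> X t \is unitarymx &
      forall t, t0 < t -> (forall j : nat, t != j%:R * T) ->
        cmx_is_derive X t (\sum_k (v t (X t) k)%:C *: (S k *m X t))].

(* On [j T, (j+1) T[ the coefficients are a j, since then truncn (t / T) = j;
   the deterministic law is the case of a constant sequence a. *)
Definition ref_control (R : realType) (m M : nat) (T : R)
    (a : nat -> 'M[R]_(m, M)) (t : R) (k : 'I_m) : R :=
  \sum_(l < M) a (Num.truncn (t / T)) k l * sin (l.+1%:R * (2 * pi / T) * t).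

(* The trace is real for Xi, Xb unitary with Xb^dagger Xi in W and S k
   skew-Hermitian; [complex.Re] only serves to land in R. *)
Definition feedback (R : realType) (n m : nat) (S : 'I_m -> 'M[R[i]]_n)
    (f : 'I_m -> R) (Xb Xi : 'M[R[i]]_n) (k : 'I_m) : R :=
  f k * complex.Re (\tr (Xi *m (Xb^t* *m Xi - 1%:M)
                            *m invmx ((Xb^t* *m Xi + 1%:M) ^+ 3)
                            *m Xb^t* *m S k)).

Definition local_law (R : realType) (n m M : nat) (S : 'I_m -> 'M[R[i]]_n)
    (f : 'I_m -> R) (T : R) (a : nat -> 'M[R]_(m, M)) (Y0 : 'M[R[i]]_n)
    (Xb : R -> 'M[R[i]]_n) (t : R) (Y : 'M[R[i]]_n) (k : 'I_m) : R :=
  ref_control T a t k + feedback S f (Xb t) (Y *m Y0^t*) k.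

(* Y is the closed-loop state for the pair (Y0, Yg) started at t0, and Xb the
   reference.  The last clause says that the feedback is well defined, [invmx]
   being total. *)
Definition closed_loop (R : realType) (n m M : nat) (S : 'I_m -> 'M[R[i]]_n)
    (f : 'I_m -> R) (T t0 : R) (Y0 Yg : 'M[R[i]]_n) (a : nat -> 'M[R]_(m, M))
    (Xb Y : R -> 'M[R[i]]_n) : Prop :=
  [/\ solves S T t0 (fun t _ => ref_control T a t) (Yg *m Y0^t*) Xb,
      solves S T t0 (local_law S f T a Y0 Xb) Y0 Y &
      forall t, t0 <= t -> in_W ((Xb t)^t* *m (Y t *m Y0^t*))].

Definition admissible (R : realType) (n m M : nat) (S : 'I_m -> 'M[R[i]]_n)
    (f : 'I_m -> R) (T t0 : R) (Y0 Yg : 'M[R[i]]_n) (a : 'M[R]_(m, M)) : Prop :=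
  (exists Xb Y, closed_loop S f T t0 Y0 Yg (fun=> a) Xb Y) /\
  (forall Xb Y, closed_loop S f T t0 Y0 Yg (fun=> a) Xb Y ->
     cmx_cvg (pinfty_nbhs R) (fun t => (Xb t)^t* *m (Y t *m Y0^t*)) 1%:M).

Definition mx_box (R : realType) (m M : nat) (lo hi : 'M[R]_(m, M)) :
    set 'M[R]_(m, M) :=
  [set a | forall k l, lo k l <= a k l <= hi k l].

Definition mx_vol (R : realType) (m M : nat) (lo hi : 'M[R]_(m, M)) : R :=
  \prod_k \prod_l (hi k l - lo k l).

(* Zero Lebesgue measure in R^(m M): coverable by countably many boxes of
   arbitrarily small total volume. *)
Definition lebesgue_null (R : realType) (m M : nat) (A : set 'M[R]_(m, M)) :
    Prop :=
  forall e : R, 0 < e -> exists lo hi : nat -> 'M[R]_(m, M),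
    [/\ forall i k l, lo i k l <= hi i k l,
        A `<=` \bigcup_i mx_box (lo i) (hi i) &
        (\sum_(0 <= i <oo) (mx_vol (lo i) (hi i))%:E <= e%:E)%E].

Definition det_big_enough (R : realType) (n m : nat) (S : 'I_m -> 'M[R[i]]_n)
    (f : 'I_m -> R) (T t0 : R) (Y0 Yg : 'M[R[i]]_n) (M : nat) : Prop :=
  [/\ (0 < M)%N,
      closed [set a : 'M[R]_(m, M) | ~ admissible S f T t0 Y0 Yg a] &
      lebesgue_null [set a : 'M[R]_(m, M) | ~ admissible S f T t0 Y0 Yg a]].

(* Probability = volume ratio on sub-boxes of the cube determines the law. *)
Definition uniform_on_cube (R : realType) (d : measure_display)
    (Om : measurableType d) (P : probability Om R) (m M : nat) (amax : R)
    (a : Om -> 'M[R]_(m, M)) : Prop :=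
  (forall k l, measurable_fun [set: Om] (fun w => a w k l)) /\
  forall lo hi : 'M[R]_(m, M),
    (forall k l, [/\ - (amax / 2) <= lo k l, lo k l <= hi k l &
                     hi k l <= amax / 2]) ->
    P (a @^-1` mx_box lo hi) = (mx_vol lo hi / amax ^+ (m * M))%:E.

Definition sigma_rv (R : realType) (d : measure_display) (Om : measurableType d)
    (m M : nat) (a : Om -> 'M[R]_(m, M)) : set (set Om) :=
  <<s [set E | exists k l (B : set R),
         measurable B /\ E = (fun w => a w k l) @^-1` B] >>.

Definition mutually_independent (R : realType) (d : measure_display)
    (Om : measurableType d) (P : probability Om R)
    (G : nat -> set (set Om)) : Prop :=
  forall (s : seq nat) (E : nat -> set Om), uniq s ->
    (forall j, j \in s -> G j (E j)) ->
    P (\bigcap_(j in [set` s]) E j) = (\prod_(j <- s) P (E j))%E.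

Definition sto_big_enough (R : realType) (n m : nat) (S : 'I_m -> 'M[R[i]]_n)
    (f : 'I_m -> R) (amax T t0 : R) (Y0 Yg : 'M[R[i]]_n) (M : nat) : Prop :=
  (0 < M)%N /\
  forall (d : measure_display) (Om : measurableType d) (P : probability Om R)
    (a : nat -> Om -> 'M[R]_(m, M)),
    (forall j, uniform_on_cube P amax (a j)) ->
    mutually_independent P (fun j => sigma_rv (a j)) ->
    {ae P, forall w,
      (exists Xb Y, closed_loop S f T t0 Y0 Yg (a ^~ w) Xb Y) /\
      (forall Xb Y, closed_loop S f T t0 Y0 Yg (a ^~ w) Xb Y ->
         cmx_cvg \oo (fun j : nat => Y (j%:R * T) *m Y0^t*) (Yg *m Y0^t*))}.

Definition switched (R : realType) (n : nat) (tb : R) (X Y : R -> 'M[R[i]]_n)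
    (t : R) : 'M[R[i]]_n :=
  if t < tb then X t else Y t.

(* Main.v *)
Require Import Defs.
From HB Require Import structures.
From mathcomp Require Import all_boot all_order all_algebra.
From mathcomp Require Import complex.
From mathcomp Require Import all_classical all_reals all_analysis.
From mathcomp Require Import measurable_realfun.
From mathcomp Require Import ring lra.
Set Implicit Arguments.
Unset Strict Implicit.
Unset Printing Implicit Defensive.
Import Order.TTheory GRing.Theory Num.Theory.
Import numFieldNormedType.Exports.
Local Open Scope classical_set_scope.
Local Open Scope ring_scope.
Local Open Scope complex_scope.
Local Open Scope sesquilinear_scope.

(** The intermediate target is a phase multiple of the initial state, X1 = c X0
   with |c| = 1: then X1 X0^dagger = c I lacks the eigenvalue -1 as soon as c
   differs from -1, and Xg X1^dagger lacks it as soon as c is not one of the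
   at most n eigenvalues of - Xg X0^dagger [intermediate_target].

   A local law is studied in a chart. Let B be the reference, Xi = Y Y0^dagger
   and Z = B^dagger Xi; as Z is in W, its Cayley transform K is a
   skew-Hermitian matrix. In terms of (B, K) the feedback is polynomial
   [feedback_chart] and the closed loop becomes B' = A B, K' = F (B, K), where
   F does not involve the open loop part of the controls. The feedback is
   designed so that the Frobenius norm of K never increases [dissipation]. So
   (B, K) stays in a compact set, on which the equation agrees with one whose
   field is bounded and Lipschitz; the latter is solved by Euler polygons,
   uniquely [euler_limit_derive, euler_limit_unique]. Consequently a closed
   loop exists for all bounded coefficients [closed_loop_exists] and its
   samples are explicit functions of the coefficients [closed_loop_flow].

   The controls of the reference are odd about the middle of each period, so
   the reference is back at R = Yg Y0^dagger at every sampling time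
   [reference_periodic]. For an admissible law the error Z tends to I, hence
   the samples of Xi tend to R and those of the state to the goal. After step
   one the samples converge to X1; as W is open, X (L T) satisfies the
   condition of step two for some L [eventually_in_W], and step two is again a
   local law. This settles the deterministic case
   [deterministic_stabilization].

   In the stochastic case the starting state X (L T) of step two is random,
   whereas the property of the local law is known for each fixed starting
   state. But X (L T) is a function of the coefficients of the first L
   periods, which are independent of those used later. Convergence of step two
   from a state y means that K, sampled along the flow, tends to 0
   [sampled_limit_chart], and this is a jointly measurable condition on past
   and future coefficients because the flow is a limit of Euler polygons
   [flow_measurable]. For each fixed past the future violates it with
   probability zero; by independence and Fubini so do past and future together
   [null_diagonal, restart_null]. The number of harmonics M2 L y is an
   arbitrary function of the state, so the pasts are sorted by its value; the
   resulting sets of pasts need not be measurable, and [null_diagonal] allows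
   for that: the set of all pasts whose section is null is measurable and
   contains them. *)

(** * Euler scheme for equations with jumps at the grid times *)

Ltac nonneg := by repeat first
  [done | apply: mulr_ge0 | apply: addr_ge0 | apply: exprn_ge0
   | exact: expR_ge0 | exact: normr_ge0 | rewrite subr_ge0].

Section EulerScheme.
Context {R : realType} {I : Type}.
Variables (T C : R) (G : R -> (I -> R) -> I -> R).
Hypotheses (hT : 0 < T) (hC : 0 <= C).

Definition piece (t : R) : nat := Num.truncn (t / T).

Hypothesis Gbnd : forall t x i, `|G t x i| <= C.
Hypothesis Glip : forall s t x y (e : R), piece s = piece t -> `|s - t| <= e ->
  (forall i, `|x i - y i| <= e) -> forall i, `|G s x i - G t y i| <= C * e.

(** Dyadic fractions of the period: each grid refines the previous one, and
   all of them contain the times at which the field may jump. *)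
Definition mesh (N : nat) : R := T / 2 ^+ N.

Fixpoint euler (N : nat) (x0 : I -> R) (k : nat) : I -> R :=
  if k is l.+1 then
    fun i => euler N x0 l i + mesh N * G (l%:R * mesh N) (euler N x0 l) i
  else x0.

Let D := C + 1.

Lemma mesh_gt0 N : 0 < mesh N.
Proof. by rewrite divr_gt0 ?exprn_gt0. Qed.

Lemma meshS N : mesh N = 2 * mesh N.+1.
Proof. by rewrite /mesh exprS; field; rewrite expf_eq0 pnatr_eq0 andbF. Qed.

Lemma mesh_le N : mesh N <= T.
Proof.
rewrite ler_pdivrMr ?exprn_gt0// ler_peMr ?(ltW hT)//.
by rewrite exprn_ege1// ler1n.
Qed.

Lemma mesh_pow N (J : nat) : (J * 2 ^ N)%:R * mesh N = J%:R * T.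
Proof.
by rewrite /mesh natrM natrX; field; rewrite expf_eq0 pnatr_eq0 andbF.
Qed.

Lemma truncn_mesh N (t : R) : 0 <= t ->
  (Num.truncn (t / mesh N))%:R * mesh N <= t
    < (Num.truncn (t / mesh N)).+1%:R * mesh N.
Proof.
move=> t0; have m0 := mesh_gt0 N.
have /truncn_itv : 0 <= t / mesh N by rewrite divr_ge0// ltW.
by rewrite ler_pdivlMr// ltr_pdivrMr.
Qed.

Lemma piece_mesh N (t : R) k : k%:R * mesh N <= t < k.+1%:R * mesh N ->
  piece t = (k %/ 2 ^ N)%N.
Proof.
move=> /andP[kt tk]; have p0 : (0 < 2 ^ N)%N by rewrite expn_gt0.
have m0 := mesh_gt0 N.
apply: truncn_def; rewrite ler_pdivlMr// ltr_pdivrMr// -!(mesh_pow N).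
apply/andP; split.
  apply: le_trans kt; rewrite ler_pM2r// ler_nat.
  exact: leq_trunc_div.
apply: lt_le_trans tk _; rewrite ler_pM2r// ler_nat.
exact: ltn_ceil.
Qed.

Lemma piece_grid N k : piece (k%:R * mesh N) = (k %/ 2 ^ N)%N.
Proof.
by apply: piece_mesh; rewrite lexx ltr_pM2r ?mesh_gt0// ltr_nat leqnn.
Qed.

Let hD : 0 <= D. Proof. by rewrite addr_ge0. Qed.

(** Solution of the discrete Gronwall recursion [gronwall_errS] with step mesh
   N and initial value 0. *)
Definition gronwall_err (N k : nat) : R := D * mesh N * ((1 + mesh N * D) ^+ k - 1).

Lemma gronwall_err_ge0 N k : 0 <= gronwall_err N k.
Proof.
have m0 := ltW (mesh_gt0 N).
apply: mulr_ge0; first exact: mulr_ge0.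
by rewrite subr_ge0 exprn_ege1// lerDl mulr_ge0.
Qed.

Lemma gronwall_errS N k : gronwall_err N k.+1 =
  gronwall_err N k + mesh N * D * gronwall_err N k + D ^+ 2 * mesh N ^+ 2.
Proof. by rewrite /gronwall_err exprS; ring. Qed.

Lemma gronwall_err_le N k (t : R) : k%:R * mesh N <= t ->
  gronwall_err N k <= D * expR (D * t) * mesh N.
Proof.
move=> kt; have m0 := ltW (mesh_gt0 N).
rewrite /gronwall_err mulrAC ler_wpM2r// ler_wpM2l// lerBlDr.
apply: (@le_trans _ _ (expR (D * t))); last by rewrite lerDl.
apply: (@le_trans _ _ (expR (mesh N * D) ^+ k)).
  by rewrite lerXn2r ?nnegrE ?expR_ge0 ?expR_ge1Dx// addr_ge0// mulr_ge0.
rewrite -expRM_natl ler_expR.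
by rewrite mulrA mulrC ler_wpM2l.
Qed.

(** One coarse step against two fine ones. At the first fine step the fields
   differ by C times the error so far, at the second also by the displacement
   made meanwhile; summing up gives the recursion [gronwall_errS]. Both fine
   steps take place in the same period, so no jump is met. *)
Lemma euler_refine N x0 k i :
  `|euler N x0 k i - euler N.+1 x0 k.*2 i| <= gronwall_err N k.
Proof.
elim: k i => [|k IH] i; first by rewrite /= subrr normr0 gronwall_err_ge0.
have m0 := mesh_gt0 N.+1.
rewrite doubleS /=.
set e := euler N x0 k; set u := euler N.+1 x0 k.*2; set h' := mesh N.+1.
set u1 := (fun _ => _ in X in _ - (_ + _ * G _ X i)).
have tE : k%:R * mesh N = (k.*2)%:R * h' by rewrite meshS -mul2n natrM -/h'; ring.
have p1 : piece (k%:R * mesh N) = piece ((k.*2).+1%:R * h').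
  by rewrite !piece_grid expnS divnMA -[(k.*2).+1]addn1 -muln2 divnMDl// addn0.
have h1 : `|G (k%:R * mesh N) e i - G ((k.*2)%:R * h') u i| <= C * gronwall_err N k.
  apply: Glip => //; first by rewrite tE.
  by rewrite tE subrr normr0 gronwall_err_ge0.
have h2 : `|G (k%:R * mesh N) e i - G ((k.*2).+1%:R * h') u1 i| <=
   C * (gronwall_err N k + h' * D).
  apply: Glip => // [|l].
    rewrite tE -[(k.*2).+1]addn1 natrD mulrDl mul1r opprD addrA subrr add0r normrN.
    rewrite gtr0_norm// -[X in X <= _]add0r lerD ?gronwall_err_ge0//.
    by rewrite ler_peMr ?(ltW m0)// lerDr.
  rewrite /u1 opprD addrA (le_trans (ler_normB _ _))// lerD//.
  rewrite normrM gtr0_norm// ler_wpM2l ?(ltW m0)//.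
  by rewrite (le_trans (Gbnd _ _ _))// lerDl.
have -> : e i + mesh N * G (k%:R * mesh N) e i -
    (u1 i + h' * G ((k.*2).+1%:R * h') u1 i) =
  (e i - u i) + h' * (G (k%:R * mesh N) e i - G ((k.*2)%:R * h') u i)
   + h' * (G (k%:R * mesh N) e i - G ((k.*2).+1%:R * h') u1 i).
  by rewrite /u1 meshS -/h'; ring.
have h'0 : 0 <= h' by rewrite ltW.
rewrite (le_trans (ler_normD _ _))// (le_trans (lerD (ler_normD _ _) (lexx _)))//.
have nh a : `|h' * a| = h' * `|a| by rewrite normrM ger0_norm.
rewrite !nh.
apply: (@le_trans _ _ (gronwall_err N k + h' * (C * gronwall_err N k) +
  h' * (C * (gronwall_err N k + h' * D)))).
  by rewrite lerD ?lerD// ler_wpM2l.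
rewrite gronwall_errS meshS -/h' -subr_ge0.
have -> : gronwall_err N k + 2 * h' * D * gronwall_err N k + D ^+ 2 * (2 * h') ^+ 2 -
    (gronwall_err N k + h' * (C * gronwall_err N k) + h' * (C * (gronwall_err N k + h' * D))) =
  2 * h' * gronwall_err N k + h' ^+ 2 * D * (3 * D + 1).
  by rewrite /D; ring.
have := gronwall_err_ge0 N k => E0; nonneg.
Qed.

Definition euler_at N x0 (t : R) : I -> R :=
  euler N x0 (Num.truncn (t / mesh N)).

Lemma euler_incr N x0 k l i :
  `|euler N x0 (k + l) i - euler N x0 k i| <= C * (l%:R * mesh N).
Proof.
have m0 := mesh_gt0 N.
elim: l => [|l IH]; first by rewrite addn0 subrr normr0 mul0r mulr0.
rewrite addnS /= addrAC (le_trans (ler_normD _ _))//.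
have -> : C * (l.+1%:R * mesh N) = C * (l%:R * mesh N) + C * mesh N.
  by rewrite -natr1; ring.
rewrite lerD//.
by rewrite normrM gtr0_norm// mulrC ler_wpM2r ?(ltW m0).
Qed.

Lemma euler_at_step N x0 (t : R) i : 0 <= t ->
  `|euler_at N.+1 x0 t i - euler_at N x0 t i| <=
    (D * expR (D * t) + D) * mesh N.
Proof.
move=> t0; have m0 := mesh_gt0 N; have m1 := mesh_gt0 N.+1.
rewrite /euler_at; set k := Num.truncn (t / mesh N).
have /andP[kt tk] := truncn_mesh N t0; rewrite -/k in kt tk.
have [b ->] : exists b : bool, Num.truncn (t / mesh N.+1) = (k.*2 + b)%N.
  have kE : k%:R * mesh N = k.*2%:R * mesh N.+1.
    by rewrite meshS -mul2n natrM; ring.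
  have kE1 : k.+1%:R * mesh N = k.*2.+2%:R * mesh N.+1.
    by rewrite meshS -doubleS -mul2n natrM; ring.
  exists (k.*2.+1%:R * mesh N.+1 <= t); apply: truncn_def.
  rewrite ler_pdivlMr// ltr_pdivrMr//.
  case: (leP (k.*2.+1%:R * mesh N.+1) t) => h; rewrite ?addn1 ?addn0.
    by rewrite h -kE1.
  by rewrite -kE kt.
rewrite distrC -[X in `|X|](subrKA (euler N.+1 x0 k.*2 i)).
rewrite (le_trans (ler_normD _ _))// mulrDl lerD//.
  by rewrite (le_trans (euler_refine _ _ _ _))// gronwall_err_le.
rewrite distrC (le_trans (euler_incr _ _ _ _ _))//.
apply: ler_pM => //; [by rewrite mulr_ge0// ltW|by rewrite lerDl|].
rewrite (meshS N); case: b; rewrite ?mul0r ?ler_wpM2r ?(ltW m1) ?ler1n//.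
by rewrite mulr_ge0// ltW.
Qed.

Lemma le_mesh_lim (a b K : R) : (forall N, a <= b + K * mesh N) -> a <= b.
Proof.
move=> h; apply/ler_addgt0Pl => e e0.
have [N hN] : exists N, `|K| * mesh N <= e.
  exists (Num.truncn (`|K| * T / e)); set N := Num.truncn _.
  rewrite /mesh mulrA ler_pdivrMr ?exprn_gt0// -ler_pdivrMl// mulrC.
  apply: ltW; apply: lt_le_trans (truncnS_gt _) _.
  by rewrite -natrX ler_nat ltn_expl.
rewrite addrC (le_trans (h N))// lerD2l (le_trans _ hN)//.
by rewrite ler_wpM2r ?ler_norm// ltW// mesh_gt0.
Qed.

(** The sequences u N - 2 q mesh N and u N + 2 q mesh N are monotone in
   opposite directions, because mesh N = 2 mesh (N + 1), and their difference
   tends to 0. *)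
Lemma cvg_mesh (u : nat -> R) (q : R) : 0 <= q ->
  (forall N, `|u N.+1 - u N| <= q * mesh N) ->
  cvgn u /\ forall N, `|limn u - u N| <= 2 * q * mesh N.
Proof.
move=> q0 hu.
pose v N := u N - 2 * q * mesh N; pose w N := u N + 2 * q * mesh N.
have step N : v N <= v N.+1 /\ w N.+1 <= w N.
  have := hu N; rewrite /v /w (meshS N) ler_norml => /andP[h1 h2].
  split; rewrite -subr_ge0.
    have -> : u N.+1 - 2 * q * mesh N.+1 - (u N - 2 * q * (2 * mesh N.+1)) =
       (u N.+1 - u N) - (- (q * (2 * mesh N.+1))) by ring.
    by rewrite subr_ge0.
  have -> : u N + 2 * q * (2 * mesh N.+1) - (u N.+1 + 2 * q * mesh N.+1) =
       (q * (2 * mesh N.+1)) - (u N.+1 - u N) by ring.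
  by rewrite subr_ge0.
have vh : {homo v : n m / (n <= m)%N >-> n <= m}.
  by apply/nondecreasing_seqP => N; have [] := step N.
have wh : {homo w : n m / (n <= m)%N >-> m <= n}.
  by apply/nonincreasing_seqP => N; have [] := step N.
have vw N M : v N <= w M.
  apply: (@le_trans _ _ (v (maxn N M))); first by rewrite vh// leq_maxl.
  apply: (@le_trans _ _ (w (maxn N M))); last by rewrite wh// leq_maxr.
  have p0 : 0 <= 2 * q * mesh (maxn N M).
    by have := ltW (mesh_gt0 (maxn N M)) => ?; nonneg.
  by rewrite /v /w lerD// (le_trans _ p0)// oppr_le0.
have mesh0 : mesh @ \oo --> (0 : R).
  rewrite /mesh -(mulr0 T).
  apply: cvgM; first exact: cvg_cst.
  rewrite (_ : (fun N => (2 ^+ N)^-1) = (fun N => (2^-1 : R) ^+ N)).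
    by apply: cvg_expr; rewrite ger0_norm// invf_lt1// ltr1n.
  by apply/funext => N; rewrite exprVn.
have cv : cvgn v.
  by apply: nondecreasing_is_cvgn => //; exists (w 0) => _ [N _ <-].
have cu : cvgn u /\ limn u = limn v.
  have : u @ \oo --> limn v + 2 * q * 0.
    rewrite (_ : u = fun N => v N + 2 * q * mesh N).
      by apply: cvgD => //; apply: cvgM => //; exact: cvg_cst.
    by apply/funext => N; rewrite /v; ring.
  rewrite mulr0 addr0 => h; split; first by apply/cvg_ex; exists (limn v).
  exact/cvg_lim.
split=> [|N]; first by case: cu.
have [_ ->] := cu; rewrite ler_distlC; apply/andP; split.
  by rewrite lerBlDr; apply: limr_le => //; near=> M; exact: vw.
by rewrite -lerBlDr; exact: nondecreasing_cvgn_le.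
Unshelve. all: by end_near.
Qed.

Section EulerLimit.
Variable x0 : I -> R.

Definition euler_limit (t : R) (i : I) : R := limn (fun N => euler_at N x0 t i).

Lemma euler_limit_rate (t : R) : 0 <= t -> exists2 K : R, 0 <= K &
  forall N i, `|euler_limit t i - euler_at N x0 t i| <= K * mesh N.
Proof.
move=> t0; exists (2 * (D * expR (D * t) + D)); first by nonneg.
move=> N i; have q0 : 0 <= D * expR (D * t) + D by nonneg.
have [_] := cvg_mesh q0 (fun N => euler_at_step N x0 i t0).
exact.
Qed.

Lemma euler_limit_cvg (t : R) i : 0 <= t -> euler_at N x0 t i @[N --> \oo] --> euler_limit t i.
Proof.
move=> t0; have q0 : 0 <= D * expR (D * t) + D by nonneg.
by have [] := cvg_mesh q0 (fun N => euler_at_step N x0 i t0).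
Qed.

Lemma euler_limit0 i : euler_limit 0 i = x0 i.
Proof.
rewrite /euler_limit; apply/cvg_lim => //.
rewrite (_ : (fun N => _) = cst (x0 i)); first exact: cvg_cst.
by apply/funext => N; rewrite /euler_at mul0r truncn0.
Qed.

Lemma euler_limit_lip (s t : R) i : 0 <= s -> s <= t ->
  `|euler_limit t i - euler_limit s i| <= C * (t - s).
Proof.
move=> s0 st; have t0 := le_trans s0 st.
have [Kt Kt0 ht] := euler_limit_rate t0; have [Ks Ks0 hs] := euler_limit_rate s0.
apply: (@le_mesh_lim _ _ (Kt + Ks + C)) => N; have m0 := ltW (mesh_gt0 N).
have /andP[h1 h2] := truncn_mesh N s0; have /andP[h3 h4] := truncn_mesh N t0.
move: (ht N i) (hs N i); rewrite /euler_at.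
set k := Num.truncn (s / _) in h1 h2 *; set l := Num.truncn (t / _) in h3 h4 *.
have kl : (k <= l)%N.
  by apply: le_truncn; rewrite ler_wpM2r// invr_ge0.
have := euler_incr N x0 k (l - k) i; rewrite subnKC// => h5 h6 h7.
have h8 : (l - k)%:R * mesh N <= t - s + mesh N.
  by rewrite natrB// mulrBl lerBlDr (le_trans h3)//; move: h2; rewrite -natr1; lra.
have h9 : C * ((l - k)%:R * mesh N) <= C * (t - s + mesh N) by rewrite ler_wpM2l.
have -> : euler_limit t i - euler_limit s i = (euler_limit t i - euler N x0 l i) +
  (euler N x0 l i - euler N x0 k i) - (euler_limit s i - euler N x0 k i) by ring.
rewrite (le_trans (ler_normB _ _))// (le_trans (lerD (ler_normD _ _) (lexx _)))//.
lra.
Qed.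

End EulerLimit.

(** Within one period all the steps between s and t use values of the field
   that are close to its value at s, so the increment of the polygon is
   almost linear. The time g separates grid points, hence equals t - s up to
   one step. *)
Lemma euler_local N x0 (s t : R) i : 0 <= s -> s <= t ->
  t <= (piece s).+1%:R * T ->
  exists2 g : R, `|g - (t - s)| <= mesh N &
  `|euler_at N x0 t i - euler_at N x0 s i - g * G s (euler_at N x0 s) i| <=
    C * D * (t - s + mesh N) ^+ 2.
Proof.
move=> s0 st tT; have t0 := le_trans s0 st.
have m0 := ltW (mesh_gt0 N).
have sp := truncn_mesh N s0.
have /andP[h1 h2] := sp; have /andP[h3 h4] := truncn_mesh N t0.
rewrite /euler_at.
set k := Num.truncn (s / _) in sp h1 h2 *; set l := Num.truncn (t / _) in h3 h4 *.
have kl : (k <= l)%N by apply: le_truncn; rewrite ler_wpM2r// invr_ge0.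
have js : piece s = (k %/ 2 ^ N)%N := piece_mesh sp.
have lj : (l <= (piece s).+1 * 2 ^ N)%N.
  rewrite -(ler_nat R) -(ler_pM2r (mesh_gt0 N)) mesh_pow.
  exact: le_trans h3 tT.
set d := t - s + mesh N.
have hd : (l - k)%:R * mesh N <= d.
  by rewrite natrB// mulrBl lerBlDr (le_trans h3)// /d; move: h2; rewrite -natr1; lra.
have d0 : 0 <= d by rewrite addr_ge0// subr_ge0.
(* the time between the grid points just before s and t *)
exists ((l - k)%:R * mesh N).
  rewrite natrB// mulrBl ler_norml; move: h2 h4; rewrite -!natr1 => h2 h4.
  by apply/andP; split; lra.
have main p : (k + p <= l)%N ->
  `|euler N x0 (k + p) i - euler N x0 k i - p%:R * mesh N * G s (euler N x0 k) i|
    <= C * D * (p%:R * mesh N * d).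
  elim: p => [|p IH] kp; first by rewrite addn0 subrr !mul0r subrr normr0 mulr0.
  have kp1 : (k + p < l)%N by rewrite -addnS.
  have pd : p%:R * mesh N <= d.
    by apply: le_trans hd; rewrite ler_wpM2r// ler_nat leq_subRL// ltnW.
  have IH' := IH (ltnW kp1).
  have hG : `|G ((k + p)%:R * mesh N) (euler N x0 (k + p)) i
      - G s (euler N x0 k) i| <= C * (D * d).
    apply: Glip.
    - rewrite piece_grid js; apply/eqP; rewrite eqn_leq.
      rewrite [X in _ && X]leq_div2r ?leq_addr// andbT -ltnS ltn_divLR ?expn_gt0//.
      by rewrite -js; exact: leq_trans kp1 lj.
    - apply: (@le_trans _ _ d); last first.
        by rewrite /D mulrDl mul1r lerDr mulr_ge0.
      have a1 : (k + p)%:R * mesh N <= l%:R * mesh N.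
        by rewrite ler_wpM2r// ler_nat ltnW.
      have a2 : k%:R * mesh N <= (k + p)%:R * mesh N.
        by rewrite ler_wpM2r// ler_nat leq_addr.
      by move: h2; rewrite -natr1 /d ler_norml => ?; apply/andP; split; lra.
    - move=> l'; rewrite (le_trans (euler_incr _ _ _ _ _))//.
      rewrite /D mulrDl mul1r (@le_trans _ _ (C * d))//; first by rewrite ler_wpM2l.
      by rewrite lerDl.
  rewrite addnS /=.
  have -> : euler N x0 (k + p) i + mesh N * G ((k + p)%:R * mesh N) (euler N x0 (k + p)) i
     - euler N x0 k i - p.+1%:R * mesh N * G s (euler N x0 k) i =
   (euler N x0 (k + p) i - euler N x0 k i - p%:R * mesh N * G s (euler N x0 k) i) +
   mesh N * (G ((k + p)%:R * mesh N) (euler N x0 (k + p)) i - G s (euler N x0 k) i).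
    by rewrite -natr1; ring.
  rewrite (le_trans (ler_normD _ _))//.
  have -> : C * D * (p.+1%:R * mesh N * d) =
    C * D * (p%:R * mesh N * d) + mesh N * (C * (D * d)).
    by rewrite -natr1; ring.
  by rewrite lerD// normrM (ger0_norm m0) ler_wpM2l.
have := main (l - k)%N; rewrite subnKC// leqnn => /(_ isT) /le_trans; apply.
rewrite expr2 ler_wpM2l ?mulr_ge0// ler_wpM2r//.
Qed.

Lemma euler_limit_local x0 (s t : R) i : 0 <= s -> s <= t ->
  t <= (piece s).+1%:R * T ->
  `|euler_limit x0 t i - euler_limit x0 s i - (t - s) * G s (euler_limit x0 s) i| <=
    C * D * (t - s) ^+ 2.
Proof.
move=> s0 st tT; have t0 := le_trans s0 st.
have [Kt Kt0 ht] := euler_limit_rate x0 t0; have [Ks Ks0 hs] := euler_limit_rate x0 s0.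
apply: (@le_mesh_lim _ _ (Kt + Ks + C + (t - s) * (C * Ks) +
  C * D * (2 * (t - s) + T))) => N; have m0 := ltW (mesh_gt0 N).
have [g hg hloc] := euler_local N x0 i s0 st tT.
have hG : `|G s (euler_limit x0 s) i - G s (euler_at N x0 s) i| <= C * (Ks * mesh N).
  by apply: Glip => //; rewrite subrr normr0 mulr_ge0.
have hts : 0 <= t - s by rewrite subr_ge0.
have e1 := ht N i; have e2 := hs N i.
have e3 : `|(g - (t - s)) * G s (euler_at N x0 s) i| <= mesh N * C.
  by rewrite normrM ler_pM.
have e4 : `|(t - s) * (G s (euler_limit x0 s) i - G s (euler_at N x0 s) i)| <=
    (t - s) * (C * (Ks * mesh N)).
  by rewrite normrM (ger0_norm hts) ler_wpM2l.
have -> : euler_limit x0 t i - euler_limit x0 s i - (t - s) * G s (euler_limit x0 s) i =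
  (euler_at N x0 t i - euler_at N x0 s i - g * G s (euler_at N x0 s) i) +
  ((euler_limit x0 t i - euler_at N x0 t i) - (euler_limit x0 s i - euler_at N x0 s i)) +
  ((g - (t - s)) * G s (euler_at N x0 s) i) -
  ((t - s) * (G s (euler_limit x0 s) i - G s (euler_at N x0 s) i)) by ring.
rewrite (le_trans (ler_normB _ _))// (le_trans (lerD (ler_normD _ _) (lexx _)))//.
rewrite (le_trans (lerD (lerD (ler_normD _ _) (lexx _)) (lexx _)))//.
have e5 := ler_normB (euler_limit x0 t i - euler_at N x0 t i)
  (euler_limit x0 s i - euler_at N x0 s i).
have e6 : C * D * (t - s + mesh N) ^+ 2 <=
    C * D * (t - s) ^+ 2 + C * D * (2 * (t - s) + T) * mesh N.
  rewrite -[X in _ <= _ + X]mulrA -mulrDr ler_wpM2l ?mulr_ge0//.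
  have := mesh_le N; move: (mesh N) m0 => x x0' xT.
  rewrite -subr_ge0 (_ : _ - _ = (T - x) * x); last by ring.
  by rewrite mulr_ge0// subr_ge0.
lra.
Qed.

Lemma is_derive_quadratic (f : R -> R) (t d K r : R) : 0 < r ->
  (forall s, `|s - t| < r -> `|f s - f t - (s - t) * d| <= K * (s - t) ^+ 2) ->
  is_derive t (1 : R) f d.
Proof.
move=> r0 h.
have : (fun e => e^-1 *: ((f \o shift t) (e *: (1 : R)) - f t)) @ (0 : R)^' --> d.
  apply/cvgrPdist_le => e e0; near=> x.
  have x0 : x != 0 by near: x; exact: nbhs_dnbhs_neq.
  have xr : `|x| < r by near: x; apply: dnbhs0_lt.
  have xe : `|x| < e / (`|K| + 1).
    by near: x; apply: dnbhs0_lt; rewrite divr_gt0// ltr_pwDr.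
  rewrite /= [x *: 1]mulr1 /GRing.scale/=.
  have /h : `|(x + t) - t| < r by rewrite addrK.
  rewrite addrK => hx.
  have -> : d - x^-1 * (f (x + t) - f t) = - (x^-1 * (f (x + t) - f t - x * d)).
    by field.
  rewrite normrN normrM normfV mulrC ler_pdivrMr ?normr_gt0//.
  apply: (le_trans hx); rewrite -real_normK ?num_real// expr2 mulrA.
  rewrite ler_wpM2r// ltW//; move: xe; rewrite ltr_pdivlMr ?ltr_pwDr//.
  apply: le_lt_trans; rewrite mulrC ler_wpM2l//.
  by rewrite (le_trans (ler_norm _))// lerDl.
move=> hc; apply: DeriveDef.
  by apply/cvg_ex; exists d.
exact/cvg_lim.
Unshelve. all: by end_near.
Qed.

(** Off the grid both one-sided expansions of [euler_limit_local] are
   available around t. The left one is based at an earlier time s; the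
   Lipschitz condition moves the value of the field from s to t. *)
Lemma euler_limit_derive x0 (t : R) i : 0 < t -> (forall j : nat, t != j%:R * T) ->
  is_derive t (1 : R) (fun s => euler_limit x0 s i) (G t (euler_limit x0 t) i).
Proof.
move=> t0 tT; have /truncn_itv : 0 <= t / T by rewrite divr_ge0// ltW.
rewrite -/(piece t) ler_pdivlMr// ltr_pdivrMr// => /andP[h1 h2].
have {}h1 : (piece t)%:R * T < t by rewrite lt_neqAle eq_sym tT.
set j := piece t in h1 h2.
pose r := Num.min (t - j%:R * T) (j.+1%:R * T - t).
have r0 : 0 < r by rewrite lt_min !subr_gt0 h1.
have jT : 0 <= j%:R * T by rewrite mulr_ge0// ltW.
have d0 : 0 <= C * D by rewrite mulr_ge0.
apply: (@is_derive_quadratic _ _ _ (2 * C * D) r) => // s.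
rewrite lt_min => /andP[hs1 hs2].
(* Each half of the neighbourhood stays inside the current period. *)
have [st|ts] := leP t s.
  have := euler_limit_local x0 i (ltW t0) st.
  have -> : s <= (piece t).+1%:R * T.
    move: hs2; rewrite ger0_norm ?subr_ge0//; rewrite -/j; lra.
  move=> /(_ isT) /le_trans; apply.
  by rewrite ler_wpM2r ?sqr_ge0// -mulrA ler_peMl// ler1n.
move: hs1 hs2; rewrite ltr0_norm ?subr_lt0// => hs1 hs2.
have s0 : 0 <= s by lra.
have sj : piece s = j.
  apply: truncn_def; rewrite ler_pdivlMr// ltr_pdivrMr//; apply/andP; split; lra.
have := euler_limit_local x0 i s0 (ltW ts).
have -> : t <= (piece s).+1%:R * T by rewrite sj ltW.
move=> /(_ isT) hl.
have hG : `|G s (euler_limit x0 s) i - G t (euler_limit x0 t) i| <= C * (D * (t - s)).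
  have ts0 : 0 <= t - s by rewrite subr_ge0 ltW.
  have ? : 0 <= C * (t - s) by rewrite mulr_ge0.
  apply: Glip => // [|l].
    by rewrite ltr0_norm ?subr_lt0// /D; lra.
  rewrite distrC (le_trans (euler_limit_lip _ _ s0 (ltW ts)))// /D; lra.
have -> : euler_limit x0 s i - euler_limit x0 t i - (s - t) * G t (euler_limit x0 t) i =
  - ((euler_limit x0 t i - euler_limit x0 s i - (t - s) * G s (euler_limit x0 s) i) +
    (t - s) * (G s (euler_limit x0 s) i - G t (euler_limit x0 t) i)) by ring.
rewrite normrN (le_trans (ler_normD _ _))// normrM (ger0_norm (_ : 0 <= t - s)).
  apply: (@le_trans _ _ (C * D * (t - s) ^+ 2 + (t - s) * (C * (D * (t - s))))).
    by rewrite lerD// ler_wpM2l// subr_ge0 ltW.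
  by rewrite le_eqVlt; apply/orP; left; apply/eqP; ring.
by rewrite subr_ge0 ltW.
Qed.

Lemma lipschitz_continuous_within (f : R -> R) (K : R) :
  (forall s t : R, 0 <= s -> s <= t -> `|f t - f s| <= K * (t - s)) ->
  {within `[0, +oo[, continuous f}.
Proof.
move=> h; apply/subspace_continuousP => t /=; rewrite in_itv/= andbT => t0.
apply/cvgrPdist_le => e e0.
have K1 : 0 < `|K| + 1 by rewrite ltr_pwDr.
rewrite /from_subspace; near=> s.
have s0 : 0 <= s.
  have : `[0, +oo[%classic s by near: s; exact: withinT.
  by rewrite /= in_itv/= andbT.
have st : `|t - s| < e / (`|K| + 1).
  near: s; apply: cvg_within; exact/nbhs_ballP/(ex_intro2 _ _ _ _ (fun _ x => x))/divr_gt0.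
have hb a b : 0 <= a -> a <= b -> `|a - b| < e / (`|K| + 1) -> `|f b - f a| <= e.
  move=> a0 ab; rewrite distrC ger0_norm ?subr_ge0// ltr_pdivlMr// => hab.
  apply: (le_trans (h _ _ a0 ab)); apply: le_trans (ltW hab).
  rewrite mulrC ler_wpM2l ?subr_ge0// (le_trans (ler_norm _))// lerDl//.
have [ab|/ltW ab] := leP s t; first by apply: hb => //; rewrite distrC.
by rewrite distrC; exact: hb.
Unshelve. all: by end_near.
Qed.

Lemma euler_limit_continuous x0 i :
  {within `[0, +oo[, continuous (fun t => euler_limit x0 t i)}.
Proof.
by apply: (@lipschitz_continuous_within _ C) => s t s0 st; exact: euler_limit_lip.
Qed.
Lemma piece_offgrid N k (t : R) : k%:R * mesh N < t < k.+1%:R * mesh N ->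
  forall j : nat, t != j%:R * T.
Proof.
move=> /andP[h1 h2] j; apply/eqP => tj.
move: h1 h2; rewrite tj -(mesh_pow N) !(ltr_pM2r (mesh_gt0 N)) !ltr_nat ltnS.
by move=> /leq_trans h /h; rewrite ltnn.
Qed.

Section EulerSolution.
Variables (x0 : I -> R) (y : R -> I -> R).
Hypothesis y0 : forall i, y 0 i = x0 i.
Hypothesis yc : forall i, {within `[0, +oo[, continuous (fun t => y t i)}.
Hypothesis yd : forall (t : R) i, 0 < t -> (forall j : nat, t != j%:R * T) ->
  is_derive t (1 : R) (fun s => y s i) (G t (y t) i).

Lemma solution_mvt N k (t : R) i : k%:R * mesh N < t <= k.+1%:R * mesh N ->
  exists2 c, k%:R * mesh N < c < t &
    y t i - y (k%:R * mesh N) i = G c (y c) i * (t - k%:R * mesh N).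
Proof.
move=> /andP[h1 h2]; have k0 : 0 <= k%:R * mesh N.
  by rewrite mulr_ge0// ltW// mesh_gt0.
have [c||c] := @MVT R (fun t => y t i) (fun c => G c (y c) i) _ _ h1.
- rewrite in_itv/= => /andP[c1 c2].
  apply: yd; first exact: le_lt_trans c1.
  by apply: (@piece_offgrid N k); rewrite c1 (lt_le_trans c2).
- apply: continuous_subspaceW; last exact: yc.
  by move=> u /=; rewrite !in_itv/= andbT => /andP[c1 _]; exact: le_trans c1.
- by rewrite in_itv/= => hc ->; exists c.
Qed.

(** By the mean value theorem the increment of y is the step times a value of
   the field at a point at distance O (mesh N). *)
Lemma solution_step N k i :
  `|y (k.+1%:R * mesh N) i - y (k%:R * mesh N) i
     - mesh N * G (k%:R * mesh N) (y (k%:R * mesh N)) i|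
  <= C * D * mesh N ^+ 2.
Proof.
have m0 := mesh_gt0 N.
have kE : k.+1%:R * mesh N = k%:R * mesh N + mesh N by rewrite -natr1; ring.
have [|c /andP[c1 c2] ->] := @solution_mvt N k (k.+1%:R * mesh N) i.
  by rewrite lexx kE ltrDl m0.
rewrite [X in _ * X](_ : _ = mesh N); last by rewrite kE; ring.
rewrite mulrC -mulrBr normrM gtr0_norm// mulrC expr2 mulrA ler_pM2r// -mulrA.
have ck : `|c - k%:R * mesh N| <= mesh N.
  by rewrite ger0_norm ?subr_ge0 ?(ltW c1)// lerBlDl -kE ltW.
have hm : mesh N <= D * mesh N by rewrite mulrDl mul1r lerDr mulr_ge0// ltW.
apply: Glip.
- by rewrite piece_grid; apply: piece_mesh; rewrite ltW.
- exact: le_trans ck hm.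
- move=> l; have [|c' _ ->] := @solution_mvt N k c l; first by rewrite c1 ltW.
  rewrite normrM (le_trans (ler_pM _ _ (Gbnd _ _ _) ck))//.
  by rewrite ler_wpM2r ?(ltW m0)// lerDl.
Qed.

(** Any solution y follows the polygons with an error that satisfies the
   recursion [gronwall_errS], by induction on the steps. *)
Lemma euler_error N k i : `|euler N x0 k i - y (k%:R * mesh N) i| <= gronwall_err N k.
Proof.
elim: k i => [|k IH] i; first by rewrite mul0r y0 /= subrr normr0 gronwall_err_ge0.
have m0 := ltW (mesh_gt0 N).
have hG : `|G (k%:R * mesh N) (euler N x0 k) i -
    G (k%:R * mesh N) (y (k%:R * mesh N)) i| <= C * gronwall_err N k.
  by apply: Glip => //; rewrite subrr normr0 gronwall_err_ge0.
have := solution_step N k i; rewrite /= => hs.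
set e := euler N x0 k in hG IH *; set u := y (k%:R * mesh N) in hG hs IH *.
have -> : e i + mesh N * G (k%:R * mesh N) e i - y (k.+1%:R * mesh N) i =
  (e i - u i) + mesh N * (G (k%:R * mesh N) e i - G (k%:R * mesh N) u i) -
  (y (k.+1%:R * mesh N) i - u i - mesh N * G (k%:R * mesh N) u i) by ring.
rewrite (le_trans (ler_normB _ _))// gronwall_errS lerD//.
  rewrite (le_trans (ler_normD _ _))// lerD// normrM (ger0_norm m0) -mulrA.
  rewrite ler_wpM2l// (le_trans hG)// ler_wpM2r ?gronwall_err_ge0// lerDl//.
rewrite (le_trans hs)// ler_wpM2r ?exprn_ge0// expr2 ler_wpM2r// lerDl//.
Qed.

(** At multiples of T, which lie on every grid, the error bound applies
   directly. *)
Lemma euler_limit_unique (J : nat) i : y (J%:R * T) i = euler_limit x0 (J%:R * T) i.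
Proof.
have t0 : 0 <= J%:R * T by rewrite mulr_ge0// ltW.
have [K K0 hK] := euler_limit_rate x0 t0.
apply/eqP; rewrite -subr_eq0 -normr_le0.
apply: (@le_mesh_lim _ _ (K + D * expR (D * (J%:R * T)))) => N; rewrite add0r.
have kJ : Num.truncn (J%:R * T / mesh N) = (J * 2 ^ N)%N.
  rewrite -(mesh_pow N) mulfK ?gt_eqF ?mesh_gt0//.
  exact: natrK.
have := hK N i; rewrite /euler_at kJ => h1.
have := euler_error N (J * 2 ^ N) i; rewrite mesh_pow => h2.
have h3 := @gronwall_err_le N (J * 2 ^ N)%N (J%:R * T).
rewrite mesh_pow lexx in h3; have {}h3 := h3 isT.
rewrite -(subrKA (euler N x0 (J * 2 ^ N) i)) mulrDl.
rewrite (le_trans (ler_normD _ _))// addrC lerD//; first by rewrite distrC.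
by rewrite distrC (le_trans h2).
Qed.

End EulerSolution.

End EulerScheme.

(** * Classes of functions closed under matrix operations *)

Section ComplexParts.
Context {R : realType}.
Implicit Types z w : R[i].

Lemma ReD z w : complex.Re (z + w) = complex.Re z + complex.Re w.
Proof. by case: z; case: w. Qed.
Lemma ImD z w : complex.Im (z + w) = complex.Im z + complex.Im w.
Proof. by case: z; case: w. Qed.
Lemma ReN z : complex.Re (- z) = - complex.Re z.
Proof. by case: z. Qed.
Lemma ImN z : complex.Im (- z) = - complex.Im z.
Proof. by case: z. Qed.
Lemma ReM z w : complex.Re (z * w) =
  complex.Re z * complex.Re w - complex.Im z * complex.Im w.
Proof. by case: z; case: w. Qed.
Lemma ImM z w : complex.Im (z * w) =
  complex.Re z * complex.Im w + complex.Im z * complex.Re w.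
Proof. by case: z => a b; case: w => c d. Qed.
Lemma Re_conj z : complex.Re (Num.conj z) = complex.Re z.
Proof. by case: z. Qed.
Lemma Im_conj z : complex.Im (Num.conj z) = - complex.Im z.
Proof. by case: z. Qed.
Lemma ReZ (c : R) z : complex.Re (c%:C * z) = c * complex.Re z.
Proof. by rewrite ReM /= mul0r subr0. Qed.
Lemma ImZ (c : R) z : complex.Im (c%:C * z) = c * complex.Im z.
Proof. by rewrite ImM /= mul0r addr0. Qed.
Lemma Re_sum (J : Type) (r : seq J) (P : pred J) (F : J -> R[i]) :
  complex.Re (\sum_(j <- r | P j) F j) = \sum_(j <- r | P j) complex.Re (F j).
Proof. exact: (big_morph _ ReD). Qed.
Lemma Im_sum (J : Type) (r : seq J) (P : pred J) (F : J -> R[i]) :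
  complex.Im (\sum_(j <- r | P j) F j) = \sum_(j <- r | P j) complex.Im (F j).
Proof. exact: (big_morph _ ImD). Qed.
Definition normsq z : R := complex.Re z ^+ 2 + complex.Im z ^+ 2.
Lemma ReV z : complex.Re z^-1 = complex.Re z * (normsq z)^-1.
Proof. by case: z. Qed.
Lemma ImV z : complex.Im z^-1 = - complex.Im z * (normsq z)^-1.
Proof. by case: z => a b; rewrite /= mulNr. Qed.
Lemma normsq_eq0 z : (normsq z == 0) = (z == 0).
Proof.
rewrite eq_complex /normsq paddr_eq0 ?sqr_ge0//.
by rewrite !expf_eq0.
Qed.
Lemma complex_ext z w : complex.Re z = complex.Re w ->
  complex.Im z = complex.Im w -> z = w.
Proof. by case: z => a b; case: w => c d /= -> ->. Qed.
End ComplexParts.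

Section FunctionAlgebra.
Context {R : realType} {X : Type}.
Variable A : (X -> R) -> Prop.

(** Entries of sums, products, adjoints, traces and determinants of matrices
   are polynomials in the real and imaginary parts of the entries. Hence any
   class of real functions closed under the operations below is stable under
   these matrix operations. The classes used are limits [cvg_fun], bounded
   Lipschitz functions [bounded_lip] and measurable functions
   [measurable_real]. *)
Record fun_algebra : Prop := FunAlgebra {
  alg_cst : forall c, A (fun=> c) ;
  alg_add : forall f g, A f -> A g -> A (fun x => f x + g x) ;
  alg_mul : forall f g, A f -> A g -> A (fun x => f x * g x) }.

Definition cfun (f : X -> R[i]) :=
  A (fun x => complex.Re (f x)) /\ A (fun x => complex.Im (f x)).

Definition mxfun p q (M : X -> 'M[R[i]]_(p, q)) :=
  forall i j, cfun (fun x => M x i j).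

Hypothesis hA : fun_algebra.

Lemma alg_opp f : A f -> A (fun x => - f x).
Proof.
move=> hf; rewrite (_ : (fun _ => _) = fun x => (-1) * f x).
  exact: (alg_mul hA (alg_cst hA _) hf).
by apply/funext => x; rewrite mulN1r.
Qed.

Lemma alg_sub f g : A f -> A g -> A (fun x => f x - g x).
Proof. by move=> hf hg; exact: (alg_add hA hf (alg_opp hg)). Qed.

Lemma alg_sum (J : Type) (r : seq J) (P : pred J) (F : J -> X -> R) :
  (forall j, A (F j)) -> A (fun x => \sum_(j <- r | P j) F j x).
Proof.
move=> hF; elim: r => [|j r IH].
  rewrite (_ : (fun _ => _) = cst 0); first exact: alg_cst.
  by apply/funext => x; rewrite big_nil.
case: (boolP (P j)) => hj.
  rewrite (_ : (fun _ => _) = fun x => F j x + \sum_(j <- r | P j) F j x).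
    exact: alg_add.
  by apply/funext => x; rewrite big_cons hj.
rewrite (_ : (fun _ => _) = fun x => \sum_(j <- r | P j) F j x)//.
by apply/funext => x; rewrite big_cons (negbTE hj).
Qed.

Lemma cfun_cst c : cfun (fun=> c).
Proof. by split; exact: alg_cst. Qed.

Lemma cfun_real f : A f -> cfun (fun x => (f x)%:C).
Proof. by move=> hf; split => //=; exact: alg_cst. Qed.

Lemma cfun_add f g : cfun f -> cfun g -> cfun (fun x => f x + g x).
Proof.
move=> [f1 f2] [g1 g2]; split.
  by under eq_fun do rewrite ReD; exact: alg_add.
by under eq_fun do rewrite ImD; exact: alg_add.
Qed.

Lemma cfun_mul f g : cfun f -> cfun g -> cfun (fun x => f x * g x).
Proof.
move=> [f1 f2] [g1 g2]; split.
  by under eq_fun do rewrite ReM; apply: alg_sub; exact: alg_mul.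
by under eq_fun do rewrite ImM; apply: alg_add => //; exact: alg_mul.
Qed.

Lemma cfun_conj f : cfun f -> cfun (fun x => Num.conj (f x)).
Proof.
move=> [f1 f2]; split; first by under eq_fun do rewrite Re_conj.
by under eq_fun do rewrite Im_conj; exact: alg_opp.
Qed.

Lemma cfun_inv f : cfun f -> A (fun x => (normsq (f x))^-1) ->
  cfun (fun x => (f x)^-1).
Proof.
move=> [f1 f2] hf; split.
  by under eq_fun do rewrite ReV; exact: alg_mul.
by under eq_fun do rewrite ImV; apply: alg_mul => //; exact: alg_opp.
Qed.

Lemma cfun_sum (J : Type) (r : seq J) (P : pred J) (F : J -> X -> R[i]) :
  (forall j, cfun (F j)) -> cfun (fun x => \sum_(j <- r | P j) F j x).
Proof.
move=> hF; split.
  by under eq_fun do rewrite Re_sum; apply: alg_sum => j; case: (hF j).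
by under eq_fun do rewrite Im_sum; apply: alg_sum => j; case: (hF j).
Qed.

Lemma cfun_prod (J : Type) (r : seq J) (P : pred J) (F : J -> X -> R[i]) :
  (forall j, cfun (F j)) -> cfun (fun x => \prod_(j <- r | P j) F j x).
Proof.
move=> hF; elim: r => [|j r IH].
  rewrite (_ : (fun _ => _) = cst 1); first exact: cfun_cst.
  by apply/funext => x; rewrite big_nil.
case: (boolP (P j)) => hj.
  rewrite (_ : (fun _ => _) = fun x => F j x * \prod_(j <- r | P j) F j x).
    exact: cfun_mul.
  by apply/funext => x; rewrite big_cons hj.
rewrite (_ : (fun _ => _) = fun x => \prod_(j <- r | P j) F j x)//.
by apply/funext => x; rewrite big_cons (negbTE hj).
Qed.

Lemma mxfun_cst p q (M : 'M[R[i]]_(p, q)) : mxfun (fun=> M).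
Proof. by move=> i j; exact: cfun_cst. Qed.

Lemma mxfun_add p q (M N : X -> 'M[R[i]]_(p, q)) :
  mxfun M -> mxfun N -> mxfun (fun x => M x + N x).
Proof.
move=> hM hN i j; under eq_fun do rewrite mxE.
exact: cfun_add.
Qed.

Lemma mxfun_scale p q (f : X -> R[i]) (M : X -> 'M[R[i]]_(p, q)) :
  cfun f -> mxfun M -> mxfun (fun x => f x *: M x).
Proof.
move=> hf hM i j; under eq_fun do rewrite mxE.
exact: cfun_mul.
Qed.

Lemma mxfun_opp p q (M : X -> 'M[R[i]]_(p, q)) :
  mxfun M -> mxfun (fun x => - M x).
Proof.
move=> hM; under eq_fun do rewrite -scaleN1r.
by apply: mxfun_scale => //; exact: cfun_cst.
Qed.

Lemma mxfun_sub p q (M N : X -> 'M[R[i]]_(p, q)) :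
  mxfun M -> mxfun N -> mxfun (fun x => M x - N x).
Proof. by move=> hM hN; exact: (mxfun_add hM (mxfun_opp hN)). Qed.

Lemma mxfun_mul p q r (M : X -> 'M[R[i]]_(p, q)) (N : X -> 'M[R[i]]_(q, r)) :
  mxfun M -> mxfun N -> mxfun (fun x => M x *m N x).
Proof.
move=> hM hN i j; under eq_fun do rewrite mxE.
by apply: cfun_sum => k; exact: cfun_mul.
Qed.

Lemma mxfun_adj p q (M : X -> 'M[R[i]]_(p, q)) :
  mxfun M -> mxfun (fun x => (M x)^t*).
Proof.
move=> hM i j; under eq_fun do rewrite !mxE.
exact: cfun_conj.
Qed.

Lemma mxfun_sum p q (J : Type) (r : seq J) (P : pred J)
    (F : J -> X -> 'M[R[i]]_(p, q)) :
  (forall j, mxfun (F j)) -> mxfun (fun x => \sum_(j <- r | P j) F j x).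
Proof.
move=> hF k l; under eq_fun do rewrite summxE.
by apply: cfun_sum => j; exact: hF.
Qed.

Lemma cfun_tr p (M : X -> 'M[R[i]]_p) : mxfun M -> cfun (fun x => \tr (M x)).
Proof. by move=> hM; apply: cfun_sum => k; exact: hM. Qed.

Lemma cfun_det p (M : X -> 'M[R[i]]_p) : mxfun M -> cfun (fun x => \det (M x)).
Proof.
move=> hM; apply: cfun_sum => s; apply: cfun_mul; first exact: cfun_cst.
by apply: cfun_prod => k; exact: hM.
Qed.

(** The cofactor formula defines an inverse by polynomials, up to one real
   division. *)
Lemma mxfun_invdet p (M : X -> 'M[R[i]]_p) : mxfun M ->
  A (fun x => (normsq (\det (M x)))^-1) ->
  mxfun (fun x => (\det (M x))^-1 *: \adj (M x)).
Proof.
move=> hM hd; apply: mxfun_scale; first by apply: cfun_inv => //; exact: cfun_det.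
move=> i j; under eq_fun do rewrite mxE.
apply: cfun_mul; first exact: cfun_cst.
apply: cfun_det => k l; under eq_fun do rewrite !mxE.
exact: hM.
Qed.

End FunctionAlgebra.

(** * Limits and derivatives of complex matrices *)

Section MatrixLimits.
Context {R : realType} {J : Type} (F : set_system J) {FF : Filter F}.

(** A function and its limit are packed into one function on [option J], the
   limit being its value at [None]; in this form convergence is a property
   closed under sums and products. *)
Definition cvg_fun (f : option J -> R) := (fun j => f (Some j)) @ F --> f None.

Lemma cvg_fun_algebra : fun_algebra cvg_fun.
Proof.
split=> [c|f g hf hg|f g hf hg]; first exact: cvg_cst.
  exact: cvgD.
exact: cvgM.
Qed.

Let pack n (X : J -> 'M[R[i]]_n) A (o : option J) := oapp X A o.

Lemma cmx_cvgP n (X : J -> 'M[R[i]]_n) A :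
  cmx_cvg F X A <-> mxfun cvg_fun (pack X A).
Proof. by []. Qed.

Lemma cmx_cvg_cst n (A : 'M[R[i]]_n) : cmx_cvg F (fun=> A) A.
Proof. by move=> i j; split; exact: cvg_cst. Qed.

Lemma cmx_cvg_ext n (X Y : J -> 'M[R[i]]_n) A : X =1 Y ->
  cmx_cvg F X A -> cmx_cvg F Y A.
Proof. by move=> /funext ->. Qed.

Lemma cmx_cvg_near n (X Y : J -> 'M[R[i]]_n) A :
  (\forall s \near F, X s = Y s) -> cmx_cvg F X A -> cmx_cvg F Y A.
Proof.
move=> XY hX i j; have [h1 h2] := hX i j; split.
  by apply: cvg_trans h1; apply: near_eq_cvg; near=> s; rewrite (near XY s).
by apply: cvg_trans h2; apply: near_eq_cvg; near=> s; rewrite (near XY s).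
Unshelve. all: by end_near.
Qed.

Lemma cmx_cvg_add n (X Y : J -> 'M[R[i]]_n) A B :
  cmx_cvg F X A -> cmx_cvg F Y B -> cmx_cvg F (fun s => X s + Y s) (A + B).
Proof.
move=> /cmx_cvgP hX /cmx_cvgP hY.
exact: (mxfun_add cvg_fun_algebra hX hY).
Qed.

Lemma cmx_cvg_sub n (X Y : J -> 'M[R[i]]_n) A B :
  cmx_cvg F X A -> cmx_cvg F Y B -> cmx_cvg F (fun s => X s - Y s) (A - B).
Proof.
move=> /cmx_cvgP hX /cmx_cvgP hY.
exact: (mxfun_sub cvg_fun_algebra hX hY).
Qed.

Lemma cmx_cvg_mul n (X Y : J -> 'M[R[i]]_n) A B :
  cmx_cvg F X A -> cmx_cvg F Y B -> cmx_cvg F (fun s => X s *m Y s) (A *m B).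
Proof.
move=> /cmx_cvgP hX /cmx_cvgP hY.
exact: (mxfun_mul cvg_fun_algebra hX hY).
Qed.

Lemma cmx_cvg_adj n (X : J -> 'M[R[i]]_n) A :
  cmx_cvg F X A -> cmx_cvg F (fun s => (X s)^t*) (A^t*).
Proof. by move=> /cmx_cvgP hX; exact: (mxfun_adj cvg_fun_algebra hX). Qed.

Lemma cmx_cvg_det n (X : J -> 'M[R[i]]_n) A : cmx_cvg F X A ->
  normsq (\det (X s)) @[s --> F] --> normsq (\det A).
Proof.
move=> /cmx_cvgP hX; have [h1 h2] := cfun_det cvg_fun_algebra hX.
by apply: cvgD; exact: cvgM.
Qed.

Lemma cmx_cvg_unit n (X : J -> 'M[R[i]]_n) A : cmx_cvg F X A ->
  A \in unitmx -> \forall s \near F, X s \in unitmx.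
Proof.
move=> /cmx_cvg_det hX; rewrite unitmxE unitfE -normsq_eq0 => dA.
have d0 : 0 < normsq (\det A).
  by rewrite lt_neqAle eq_sym dA addr_ge0 ?sqr_ge0.
have : \forall s \near F, 0 < normsq (\det (X s)).
  exact: (cvgr_gt _ hX).
apply: filterS => s hs.
by rewrite unitmxE unitfE -normsq_eq0 gt_eqF.
Qed.

Lemma cmx_cvg_inv n (X : J -> 'M[R[i]]_n) A : cmx_cvg F X A ->
  A \in unitmx -> cmx_cvg F (fun s => invmx (X s)) (invmx A).
Proof.
move=> hX uA; have hd := cmx_cvg_det hX; have hu := cmx_cvg_unit hX uA.
have dA : normsq (\det A) != 0 by rewrite normsq_eq0 -unitfE -unitmxE.
apply: (@cmx_cvg_near _ (fun s => (\det (X s))^-1 *: \adj (X s))).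
  by apply: filterS hu => s hs; rewrite /invmx hs.
rewrite /invmx uA.
move: hX => /cmx_cvgP hX; apply: (mxfun_invdet cvg_fun_algebra hX).
exact: cvgV.
Qed.

End MatrixLimits.

Section MatrixDerivatives.
Context {R : realType}.

Lemma is_derive_cvg (f : R -> R) t d : is_derive t (1 : R) f d <->
  h^-1 * (f (h + t) - f t) @[h --> (0 : R)^'] --> d.
Proof.
have E : (fun h => h^-1 *: ((f \o shift t) (h *: (1 : R)) - f t)) =
    (fun h => h^-1 * (f (h + t) - f t)).
  by apply/funext => h; rewrite /= /GRing.scale /= mulr1.
split=> [[df <-]|h]; first by rewrite -E; exact: df.
rewrite -E in h; apply: DeriveDef; first by apply/cvg_ex; exists d.
exact/cvg_lim.
Qed.

Lemma cmx_is_deriveP n (X : R -> 'M[R[i]]_n) t D : cmx_is_derive X t D <->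
  cmx_cvg (0 : R)^' (fun h => (h^-1)%:C *: (X (h + t) - X t)) D.
Proof.
have E i j h : ((h^-1)%:C *: (X (h + t) - X t)) i j =
    (h^-1)%:C * (X (h + t) i j - X t i j) by rewrite !mxE.
split=> hX i j; have [h1 h2] := hX i j; split.
- under eq_fun do rewrite E ReZ ReD ReN; exact/is_derive_cvg.
- under eq_fun do rewrite E ImZ ImD ImN; exact/is_derive_cvg.
- move: h1; under eq_fun do rewrite E ReZ ReD ReN; move=> h1.
  exact/is_derive_cvg.
- move: h2; under eq_fun do rewrite E ImZ ImD ImN; move=> h2.
  exact/is_derive_cvg.
Qed.

Lemma cmx_is_derive_cvg n (X : R -> 'M[R[i]]_n) t D : cmx_is_derive X t D ->
  cmx_cvg (0 : R)^' (fun h => X (h + t)) (X t).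
Proof.
move=> hX i j; have [h1 h2] := hX i j.
have aux (f : R -> R) d : is_derive t (1 : R) f d ->
    f (h + t) @[h --> (0 : R)^'] --> f t.
  move=> df; have /differentiable_continuous cf : differentiable f t.
    by apply/derivable1_diffP; case: df.
  apply: cvg_trans (_ : f (h + t) @[h --> (0 : R)] --> f t).
    by apply: cvg_app; exact: cvg_within.
  have hc : h + t @[h --> (0 : R)] --> 0 + t.
    by apply: cvgD; [exact: cvg_id|exact: cvg_cst].
  by rewrite add0r in hc; exact: (@cvg_comp _ _ _ (fun h : R => h + t) f _ _ _ hc cf).
by split; [exact: aux h1|exact: aux h2].
Qed.

Lemma cmx_is_derive_cst n (A : 'M[R[i]]_n) t : cmx_is_derive (fun=> A) t 0.
Proof. by move=> i j; rewrite !mxE; split; exact: is_derive_cst. Qed.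

Lemma cmx_is_derive_mul n (X Y : R -> 'M[R[i]]_n) t D E :
  cmx_is_derive X t D -> cmx_is_derive Y t E ->
  cmx_is_derive (fun s => X s *m Y s) t (D *m Y t + X t *m E).
Proof.
move=> hX hY; have cX := cmx_is_derive_cvg hX.
move: hX hY => /cmx_is_deriveP hX /cmx_is_deriveP hY; apply/cmx_is_deriveP.
apply: (@cmx_cvg_ext _ _ _ _ (fun h =>
  ((h^-1)%:C *: (X (h + t) - X t)) *m Y t +
  X (h + t) *m ((h^-1)%:C *: (Y (h + t) - Y t)))).
  move=> h; rewrite -scalemxAl -scalemxAr -scalerDr; congr (_ *: _).
  by rewrite mulmxBl mulmxBr addrC subrKA.
apply: cmx_cvg_add; apply: cmx_cvg_mul => //; exact: cmx_cvg_cst.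
Qed.

Lemma cmx_is_derive_add n (X Y : R -> 'M[R[i]]_n) t D E :
  cmx_is_derive X t D -> cmx_is_derive Y t E ->
  cmx_is_derive (fun s => X s + Y s) t (D + E).
Proof.
move=> /cmx_is_deriveP hX /cmx_is_deriveP hY; apply/cmx_is_deriveP.
apply: (@cmx_cvg_ext _ _ _ _ (fun h =>
  (h^-1)%:C *: (X (h + t) - X t) + (h^-1)%:C *: (Y (h + t) - Y t))).
  move=> h; rewrite -scalerDr; congr (_ *: _).
  by rewrite opprD addrACA.
exact: cmx_cvg_add.
Qed.

Lemma cmx_is_derive_mull n (A : 'M[R[i]]_n) (Y : R -> 'M[R[i]]_n) t E :
  cmx_is_derive Y t E -> cmx_is_derive (fun s => A *m Y s) t (A *m E).
Proof.
by move=> /(cmx_is_derive_mul (cmx_is_derive_cst A t)); rewrite mul0mx add0r.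
Qed.

Lemma cmx_is_derive_mulr n (A : 'M[R[i]]_n) (Y : R -> 'M[R[i]]_n) t E :
  cmx_is_derive Y t E -> cmx_is_derive (fun s => Y s *m A) t (E *m A).
Proof.
move=> h; have := cmx_is_derive_mul h (cmx_is_derive_cst A t).
by rewrite mulmx0 addr0.
Qed.

Lemma cmx_is_derive_adj n (X : R -> 'M[R[i]]_n) t D :
  cmx_is_derive X t D -> cmx_is_derive (fun s => (X s)^t*) t (D^t*).
Proof.
move=> hX i j; have [h1 h2] := hX j i; rewrite !mxE.
split.
  by rewrite Re_conj; under eq_fun do rewrite !mxE Re_conj.
rewrite Im_conj; under eq_fun do rewrite !mxE Im_conj.
exact: is_deriveN.
Qed.

Lemma cmx_is_derive_inv n (X : R -> 'M[R[i]]_n) t D :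
  X t \in unitmx -> cmx_is_derive X t D ->
  cmx_is_derive (fun s => invmx (X s)) t (- (invmx (X t) *m D *m invmx (X t))).
Proof.
move=> ut hX.
have cX := cmx_is_derive_cvg hX.
have cV := cmx_cvg_inv cX ut.
have nX := cmx_cvg_unit cX ut.
have F0 : Filter (0 : R)^' by exact: _.
move: hX => /cmx_is_deriveP hX; apply/cmx_is_deriveP.
apply: (@cmx_cvg_near _ _ _ _ _ (fun h =>
  0 - invmx (X (h + t)) *m ((h^-1)%:C *: (X (h + t) - X t)) *m invmx (X t))).
  apply: filterS (nX F0) => h uh.
  rewrite sub0r -scalemxAr -scalemxAl -scalerN; congr (_ *: _).
  by rewrite mulmxBr mulmxBl mulVmx// mul1mx mulmxK// opprB.
rewrite -[X in cmx_cvg _ _ X]sub0r; apply: cmx_cvg_sub; first exact: cmx_cvg_cst.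
apply: cmx_cvg_mul; last exact: cmx_cvg_cst.
exact: cmx_cvg_mul (cV F0) hX.
Qed.

End MatrixDerivatives.

(** * Unitary and skew-Hermitian matrices, Cayley transform *)

Section Adjoint.
Context {R : realType} {n : nat}.
Implicit Types A B K Z U : 'M[R[i]]_n.

Lemma adjM A B : (A *m B)^t* = B^t* *m A^t*.
Proof. by rewrite trmx_mul map_mxM. Qed.
Lemma adjD A B : (A + B)^t* = A^t* + B^t*.
Proof. by rewrite linearD/= map_mxD. Qed.
Lemma adjN A : (- A)^t* = - A^t*.
Proof. by rewrite linearN/= map_mxN. Qed.
Lemma adjB A B : (A - B)^t* = A^t* - B^t*.
Proof. by rewrite adjD adjN. Qed.
Lemma adj0 : (0 : 'M[R[i]]_n)^t* = 0.
Proof. by rewrite trmx0 map_mx0. Qed.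
Lemma adj1 : (1%:M : 'M[R[i]]_n)^t* = 1%:M.
Proof. by rewrite trmx1 map_mx1. Qed.
Lemma adjZ (c : R) A : (c%:C *: A)^t* = c%:C *: A^t*.
Proof.
apply/matrixP => i j; rewrite !mxE rmorphM; congr (_ * _).
by apply: complex_ext; rewrite ?Re_conj// Im_conj /= oppr0.
Qed.
Lemma adjK A : (A^t*)^t* = A.
Proof. by apply/matrixP => i j; rewrite !mxE conjCK. Qed.
Lemma adj_sum (J : Type) (r : seq J) (P : pred J) (F : J -> 'M[R[i]]_n) :
  (\sum_(j <- r | P j) F j)^t* = \sum_(j <- r | P j) (F j)^t*.
Proof. by elim/big_rec2: _ => [|j A B _ <-]; rewrite ?adj0 ?adjD. Qed.

Lemma unitarymxK U : U \is unitarymx -> U *m U^t* = 1%:M.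
Proof. by move=> /unitarymxP. Qed.
Lemma unitarymxVK U : U \is unitarymx -> U^t* *m U = 1%:M.
Proof. by move=> /unitarymxP /mulmx1C. Qed.

Lemma unitary_adj U : U \is unitarymx -> U^t* \is unitarymx.
Proof. by rewrite trmxC_unitary. Qed.

(** The square of the Frobenius norm. *)
Definition sqnorm A : R := \sum_i \sum_j normsq (A i j).

Lemma normsq_ge0 (z : R[i]) : 0 <= normsq z.
Proof. by rewrite addr_ge0 ?sqr_ge0. Qed.

Lemma sqnorm_ge0 A : 0 <= sqnorm A.
Proof. by do 2![apply: sumr_ge0 => ? _]; exact: normsq_ge0. Qed.

Lemma sqnormE A : sqnorm A = complex.Re (\tr (A *m A^t*)).
Proof.
rewrite Re_sum; apply: eq_bigr => i _; rewrite mxE Re_sum; apply: eq_bigr => j _.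
by rewrite !mxE ReM Re_conj Im_conj mulrN opprK -!expr2.
Qed.

Lemma normsq_le_sqnorm A i j : normsq (A i j) <= sqnorm A.
Proof.
rewrite /sqnorm (bigD1 i)//= (bigD1 j)//= -addrA lerDl addr_ge0//.
  by apply: sumr_ge0 => k _; exact: normsq_ge0.
by do 2![apply: sumr_ge0 => ? _]; exact: normsq_ge0.
Qed.

Lemma sqnorm_eq0 A : sqnorm A = 0 -> A = 0.
Proof.
move=> h; apply/matrixP => i j; rewrite mxE; apply/eqP.
rewrite -normsq_eq0 eq_le normsq_ge0 andbT -h; exact: normsq_le_sqnorm.
Qed.

Lemma mul_adj_eq0 A : A *m A^t* = 0 -> A = 0.
Proof. by move=> h; apply: sqnorm_eq0; rewrite sqnormE h mxtrace0. Qed.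

Lemma sqnorm_unitary U : U \is unitarymx -> sqnorm U = n%:R.
Proof.
move=> /unitarymxK h; rewrite sqnormE h mxtrace1.
by elim: n => // k IH; rewrite -natr1 ReD IH -natr1.
Qed.

Lemma sqnorm_skew K : skew_hermitian K -> sqnorm K = - complex.Re (\tr (K *m K)).
Proof. by move=> hK; rewrite sqnormE hK mulmxN linearN /= ReN. Qed.

(** If the rows of M are fixed by K, then M M^dagger = M K M^dagger is both
   Hermitian and skew-Hermitian, so it vanishes and M = 0. *)
Lemma skew_sub_unit K : skew_hermitian K -> 1%:M - K \in unitmx.
Proof.
move=> hK; rewrite -row_free_unit -kermx_eq0; apply/eqP.
move: (mulmx_ker (1%:M - K)); move: (kermx _) => M.
rewrite mulmxBr mulmx1 => /eqP; rewrite subr_eq0 => /eqP MK.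
apply: mul_adj_eq0.
have PN : M *m M^t* = - (M *m M^t*).
  have h : (M *m K *m M^t*)^t* = - (M *m K *m M^t*).
    by rewrite !adjM adjK hK mulmxA mulmxN mulNmx.
  by rewrite -MK adjM adjK in h.
apply/eqP; have : (M *m M^t*) *+ 2 == 0 by rewrite mulr2n [X in _ + X]PN subrr.
by rewrite -scaler_nat scaler_eq0 pnatr_eq0.
Qed.

Lemma skewN K : skew_hermitian K -> skew_hermitian (- K).
Proof. by rewrite /skew_hermitian /= adjN => ->. Qed.

Lemma skew_add_unit K : skew_hermitian K -> 1%:M + K \in unitmx.
Proof. by move=> /skewN /skew_sub_unit; rewrite opprK. Qed.

Lemma skew_conj K U : skew_hermitian K -> skew_hermitian (U^t* *m K *m U).
Proof.
by move=> hK; rewrite /skew_hermitian /= !adjM adjK hK mulNmx mulmxN mulmxA.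
Qed.

End Adjoint.

Section Cayley.
Context {R : realType} {n : nat}.
Implicit Types K Z U B : 'M[R[i]]_n.

Definition cayley Z := 1%:M - invmx (Z + 1%:M) *+ 2.
Definition cayley_inv K := (1%:M + K) *m invmx (1%:M - K).

Lemma in_W_unit Z : in_W Z -> Z + 1%:M \in unitmx.
Proof. by case=> _; rewrite unitmxE unitfE addrC. Qed.

(** With W = (Z + 1)^-1 one has W^dagger = Z W = 1 - W, so the adjoint of 1 -
   2 W is - (1 - 2 W). *)
Lemma cayley_skew Z : in_W Z -> skew_hermitian (cayley Z).
Proof.
move=> hZ; have u1 := in_W_unit hZ; have [uZ _] := hZ.
set W := invmx (Z + 1%:M).
have WZ : W *m (Z + 1%:M) = 1%:M by rewrite mulVmx.
have ZW : (Z + 1%:M) *m W = 1%:M by rewrite mulmxV.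
have WE : W^t* = Z *m W.
  have h1 : W^t* *m (Z^t* + 1%:M) = 1%:M.
    by rewrite -[X in _ + X]adj1 -adjD -adjM ZW adj1.
  have h2 : (Z^t* + 1%:M) *m (Z *m W) = 1%:M.
    by rewrite mulmxDl mulmxA unitarymxVK// mul1mx mul1mx -[X in X + _]mul1mx -mulmxDl addrC.
  by rewrite -[LHS]mulmx1 -h2 mulmxA h1 mul1mx.
rewrite /skew_hermitian /= /cayley -/W adjB adj1 -scaler_nat.
rewrite (_ : 2 = (2 : R)%:C) ?adjZ; last by rewrite rmorph_nat.
rewrite rmorph_nat WE opprB.
have -> : Z *m W = 1%:M - W by rewrite -ZW mulmxDl mul1mx addrK.
by rewrite scalerBr opprB addrCA (_ : 1%:M - 2 *: 1%:M = - 1%:M)//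
  scaler_nat mulr2n opprD addrA subrr add0r.
Qed.

(** The relation Z (1 - K) = 1 + K contains no inverse and determines Z and K
   from each other; the facts about the chart are derived from it. *)
Lemma cayleyP Z : in_W Z -> Z *m (1%:M - cayley Z) = 1%:M + cayley Z.
Proof.
move=> hZ; have u1 := in_W_unit hZ; rewrite /cayley.
rewrite opprB addrCA subrr addr0.
have -> : Z *m (invmx (Z + 1%:M) *+ 2) =
    (Z + 1%:M) *m (invmx (Z + 1%:M) *+ 2) - invmx (Z + 1%:M) *+ 2.
  by rewrite mulmxDl mul1mx addrK.
by rewrite -scaler_nat -scalemxAr mulmxV// !scaler_nat [X in X - _ = _]mulr2n addrA.
Qed.

Lemma cayley_invP K : skew_hermitian K ->
  cayley_inv K *m (1%:M - K) = 1%:M + K.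
Proof. by move=> /skew_sub_unit u; rewrite /cayley_inv mulmxKV. Qed.

Section Chart.
Variables Z K : 'M[R[i]]_n.
Hypotheses (hK : skew_hermitian K) (ZK : Z *m (1%:M - K) = 1%:M + K).

Lemma chart_comm : (1%:M - K) *m (1%:M + K) = (1%:M + K) *m (1%:M - K).
Proof.
by rewrite mulmxBl mulmxDl !mul1mx !mulmxDr mulmxN !mulmx1 opprD !addrA addrK subrK.
Qed.

Lemma chart_double : (Z + 1%:M) *m (1%:M - K) = 1%:M *+ 2.
Proof. by rewrite mulmxDl ZK mul1mx addrACA subrr addr0 mulr2n. Qed.

Lemma chart_half : (Z + 1%:M) *m (2^-1 *: (1%:M - K)) = 1%:M.
Proof.
by rewrite -scalemxAr chart_double -[1%:M *+ 2]scaler_nat scalerA mulVf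
  ?scale1r// pnatr_eq0.
Qed.

Lemma chart_unit : Z + 1%:M \in unitmx.
Proof. by have [] := mulmx1_unit chart_half. Qed.

Lemma chart_inv : invmx (Z + 1%:M) = 2^-1 *: (1%:M - K).
Proof. by rewrite -[RHS](mulKmx chart_unit) chart_half mulmx1. Qed.

Lemma chart_cayley : cayley Z = K.
Proof.
rewrite /cayley chart_inv -[(_ *: _) *+ 2]scaler_nat scalerA divff ?pnatr_eq0// scale1r.
by rewrite opprB addrCA subrr addr0.
Qed.

(** Z commutes with 1 + K, and the adjoint of the relation reads (1 + K)
   Z^dagger = 1 - K. *)
Lemma chart_unitary : Z \is unitarymx.
Proof.
have u := skew_sub_unit hK; have u' := skew_add_unit hK.
have h : (1%:M + K) *m Z^t* = 1%:M - K.
  have : (Z *m (1%:M - K))^t* = (1%:M + K)^t* by rewrite ZK.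
  by rewrite adjM adjB adjD adj1 hK opprK.
have comm : Z *m (1%:M + K) = (1%:M + K) *m Z.
  rewrite -[LHS](mulmxK u) -[RHS](mulmxK u); congr (_ *m _).
  by rewrite -!mulmxA -chart_comm !mulmxA ZK -mulmxA ZK.
by apply/unitarymxP; rewrite -[LHS](mulKmx u') (mulmxA _ Z) -comm -(mulmxA Z) h ZK mulVmx.
Qed.

Lemma chart_in_W : in_W Z.
Proof.
split; first exact: chart_unitary.
by have := chart_unit; rewrite unitmxE unitfE addrC.
Qed.

Lemma chart_cayley_inv : Z = cayley_inv K.
Proof. by rewrite /cayley_inv -ZK mulmxK// skew_sub_unit. Qed.

End Chart.

Lemma cayley_inv_cvg1 (J : Type) (F : set_system J) {FF : Filter F}
    (K : J -> 'M[R[i]]_n) : cmx_cvg F K 0 ->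
  cmx_cvg F (fun s => cayley_inv (K s)) 1%:M.
Proof.
move=> hK; have c1 := @cmx_cvg_cst R J F FF n 1%:M.
rewrite -[X in cmx_cvg _ _ X]mulmx1 -[X in cmx_cvg _ _ (_ *m X)]invmx1.
rewrite -[X in cmx_cvg _ _ (X *m _)]addr0 -[X in invmx X]subr0.
apply: cmx_cvg_mul; first exact: cmx_cvg_add.
by apply: cmx_cvg_inv; [exact: cmx_cvg_sub|rewrite subr0 unitmx1].
Qed.

Lemma cayley_cvg0 (J : Type) (F : set_system J) {FF : Filter F}
    (Z : J -> 'M[R[i]]_n) : cmx_cvg F Z 1%:M ->
  cmx_cvg F (fun s => cayley (Z s)) 0.
Proof.
move=> hZ; have c1 := @cmx_cvg_cst R J F FF n 1%:M.
have two : (1%:M + 1%:M : 'M[R[i]]_n) = 2 *: 1%:M by rewrite scaler_nat mulr2n.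
have u2 : (2 : R[i]) \is a GRing.unit by rewrite unitfE pnatr_eq0.
have h2 : invmx (1%:M + 1%:M : 'M[R[i]]_n) *+ 2 = 1%:M.
  rewrite two invmxZ ?unitmxZ ?unitmx1// invmx1 -[(_ *: _) *+ 2]scaler_nat.
  by rewrite scalerA divrr// scale1r.
rewrite -[X in cmx_cvg _ _ X](subrr 1%:M) -[X in _ - X]h2.
apply: cmx_cvg_sub => //; rewrite mulr2n.
have hi : cmx_cvg F (fun s => invmx (Z s + 1%:M)) (invmx (1%:M + 1%:M)).
  apply: cmx_cvg_inv; first exact: cmx_cvg_add.
  by rewrite two unitmxZ ?unitmx1.
by under eq_fun do rewrite mulr2n; exact: cmx_cvg_add.
Qed.

End Cayley.

(** * The feedback in the Cayley chart *)

Section ChartDynamics.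
Context {R : realType} {n m : nat}.
Variables (S : 'I_m -> 'M[R[i]]_n) (f : 'I_m -> R).
Implicit Types B K Z : 'M[R[i]]_n.

(** The trace in the feedback law up to a constant factor, see
   [feedback_chart]. *)
Definition chart_feedback B K k : R :=
  complex.Re (\tr ((1%:M + K) *m K *m (1%:M - K) *m (B^t* *m S k *m B))).

(** The part of the dynamics due to the feedback, seen from the frame B that
   moves with the reference. *)
Definition damping B K : 'M[R[i]]_n :=
  \sum_k (f k / 4 * chart_feedback B K k)%:C *: (B^t* *m S k *m B).

Definition drift (u : 'I_m -> R) : 'M[R[i]]_n := \sum_k (u k)%:C *: S k.

(** The velocity damping B K *m Z of Z, transported by the Cayley transform. *)
Definition chart_field B K : 'M[R[i]]_n :=
  (2^-1 : R)%:C *: ((1%:M - K) *m damping B K *m (1%:M + K)).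

(** With W = (Z + 1)^-1 = (1 - K) / 2 one finds Z W = (1 + K) / 2 and (Z - 1)
   W = K. Besides (Z - 1) W the trace contains the factors Z W and W, which
   contribute 1/2 each. *)
Lemma feedback_chart B Z K k : B \is unitarymx -> skew_hermitian K ->
  Z *m (1%:M - K) = 1%:M + K ->
  feedback S f B (B *m Z) k = f k / 4 * chart_feedback B K k.
Proof.
move=> uB hK ZK; rewrite /feedback -mulrA; congr (_ * _).
rewrite mulmxA unitarymxVK// mul1mx.
set W := 2^-1 *: (1%:M - K).
have WE : invmx (Z + 1%:M) = W by exact: chart_inv ZK.
have uZ : Z + 1%:M \in unitmx := chart_unit ZK.
have ZWE : Z *m W = 2^-1 *: (1%:M + K) by rewrite -scalemxAr ZK.
have Z1WE : (Z - 1%:M) *m W = K.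
  rewrite mulmxBl ZWE mul1mx -scalerBr opprB addrC addrA subrK -mulr2n.
  by rewrite -[K *+ 2]scaler_nat scalerA mulVf ?scale1r// pnatr_eq0.
have inv3 : invmx ((Z + 1%:M) ^+ 3) = W *m W *m W.
  have e3 : (Z + 1%:M) ^+ 3 = (Z + 1%:M) *m (Z + 1%:M) *m (Z + 1%:M).
    by rewrite !exprS expr0 mulr1; exact: mulmxA.
  have u3 : (Z + 1%:M) ^+ 3 \in unitmx by rewrite e3 !unitmx_mul uZ.
  rewrite -[RHS](mulKmx u3) [X in _ *m (X *m _)]e3.
  have ZW1 : (Z + 1%:M) *m W = 1%:M by rewrite -WE mulmxV.
  rewrite -!mulmxA [X in _ *m (_ *m (_ *m X))](mulmxA (Z + 1%:M) W) ZW1 mul1mx.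
  by rewrite [X in _ *m (_ *m X)](mulmxA (Z + 1%:M) W) ZW1 mul1mx ZW1 mulmx1.
rewrite inv3 -!mulmxA mxtrace_mulC -!mulmxA.
rewrite (mulmxA (Z - 1%:M) W) Z1WE.
have KW : K *m W = W *m K.
  by rewrite -scalemxAr -scalemxAl mulmxBr mulmxBl mulmx1 mul1mx.
rewrite (mulmxA K W) KW -(mulmxA W K) (mulmxA Z W) ZWE.
rewrite -!scalemxAl -!scalemxAr !linearZ /= mulrA.
rewrite (_ : 2^-1 * 2^-1 = (4^-1 : R)%:C); last first.
  by rewrite fmorphV rmorph_nat -invfM -natrM.
by rewrite ReZ /chart_feedback !mulmxA.
Qed.

Hypothesis hS : forall k, skew_hermitian (S k).

Lemma skew_sum (J : Type) (r : seq J) (P : pred J) (c : J -> R)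
    (F : J -> 'M[R[i]]_n) :
  (forall j, skew_hermitian (F j)) ->
  skew_hermitian (\sum_(j <- r | P j) (c j)%:C *: F j).
Proof.
move=> hF; rewrite /skew_hermitian /= adj_sum -sumrN; apply: eq_bigr => j _.
by rewrite adjZ hF scalerN.
Qed.

Lemma damping_skew B K : skew_hermitian (damping B K).
Proof. by apply: skew_sum => k; exact: skew_conj. Qed.

Lemma drift_skew u : skew_hermitian (drift u).
Proof. exact: skew_sum. Qed.

Lemma chart_field_skew B K : skew_hermitian K ->
  skew_hermitian (chart_field B K).
Proof.
move=> hK; rewrite /skew_hermitian /= adjZ -scalerN; congr (_ *: _).
by rewrite !adjM adjD adjB adj1 hK opprK damping_skew mulNmx mulmxN mulmxA.
Qed.

(** Moving 1 + K around the trace turns it into the sum of f k / 4 times the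
   squares of the feedback traces. For skew-Hermitian K the real part of tr
   (K K) is - sqnorm K [sqnorm_skew], so this inequality says that sqnorm K
   does not increase along the chart dynamics. *)
Lemma dissipation B K : (forall k, 0 < f k) ->
  0 <= complex.Re (\tr (K *m chart_field B K)).
Proof.
move=> hf; rewrite -scalemxAr linearZ /= ReZ mulr_ge0 ?invr_ge0//.
rewrite mulmxA mxtrace_mulC.
have -> : (1%:M + K) *m (K *m ((1%:M - K) *m damping B K)) =
    \sum_k (f k / 4 * chart_feedback B K k)%:C *:
      ((1%:M + K) *m K *m (1%:M - K) *m (B^t* *m S k *m B)).
  by rewrite !mulmxA mulmx_sumr; apply: eq_bigr => k _; rewrite -scalemxAr.
have RtD (X Y : 'M[R[i]]_n) : complex.Re (\tr (X + Y)) =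
  complex.Re (\tr X) + complex.Re (\tr Y) by rewrite mxtraceD ReD.
have Rt0 : complex.Re (\tr (0 : 'M[R[i]]_n)) = 0 by rewrite mxtrace0.
rewrite (big_morph (fun X => complex.Re (\tr X)) RtD Rt0).
apply: sumr_ge0 => k _.
rewrite linearZ /= ReZ -/(chart_feedback B K k) -mulrA -expr2 mulr_ge0 ?sqr_ge0//.
by rewrite divr_ge0// ltW.
Qed.

End ChartDynamics.

(** * Truncation of the chart dynamics *)

Section Coordinates.
Context {R : realType} {n : nat}.
Implicit Types B Q : 'M[R[i]]_n.

(** The first boolean selects the reference (true) or the Cayley coordinate
   (false), the second one the imaginary or the real part. *)
Definition coord_index := (bool * bool * ('I_n * 'I_n))%type.

Definition coords B Q (i : coord_index) : R :=
  let z := (if i.1.1 then B else Q) i.2.1 i.2.2 in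
  if i.1.2 then complex.Im z else complex.Re z.

Definition mx_of (c : bool) (x : coord_index -> R) : 'M[R[i]]_n :=
  \matrix_(i, j) (x (c, false, (i, j)) +i* x (c, true, (i, j))).

(** Projection on the skew-Hermitian matrices: inserted in the field, it makes
   them invariant without assuming that the argument is skew-Hermitian. *)
Definition skew_part Q := (2^-1 : R)%:C *: (Q - Q^t*).

Lemma mx_of_coords c B Q : mx_of c (coords B Q) = if c then B else Q.
Proof. by apply/matrixP => i j; rewrite mxE; case: c => /=; apply: complex_ext. Qed.

Lemma coords_mx_of x : coords (mx_of true x) (mx_of false x) = x.
Proof.
by apply/funext => -[[[] []] [i j]]; rewrite /coords /= mxE.
Qed.

Lemma skew_part_skew Q : skew_hermitian (skew_part Q).
Proof.
by rewrite /skew_hermitian /= adjZ adjB adjK -scalerN opprB.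
Qed.

Lemma skew_partE K : skew_hermitian K -> skew_part K = K.
Proof.
move=> hK; rewrite /skew_part hK opprK -mulr2n -[K *+ 2]scaler_nat scalerA.
by rewrite (_ : _ * 2 = 1) ?scale1r// fmorphV rmorph_nat mulVf// pnatr_eq0.
Qed.

Lemma sum_coords B Q : \sum_i coords B Q i ^+ 2 = sqnorm B + sqnorm Q.
Proof.
rewrite -(pair_bigA _ (fun cp ij => coords B Q (cp, ij) ^+ 2))/=.
rewrite -(pair_bigA _ (fun c p => \sum_j coords B Q (c, p, j) ^+ 2))/=.
have h c : \sum_p \sum_j coords B Q (c, p, j) ^+ 2 =
    sqnorm (if c then B else Q).
  rewrite big_bool /= -big_split /= /sqnorm pair_bigA /=.
  by apply: eq_bigr => -[i j] _; rewrite /coords /= addrC.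
by rewrite big_bool /= !h.
Qed.

Lemma coords_scale (c : R) B Q i :
  coords (c%:C *: B) (c%:C *: Q) i = c * coords B Q i.
Proof.
case: i => -[[] []] [i j]; rewrite /coords /= mxE ?ReZ ?ImZ //.
Qed.

End Coordinates.

Section Cutoff.
Context {R : realType} {I : finType}.

Definition clamp (lo hi y : R) : R := Num.max lo (Num.min hi y).

Lemma clamp_id lo hi y : lo <= y <= hi -> clamp lo hi y = y.
Proof. by move=> /andP[h1 h2]; rewrite /clamp min_r// max_r. Qed.

Lemma clamp_ge lo hi y : lo <= clamp lo hi y.
Proof. by rewrite /clamp le_max lexx. Qed.

Lemma clamp_le lo hi y : lo <= hi -> clamp lo hi y <= hi.
Proof. by move=> h; rewrite /clamp ge_max h ge_min lexx. Qed.

Lemma clamp_lip lo hi y z : `|clamp lo hi y - clamp lo hi z| <= `|y - z|.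
Proof.
rewrite /clamp; wlog yz : y z / y <= z.
  move=> h; have [yz|/ltW yz] := leP y z; first exact: h.
  by rewrite distrC (distrC y); exact: h.
rewrite distrC (distrC y) !ger0_norm ?subr_ge0//; last first.
  by rewrite le_max2// le_min2.
by case: (leP hi z) => ?; case: (leP hi y) => ?; case: (leP lo hi) => ?;
  case: (leP lo y) => ?; case: (leP lo z) => ?; lra.
Qed.

Lemma clamp_norm (b y : R) : 0 <= b -> `|clamp (- b) b y| <= b.
Proof.
move=> b0; rewrite ler_norml clamp_ge clamp_le//.
by rewrite (le_trans _ b0)// oppr_le0.
Qed.

(** A Lipschitz function that is 1 where the squares of the coordinates sum to
   at most b ^+ 2 - 1, and 0 where some coordinate exceeds b in absolute
   value. *)
Definition cutoff (b : R) (x : I -> R) : R :=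
  clamp 0 1 (b ^+ 2 - \sum_i clamp (- b) b (x i) ^+ 2).

Lemma cutoff_ge0 b x : 0 <= cutoff b x.
Proof. exact: clamp_ge. Qed.

Lemma cutoff_neq0 (b : R) x i : 0 <= b -> cutoff b x != 0 -> `|x i| <= b.
Proof.
move=> b0; apply: contraNT; rewrite -ltNge => hx.
have hc : b ^+ 2 <= clamp (- b) b (x i) ^+ 2.
  rewrite -[X in X <= _]ger0_norm ?sqr_ge0// -[X in _ <= X]ger0_norm ?sqr_ge0//.
  rewrite !normrX lerXn2r ?nnegrE// ger0_norm//.
  move: hx; rewrite lter_normr /clamp => /orP[h|h].
    have nb : - b <= b by lra.
    by rewrite (min_l (ltW h)) (max_r nb) ger0_norm.
  have xb : x i <= b by lra.
  have xb' : x i <= - b by lra.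
  by rewrite (min_r xb) (max_l xb') normrN ger0_norm.
rewrite /cutoff /clamp max_l// ge_min; apply/orP; right.
rewrite subr_le0 (le_trans hc)// (bigD1 i)//= lerDl sumr_ge0// => j _.
exact: sqr_ge0.
Qed.

Lemma cutoff_eq1 (b : R) x : 0 <= b -> 1 + \sum_i x i ^+ 2 <= b ^+ 2 ->
  cutoff b x = 1 /\ forall i, clamp (- b) b (x i) = x i.
Proof.
move=> b0 hb.
have hx i : clamp (- b) b (x i) = x i.
  apply: clamp_id; rewrite -ler_norml -(ger0_norm b0) -ler_sqr ?nnegrE//.
  rewrite -!normrX !ger0_norm ?sqr_ge0// (le_trans _ hb)//.
  rewrite (bigD1 i)//= addrCA lerDl addr_ge0//.
  by apply: sumr_ge0 => j _; exact: sqr_ge0.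
split=> //; rewrite /cutoff.
under eq_bigr do rewrite hx.
by rewrite /clamp min_l ?max_r//; lra.
Qed.

End Cutoff.

Section Clip.
Context {R : realType} {m M : nat}.
Implicit Types A : 'M[R]_(m, M).

(** A substitute for random coefficients that is bounded everywhere and equal
   to them almost surely. *)
Definition clip (c : R) A := map_mx (clamp (- c) c) A.

Lemma clip_norm (c : R) A k l : 0 <= c -> `|clip c A k l| <= c.
Proof. by move=> c0; rewrite mxE clamp_norm. Qed.

Lemma clip_id (c : R) A : (forall k l, `|A k l| <= c) -> clip c A = A.
Proof. by move=> h; apply/matrixP => k l; rewrite mxE clamp_id// -ler_norml. Qed.

End Clip.

Section TruncatedField.
Context {R : realType} {n m : nat}.
Variables (S : 'I_m -> 'M[R[i]]_n) (f : 'I_m -> R).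
Local Notation I := (coord_index (n := n)).

Definition clamped (b : R) (x : I -> R) (i : I) : R := clamp (- b) b (x i).

(** Clamping the coordinates makes the polynomial field bounded and Lipschitz;
   the cutoff makes the clamping invisible, see [trunc_fieldE]. *)
Definition trunc_field (b : R) (u : 'I_m -> R) (x : I -> R) (i : I) : R :=
  let B := mx_of true (clamped b x) in
  let K := skew_part (mx_of false (clamped b x)) in
  cutoff b x * coords (drift S u *m B) (chart_field S f B K) i.

Lemma alg_coords (X : Type) (A : (X -> R) -> Prop)
    (B Q : X -> 'M[R[i]]_n) i : mxfun A B -> mxfun A Q ->
  A (fun p => coords (B p) (Q p) i).
Proof.
case: i => -[[] []] [i j] hB hQ; rewrite /coords /=.
- by have [] := hB i j.
- by have [] := hB i j.
- by have [] := hQ i j.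
- by have [] := hQ i j.
Qed.

(** The field is built from the controls and the clamped coordinates by matrix
   operations, so one argument yields both its Lipschitz bounds and the
   measurability of its values. *)
Lemma trunc_field_alg (X : Type) (A : (X -> R) -> Prop) (b : R)
    (u : X -> 'I_m -> R) (x : X -> I -> R) : fun_algebra A ->
  (forall g, A g -> A (fun p => clamp 0 1 (g p))) ->
  (forall k, A (fun p => u p k)) ->
  (forall i, A (fun p => clamp (- b) b (x p i))) ->
  forall i, A (fun p => trunc_field b (u p) (x p) i).
Proof.
move=> hA hc hu hx i.
have hmx c : mxfun A (fun p => mx_of c (clamped b (x p))).
  by move=> j k; split; under eq_fun do rewrite mxE /=; exact: hx.
set B := fun p => mx_of true (clamped b (x p)).
set K := fun p => skew_part (mx_of false (clamped b (x p))).
have hK : mxfun A K.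
  apply: (mxfun_scale hA); first exact: cfun_cst.
  by apply: (mxfun_sub hA) => //; exact: mxfun_adj.
have h1 := mxfun_cst hA (1%:M : 'M[R[i]]_n).
have hBSB k : mxfun A (fun p => (B p)^t* *m S k *m B p).
  apply: (mxfun_mul hA); last exact: hmx.
  apply: (mxfun_mul hA); last exact: mxfun_cst.
  by apply: (mxfun_adj hA); exact: hmx.
have hKp : mxfun A (fun p => 1%:M + K p) by exact: mxfun_add.
have hKm : mxfun A (fun p => 1%:M - K p) by exact: mxfun_sub.
have htau k : A (fun p => chart_feedback S (B p) (K p) k).
  suff [] : cfun A (fun p => \tr ((1%:M + K p) *m K p *m (1%:M - K p)
      *m ((B p)^t* *m S k *m B p))) by [].
  apply: (cfun_tr hA); apply: (mxfun_mul hA) => //.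
  by apply: (mxfun_mul hA) => //; exact: mxfun_mul.
rewrite /trunc_field -/B -/K; apply: (alg_mul hA).
  apply: hc; apply: (alg_sub hA); first exact: alg_cst.
  apply: (alg_sum hA) => j; rewrite (_ : (fun _ => _) =
    fun p => clamp (- b) b (x p j) * clamp (- b) b (x p j)).
    exact: alg_mul.
  by apply/funext => p; rewrite expr2.
apply: alg_coords.
  apply: (mxfun_mul hA); last exact: hmx.
  apply: (mxfun_sum hA) => k; apply: (mxfun_scale hA); last exact: mxfun_cst.
  exact: cfun_real.
apply: (mxfun_scale hA); first exact: cfun_cst.
apply: (mxfun_mul hA) => //; apply: (mxfun_mul hA) => //.
apply: (mxfun_sum hA) => k; apply: (mxfun_scale hA) => //.
by apply: (cfun_real hA); apply: (alg_mul hA) => //; exact: alg_cst.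
Qed.

Variable T : R.

(** Boundedness belongs to the class because it is what makes a product of two
   Lipschitz functions Lipschitz. *)
Definition bounded_lip (g : R * (I -> R) -> R) := exists2 C : R, 0 <= C &
  (forall p, `|g p| <= C) /\
  forall s t x y (e : R), piece T s = piece T t -> `|s - t| <= e ->
    (forall i, `|x i - y i| <= e) -> `|g (s, x) - g (t, y)| <= C * e.

Lemma bounded_lip_le g C : 0 <= C -> (forall p, `|g p| <= C) ->
  (forall s t x y (e : R), 0 <= e -> piece T s = piece T t -> `|s - t| <= e ->
    (forall i, `|x i - y i| <= e) -> `|g (s, x) - g (t, y)| <= C * e) ->
  bounded_lip g.
Proof.
move=> C0 h1 h2; exists C => //; split=> // s t x y e hst hst' hxy.
by apply: h2 => //; exact: le_trans (normr_ge0 _) hst'.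
Qed.

Lemma bounded_lip_algebra : fun_algebra bounded_lip.
Proof.
split.
- move=> c; apply: (@bounded_lip_le _ `|c|) => // s t x y e e0 _ _ _.
  by rewrite subrr normr0 mulr_ge0.
- move=> g h [C C0 [g1 g2]] [D D0 [h1 h2]].
  apply: (@bounded_lip_le _ (C + D)) => [|p|s t x y e e0 p1 p2 p3].
  + exact: addr_ge0.
  + by rewrite (le_trans (ler_normD _ _))// lerD.
  + rewrite opprD addrACA (le_trans (ler_normD _ _))// mulrDl.
    by rewrite lerD//; [exact: g2|exact: h2].
- move=> g h [C C0 [g1 g2]] [D D0 [h1 h2]].
  apply: (@bounded_lip_le _ (C * D + C * D + C * D)) => [|p|s t x y e e0 p1 p2 p3].
  + by rewrite !addr_ge0// mulr_ge0.
  + rewrite normrM (le_trans (ler_pM _ _ (g1 p) (h1 p)))// -addrA lerDl.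
    by rewrite addr_ge0// mulr_ge0.
  + have -> : g (s, x) * h (s, x) - g (t, y) * h (t, y) =
      (g (s, x) - g (t, y)) * h (s, x) + g (t, y) * (h (s, x) - h (t, y)) by ring.
    have CDe : 0 <= C * D * e by rewrite !mulr_ge0.
    rewrite (le_trans (ler_normD _ _))// !normrM.
    have e1 : `|g (s, x) - g (t, y)| * `|h (s, x)| <= C * e * D.
      by rewrite ler_pM// g2.
    have e2 : `|g (t, y)| * `|h (s, x) - h (t, y)| <= C * (D * e).
      by rewrite ler_pM// h2.
    lra.
Qed.

Lemma bounded_lip_clamp lo hi g : bounded_lip g ->
  bounded_lip (fun p => clamp lo hi (g p)).
Proof.
move=> [C C0 [g1 g2]].
apply: (@bounded_lip_le _ (C + `|lo| + `|hi|)) => [|p|s t x y e e0 p1 p2 p3].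
- by rewrite !addr_ge0.
- have l0 := normr_ge0 lo; have h0 := normr_ge0 hi; have gp := g1 p.
  rewrite /clamp; case: (leP hi (g p)) => _.
    by case: (leP lo hi) => _; lra.
  by case: (leP lo (g p)) => _; lra.
- rewrite (le_trans (clamp_lip _ _ _ _))// (le_trans (g2 _ _ _ _ _ p1 p2 p3))//.
  by rewrite ler_wpM2r// -addrA lerDl addr_ge0.
Qed.

Lemma bounded_lip_clamped (b : R) i : 0 <= b ->
  bounded_lip (fun p => clamp (- b) b (p.2 i)).
Proof.
move=> b0; apply: (@bounded_lip_le _ (b + 1)) => [|p|s t x y e e0 p1 p2 p3].
- exact: addr_ge0.
- by rewrite (le_trans (clamp_norm _ b0))// lerDl.
- rewrite (le_trans (clamp_lip _ _ _ _))// (le_trans (p3 i))//.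
  by rewrite mulrDl mul1r lerDr mulr_ge0.
Qed.

Lemma sin_lip (x y : R) : `|sin x - sin y| <= `|x - y|.
Proof.
wlog yx : x y / y <= x.
  move=> h; have [yx|/ltW yx] := leP y x; first exact: h.
  by rewrite distrC (distrC x); exact: h.
have [|c _ ->] := @MVT_segment R sin cos y x yx.
  by apply: continuous_subspaceT => z; exact: continuous_sin.
rewrite normrM ler_piMl// ler_norml.
by rewrite cos_geN1 cos_le1.
Qed.

Lemma ref_control_bounded_lip (M : nat) (a : nat -> 'M[R]_(m, M)) (c : R) k :
  (forall j k l, `|a j k l| <= c) ->
  bounded_lip (fun p => ref_control T a p.1 k).
Proof.
move=> ha; apply: (alg_sum bounded_lip_algebra) => l.
have c0 : 0 <= c by exact: le_trans (normr_ge0 _) (ha 0%N k l).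
apply: (alg_mul bounded_lip_algebra).
  apply: (@bounded_lip_le _ c) => // s t x y e e0 p1 _ _ /=.
  by rewrite -/(piece T s) p1 subrr normr0 mulr_ge0.
set w := _ * (_ / T); apply: (@bounded_lip_le _ (1 + `|w|)) => [|p|s t x y e e0 _ h _ /=].
- by rewrite addr_ge0.
- by rewrite (@le_trans _ _ 1)// ?lerDl// ler_norml sin_geN1 sin_le1.
rewrite (le_trans (sin_lip _ _))// -mulrBr normrM mulrDl mul1r.
by rewrite (@le_trans _ _ (`|w| * e))// ?lerDr// ler_wpM2l.
Qed.

Lemma trunc_field_bounded_lip (M : nat) (a : nat -> 'M[R]_(m, M)) (b c : R) :
  0 <= b -> (forall j k l, `|a j k l| <= c) ->
  exists2 C : R, 0 <= C &
   (forall t x i, `|trunc_field b (ref_control T a t) x i| <= C) /\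
   (forall s t x y (e : R), piece T s = piece T t -> `|s - t| <= e ->
     (forall i, `|x i - y i| <= e) -> forall i,
     `|trunc_field b (ref_control T a s) x i -
       trunc_field b (ref_control T a t) y i| <= C * e).
Proof.
move=> b0 ha.
have /choice[C hC] i : exists C : R, 0 <= C /\
   (forall t x, `|trunc_field b (ref_control T a t) x i| <= C) /\
   (forall s t x y (e : R), piece T s = piece T t -> `|s - t| <= e ->
     (forall i, `|x i - y i| <= e) ->
     `|trunc_field b (ref_control T a s) x i -
       trunc_field b (ref_control T a t) y i| <= C * e).
  have [|k|j|C C0 [h1 h2]] := @trunc_field_alg _ bounded_lip b
    (fun p => ref_control T a p.1) (fun p => p.2) bounded_lip_algebra _ _ _ i.
  - by move=> g; exact: bounded_lip_clamp.
  - exact: ref_control_bounded_lip ha.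
  - exact: bounded_lip_clamped.
  - exists C; split=> //; split=> [t x|]; first exact: (h1 (t, x)).
    exact: h2.
have CS i : C i <= \sum_j C j.
  by rewrite (bigD1 i)//= lerDl sumr_ge0// => j _; case: (hC j).
exists (\sum_i C i); first by apply: sumr_ge0 => j _; case: (hC j).
split=> [t x i|s t x y e p1 p2 p3 i].
  by have [_ [h _]] := hC i; exact: le_trans (h t x) (CS i).
have [_ [_ h]] := hC i; rewrite (le_trans (h _ _ _ _ _ p1 p2 p3))//.
by rewrite ler_wpM2r// (le_trans _ p2).
Qed.

End TruncatedField.

(** * Curves differentiable off the grid *)

Section OffGrid.
Context {R : realType}.
Variable T : R.
Hypothesis hT : 0 < T.

(** The mean value theorem on each period; continuity carries the bound across
   the grid times. *)
Lemma offgrid_nonincreasing (g dg : R -> R) :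
  {within `[0, +oo[, continuous g} ->
  (forall t : R, 0 < t -> (forall j : nat, t != j%:R * T) ->
    is_derive t (1 : R) g (dg t)) ->
  (forall t : R, 0 < t -> (forall j : nat, t != j%:R * T) -> dg t <= 0) ->
  forall t : R, 0 <= t -> g t <= g 0.
Proof.
move=> gc gd dg0.
have step (j : nat) t : j%:R * T <= t <= j.+1%:R * T -> g t <= g (j%:R * T).
  move=> /andP[h1 h2]; have j0 : 0 <= j%:R * T by rewrite mulr_ge0// ltW.
  have off x : x \in `]j%:R * T, t[ -> 0 < x /\ forall k : nat, x != k%:R * T.
    rewrite in_itv/= => /andP[x1 x2]; split=> [|k]; first exact: le_lt_trans x1.
    apply/eqP => xk; move: x1 (lt_le_trans x2 h2).
    by rewrite xk !(ltr_pM2r hT) !ltr_nat ltnS => /leq_trans h /h; rewrite ltnn.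
  rewrite -subr_le0.
  move: h1; rewrite le_eqVlt => /orP[/eqP <-|h1]; first by rewrite subrr.
  have [x /off[]||x /off[x0 xg] ->] := @MVT R g dg _ _ h1.
  - exact: gd.
  - apply: continuous_subspaceW; last exact: gc.
    by move=> x /=; rewrite !in_itv/= andbT => /andP[x1 _]; exact: le_trans x1.
  - by rewrite mulr_le0_ge0 ?dg0// subr_ge0 ltW.
have grid (j : nat) : g (j%:R * T) <= g 0.
  elim: j => [|j IH]; first by rewrite mul0r.
  by rewrite (le_trans _ IH)// step// lexx andbT ler_pM2r// ler_nat.
move=> t t0; have := truncn_itv (divr_ge0 t0 (ltW hT)).
rewrite ler_pdivlMr// ltr_pdivrMr// => /andP[h1 h2].
by apply: le_trans (grid (Num.truncn (t / T))); apply: step; rewrite h1 ltW.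
Qed.

Lemma offgrid_constant (g : R -> R) :
  {within `[0, +oo[, continuous g} ->
  (forall t : R, 0 < t -> (forall j : nat, t != j%:R * T) ->
    is_derive t (1 : R) g 0) ->
  forall t : R, 0 <= t -> g t = g 0.
Proof.
move=> gc gd t t0; apply/eqP; rewrite eq_le; apply/andP; split.
  exact: (@offgrid_nonincreasing g (fun=> 0)).
rewrite -lerN2; apply: (@offgrid_nonincreasing (- g) (fun=> 0)) => //.
- by move=> x; apply: continuousN; exact: gc.
- by move=> s s0 sg; rewrite -oppr0; apply: is_deriveN; exact: gd.
Qed.

End OffGrid.

Section MatrixContinuity.
Context {R : realType} {n : nat}.
Implicit Types X Y : R -> 'M[R[i]]_n.

Lemma cmx_continuous_fromP (t0 : R) X : cmx_continuous_from t0 X <->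
  forall t, t0 <= t -> cmx_cvg (within `[t0, +oo[ (nbhs t)) X (X t).
Proof.
split=> [h t ht i j|h i j].
  have [/subspace_continuousP h1 /subspace_continuousP h2] := h i j.
  by split; [apply: h1|apply: h2]; rewrite /= in_itv/= ht.
split; apply/subspace_continuousP => t /=; rewrite in_itv/= andbT => ht.
  by have [] := h t ht i j.
by have [] := h t ht i j.
Qed.

Lemma continuous_from_cst (t0 : R) (A : 'M[R[i]]_n) :
  cmx_continuous_from t0 (fun=> A).
Proof. by apply/cmx_continuous_fromP => t _; exact: cmx_cvg_cst. Qed.

Lemma continuous_from_mul t0 X Y : cmx_continuous_from t0 X ->
  cmx_continuous_from t0 Y -> cmx_continuous_from t0 (fun t => X t *m Y t).
Proof.
move=> /cmx_continuous_fromP hX /cmx_continuous_fromP hY.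
by apply/cmx_continuous_fromP => t ht; apply: cmx_cvg_mul; [exact: hX|exact: hY].
Qed.

Lemma continuous_from_add t0 X Y : cmx_continuous_from t0 X ->
  cmx_continuous_from t0 Y -> cmx_continuous_from t0 (fun t => X t + Y t).
Proof.
move=> /cmx_continuous_fromP hX /cmx_continuous_fromP hY.
by apply/cmx_continuous_fromP => t ht; apply: cmx_cvg_add; [exact: hX|exact: hY].
Qed.

Lemma continuous_from_sub t0 X Y : cmx_continuous_from t0 X ->
  cmx_continuous_from t0 Y -> cmx_continuous_from t0 (fun t => X t - Y t).
Proof.
move=> /cmx_continuous_fromP hX /cmx_continuous_fromP hY.
by apply/cmx_continuous_fromP => t ht; apply: cmx_cvg_sub; [exact: hX|exact: hY].
Qed.

Lemma continuous_from_adj t0 X : cmx_continuous_from t0 X ->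
  cmx_continuous_from t0 (fun t => (X t)^t*).
Proof.
move=> /cmx_continuous_fromP hX; apply/cmx_continuous_fromP => t ht.
by apply: cmx_cvg_adj; exact: hX.
Qed.

Lemma continuous_from_inv t0 X : cmx_continuous_from t0 X ->
  (forall t : R, t0 <= t -> X t \in unitmx) ->
  cmx_continuous_from t0 (fun t => invmx (X t)).
Proof.
move=> /cmx_continuous_fromP hX uX; apply/cmx_continuous_fromP => t ht.
by apply: cmx_cvg_inv; [exact: hX|exact: uX].
Qed.

Lemma continuous_from_Re_tr t0 X : cmx_continuous_from t0 X ->
  {within `[t0, +oo[, continuous (fun t => complex.Re (\tr (X t)))}.
Proof.
move=> /cmx_continuous_fromP hX; apply/subspace_continuousP => t /=.
rewrite in_itv/= andbT => /hX /cmx_cvgP hXt.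
by have [] := cfun_tr (cvg_fun_algebra (F := within `[t0, +oo[ (nbhs t))) hXt.
Qed.

Lemma is_derive_Re_tr X t D : cmx_is_derive X t D ->
  is_derive t (1 : R) (fun s => complex.Re (\tr (X s))) (complex.Re (\tr D)).
Proof.
move=> hX; rewrite Re_sum.
rewrite (_ : (fun s => _) = \sum_(k < n) (fun s => complex.Re (X s k k))).
  by apply: is_derive_sum => k; have [] := hX k k.
by apply/funext => s; rewrite Re_sum fct_sumE.
Qed.

Lemma offgrid_constant_mx (T : R) X : 0 < T -> cmx_continuous_from 0 X ->
  (forall t : R, 0 < t -> (forall j : nat, t != j%:R * T) -> cmx_is_derive X t 0) ->
  forall t : R, 0 <= t -> X t = X 0.
Proof.
move=> hT hX dX t t0; apply/matrixP => i j; have [h1 h2] := hX i j.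
apply: complex_ext.
  apply: (@offgrid_constant _ T hT (fun s => complex.Re (X s i j))) => // s s0 sg.
  by have [] := dX s s0 sg i j; rewrite !mxE.
apply: (@offgrid_constant _ T hT (fun s => complex.Im (X s i j))) => // s s0 sg.
by have [] := dX s s0 sg i j; rewrite !mxE.
Qed.

Lemma cmx_is_derive_ext X Y t D : X =1 Y -> cmx_is_derive X t D ->
  cmx_is_derive Y t D.
Proof. by move=> /funext ->. Qed.

Lemma cmx_is_derive_shift X (c t : R) D : cmx_is_derive X (c + t) D ->
  cmx_is_derive (fun s => X (c + s)) t D.
Proof.
move=> /cmx_is_deriveP h; apply/cmx_is_deriveP.
by apply: cmx_cvg_ext h => s; rewrite addrCA.
Qed.

Lemma continuous_from_shift X (t0 c : R) : cmx_continuous_from t0 X ->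
  cmx_continuous_from (t0 - c) (fun s => X (c + s)).
Proof.
move=> /cmx_continuous_fromP hX; apply/cmx_continuous_fromP => t ht.
have ct : t0 <= c + t by rewrite -lerBlDl.
have hc : c + s @[s --> within `[t0 - c, +oo[ (nbhs t)] --> within `[t0, +oo[ (nbhs (c + t)).
  have hn : c + s @[s --> nbhs t] --> c + t by apply: cvgD; [exact: cvg_cst|exact: cvg_id].
  move=> P hP.
  have hP' : \forall s \near t, `[t0, +oo[%classic (c + s) -> P (c + s).
    exact: (hn _ hP).
  change (\forall s \near t, `[t0 - c, +oo[%classic s -> P (c + s)).
  apply: filterS hP' => s /= h; rewrite in_itv/= andbT => hs.
  by apply: h; rewrite in_itv/= andbT -lerBlDl.
move=> i j; have [h1 h2] := hX _ ct i j; split.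
  exact: (@cvg_comp _ _ _ (fun s : R => c + s) (fun s => complex.Re (X s i j)) _ _ _ hc h1).
exact: (@cvg_comp _ _ _ (fun s : R => c + s) (fun s => complex.Im (X s i j)) _ _ _ hc h2).
Qed.

End MatrixContinuity.

(** * The flow of the truncated chart dynamics *)

Section CurvesInCoordinates.
Context {R : realType} {n : nat}.
Implicit Types y : R -> coord_index (n := n) -> R.

Lemma Re_mx_of y c i j : (fun t => complex.Re (mx_of c (y t) i j)) =
  (fun t => y t (c, false, (i, j))).
Proof. by apply/funext => t; rewrite mxE. Qed.

Lemma Im_mx_of y c i j : (fun t => complex.Im (mx_of c (y t) i j)) =
  (fun t => y t (c, true, (i, j))).
Proof. by apply/funext => t; rewrite mxE. Qed.

Lemma mx_of_continuous y c (t0 : R) :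
  (forall p, {within `[t0, +oo[, continuous (fun t => y t p)}) ->
  cmx_continuous_from t0 (fun t => mx_of c (y t)).
Proof. by move=> h i j; rewrite Re_mx_of Im_mx_of; split; exact: h. Qed.

Lemma coords_continuous (B K : R -> 'M[R[i]]_n) (t0 : R) p :
  cmx_continuous_from t0 B -> cmx_continuous_from t0 K ->
  {within `[t0, +oo[, continuous (fun t => coords (B t) (K t) p)}.
Proof.
move: p => [[[] []] [i j]] cB cK; rewrite /coords /=.
- by have [] := cB i j.
- by have [] := cB i j.
- by have [] := cK i j.
- by have [] := cK i j.
Qed.

Lemma mx_of_derive y (t : R) D E :
  (forall p, is_derive t (1 : R) (fun s => y s p) (coords D E p)) ->
  cmx_is_derive (fun s => mx_of true (y s)) t D /\
  cmx_is_derive (fun s => mx_of false (y s)) t E.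
Proof.
move=> h; split=> i j; rewrite Re_mx_of Im_mx_of; split.
- exact: (h (true, false, (i, j))).
- exact: (h (true, true, (i, j))).
- exact: (h (false, false, (i, j))).
- exact: (h (false, true, (i, j))).
Qed.

Lemma coords_derive (B K : R -> 'M[R[i]]_n) (t : R) D E p :
  cmx_is_derive B t D -> cmx_is_derive K t E ->
  is_derive t (1 : R) (fun s => coords (B s) (K s) p) (coords D E p).
Proof.
move: p => [[[] []] [i j]] dB dK; rewrite /coords /=.
- by have [] := dB i j.
- by have [] := dB i j.
- by have [] := dK i j.
- by have [] := dK i j.
Qed.

End CurvesInCoordinates.

Section Flow.
Context {R : realType} {n m M : nat}.
Variables (S : 'I_m -> 'M[R[i]]_n) (f : 'I_m -> R) (T : R).
Hypotheses (hS : forall k, skew_hermitian (S k)) (hf : forall k, 0 < f k).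
Hypothesis hT : 0 < T.
Local Notation I := (coord_index (n := n)).

(** Defined for all values of the parameters, so that it can depend measurably
   on them. It solves the chart dynamics when b is large enough, see
   [flow_solution]. *)
Definition flow (a : nat -> 'M[R]_(m, M)) (b : R) (B0 K0 : 'M[R[i]]_n) :
    R -> I -> R :=
  euler_limit T (fun t => trunc_field S f b (ref_control T a t)) (coords B0 K0).

Section Invariants.
Variables (u : R -> 'I_m -> R) (chi : R -> R) (B K : R -> 'M[R[i]]_n).
Hypotheses (chi0 : forall t, 0 <= chi t).
Hypotheses (cB : cmx_continuous_from 0 B) (cK : cmx_continuous_from 0 K).

(** B^dagger B is constant because the drift is skew-Hermitian. The factor chi
   stands for the cutoff in the case of the flow and for 1 in the case of a
   given solution. *)
Lemma reference_unitary : B 0 \is unitarymx ->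
  (forall t : R, 0 < t -> (forall j : nat, t != j%:R * T) ->
    cmx_is_derive B t ((chi t)%:C *: (drift S (u t) *m B t))) ->
  forall t : R, 0 <= t -> B t \is unitarymx.
Proof.
move=> uB0 dB t t0; rewrite -trmxC_unitary; apply/unitarymxP; rewrite adjK.
rewrite -(unitarymxVK uB0).
apply: (@offgrid_constant_mx _ _ T (fun t => (B t)^t* *m B t)) => //.
  by apply: continuous_from_mul => //; exact: continuous_from_adj.
move=> s s0 sg; have h := dB s s0 sg.
have := cmx_is_derive_mul (cmx_is_derive_adj h) h.
rewrite adjZ adjM drift_skew// -scalemxAl -scalemxAr -scalerDr.
by rewrite mulmxN mulNmx mulmxA addNr scaler0.
Qed.

Lemma cayley_decreasing : (forall t : R, 0 <= t -> skew_hermitian (K t)) ->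
  (forall t : R, 0 < t -> (forall j : nat, t != j%:R * T) ->
    cmx_is_derive K t ((chi t)%:C *: chart_field S f (B t) (K t))) ->
  forall t : R, 0 <= t -> sqnorm (K t) <= sqnorm (K 0).
Proof.
move=> sK dK t t0.
rewrite (sqnorm_skew (sK t t0)) (sqnorm_skew (sK 0 (lexx 0))).
pose g t := complex.Re (\tr (K t *m K t)).
have cg : {within `[0, +oo[, continuous g}.
  by apply: continuous_from_Re_tr; exact: continuous_from_mul.
apply: (@offgrid_nonincreasing _ T hT (fun t => - g t) (fun t =>
  - complex.Re (\tr ((chi t)%:C *: chart_field S f (B t) (K t) *m K t +
     K t *m ((chi t)%:C *: chart_field S f (B t) (K t)))))) => //.
- by move=> s; apply: continuousN; exact: cg.
- move=> s s0 sg; apply: is_deriveN; apply: is_derive_Re_tr.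
  by apply: cmx_is_derive_mul; exact: dK.
- move=> s s0 sg; rewrite oppr_le0 mxtraceD mxtrace_mulC ReD.
  rewrite -scalemxAr linearZ /= ReZ.
  by rewrite addr_ge0// mulr_ge0//; exact: dissipation.
Qed.

End Invariants.

Section FlowFacts.
Variables (a : nat -> 'M[R]_(m, M)) (b c : R) (B0 K0 : 'M[R[i]]_n).
Hypotheses (b0 : 0 <= b) (ha : forall j k l, `|a j k l| <= c).

Let x := flow a b B0 K0.
Let B t := mx_of true (x t).
Let Q t := mx_of false (x t).

Lemma flow_continuous : cmx_continuous_from 0 B /\ cmx_continuous_from 0 Q.
Proof.
have [C C0 [h1 h2]] := trunc_field_bounded_lip S f T b0 ha.
have h p : {within `[0, +oo[, continuous (fun t => x t p)}.
  exact: (euler_limit_continuous hT C0 h1 h2).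
by split; exact: mx_of_continuous.
Qed.

Lemma flow0 : B 0 = B0 /\ Q 0 = K0.
Proof.
have h p : x 0 p = coords B0 K0 p by exact: euler_limit0.
have {}h : x 0 = coords B0 K0 by apply/funext.
by rewrite /B /Q h !mx_of_coords.
Qed.

(** Where the cutoff does not vanish, all the coordinates are within the
   clamping bounds. *)
Lemma trunc_fieldE (u : 'I_m -> R) (y : I -> R) : trunc_field S f b u y =
  coords ((cutoff b y)%:C *: (drift S u *m mx_of true y))
    ((cutoff b y)%:C *: chart_field S f (mx_of true y) (skew_part (mx_of false y))).
Proof.
apply/funext => i; rewrite coords_scale /trunc_field.
have /orP[/eqP h|h] := orbN (cutoff b y == 0); first last.
  have -> : clamped b y = y.
    apply/funext => j; apply: clamp_id; rewrite -ler_norml.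
    exact: cutoff_neq0 h.
  exact: erefl.
rewrite h; exact: etrans (mul0r _) (esym (mul0r _)).
Qed.

Lemma flow_derive (t : R) : 0 < t -> (forall j : nat, t != j%:R * T) ->
  cmx_is_derive B t ((cutoff b (x t))%:C *: (drift S (ref_control T a t) *m B t))
  /\ cmx_is_derive Q t
    ((cutoff b (x t))%:C *: chart_field S f (B t) (skew_part (Q t))).
Proof.
move=> t0 tg; apply: mx_of_derive => i.
have [C C0 [h1 h2]] := trunc_field_bounded_lip S f T b0 ha.
have := euler_limit_derive hT C0 h1 h2 (coords B0 K0) i t0 tg.
by rewrite trunc_fieldE.
Qed.

Hypotheses (uB0 : B0 \is unitarymx) (hK0 : skew_hermitian K0).

(** K + K^dagger has derivative 0, the field being skew-Hermitian. *)
Lemma flow_skew (t : R) : 0 <= t -> skew_hermitian (Q t).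
Proof.
have [cB cQ] := flow_continuous; have [_ Q0] := flow0.
move=> t0; suff h : Q t + (Q t)^t* = 0.
  by rewrite /skew_hermitian /=; apply/eqP; rewrite -addr_eq0 addrC h.
have -> : 0 = Q 0 + (Q 0)^t* by rewrite Q0 hK0 subrr.
apply: (@offgrid_constant_mx _ _ T (fun t => Q t + (Q t)^t*)) => //.
  by apply: continuous_from_add => //; exact: continuous_from_adj.
move=> s s0 sg; have [_ h] := flow_derive s0 sg.
have := cmx_is_derive_add h (cmx_is_derive_adj h).
by rewrite adjZ (chart_field_skew f hS (B s) (skew_part_skew (Q s))) -scalerDr subrr scaler0.
Qed.

Lemma flow_unitary (t : R) : 0 <= t -> B t \is unitarymx.
Proof.
have [cB cQ] := flow_continuous; have [h0 _] := flow0.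
apply: (reference_unitary (u := ref_control T a)
  (chi := fun t => cutoff b (x t)) cB).
  by rewrite h0; exact: uB0.
by move=> s s0 sg; have [h _] := flow_derive s0 sg; exact: h.
Qed.

Lemma flow_decreasing (t : R) : 0 <= t -> sqnorm (Q t) <= sqnorm K0.
Proof.
have [cB cQ] := flow_continuous; have [_ h0] := flow0; rewrite -h0.
apply: (cayley_decreasing (chi := fun t => cutoff b (x t)) (B := B) _ cQ).
- by move=> s; exact: cutoff_ge0.
- exact: flow_skew.
- move=> s s0 sg; have [_ h] := flow_derive s0 sg.
  by rewrite (skew_partE (flow_skew (ltW s0))) in h; exact: h.
Qed.

Hypothesis hb : 1 + n%:R + sqnorm K0 <= b ^+ 2.

(** B remains unitary and the norm of K does not increase, so the squares of
   the coordinates sum to at most n + sqnorm K0, where the cutoff is 1. *)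
Lemma flow_solution (t : R) : 0 < t -> (forall j : nat, t != j%:R * T) ->
  cmx_is_derive B t (drift S (ref_control T a t) *m B t) /\
  cmx_is_derive Q t (chart_field S f (B t) (Q t)).
Proof.
move=> t0 tg; have [dB dQ] := flow_derive t0 tg.
have hc : cutoff b (x t) = 1.
  have [|-> _] := @cutoff_eq1 _ _ b (x t) b0; last exact: erefl.
  rewrite -[x t]coords_mx_of sum_coords (sqnorm_unitary (flow_unitary (ltW t0))).
  apply: le_trans hb; rewrite -addrA lerD2l lerD2l.
  exact: flow_decreasing (ltW t0).
rewrite hc scale1r in dB; rewrite hc scale1r in dQ.
by rewrite (skew_partE (flow_skew (ltW t0))) in dQ; split; [exact: dB|exact: dQ].
Qed.

End FlowFacts.

(** A solution of the chart dynamics obeys the same two bounds, hence solves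
   the truncated equation, whose solution is unique. *)
Lemma flow_unique (a : nat -> 'M[R]_(m, M)) (b c : R) (B K : R -> 'M[R[i]]_n) :
  0 <= b -> (forall j k l, `|a j k l| <= c) ->
  cmx_continuous_from 0 B -> cmx_continuous_from 0 K ->
  (forall t : R, 0 <= t -> B t \is unitarymx) ->
  (forall t : R, 0 <= t -> skew_hermitian (K t)) ->
  (forall t : R, 0 < t -> (forall j : nat, t != j%:R * T) ->
    cmx_is_derive B t (drift S (ref_control T a t) *m B t) /\
    cmx_is_derive K t (chart_field S f (B t) (K t))) ->
  1 + n%:R + sqnorm (K 0) <= b ^+ 2 ->
  forall J : nat, flow a b (B 0) (K 0) (J%:R * T) =
    coords (B (J%:R * T)) (K (J%:R * T)).
Proof.
move=> b0 ha cB cK uB sK d hb J.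
have [C C0 [h1 h2]] := trunc_field_bounded_lip S f T b0 ha.
apply/funext => i; apply/esym.
apply: (euler_limit_unique hT C0 h1 h2 (y := fun t => coords (B t) (K t))).
- by move=> p; exact: erefl.
- by move=> p; exact: coords_continuous.
- move=> t p t0 tg; have [dB dK] := d t t0 tg.
  have hc : cutoff b (coords (B t) (K t)) = 1.
    have [|-> _] := @cutoff_eq1 _ _ b (coords (B t) (K t)) b0; last exact: erefl.
    rewrite sum_coords (sqnorm_unitary (uB _ (ltW t0))).
    apply: le_trans hb; rewrite -addrA lerD2l lerD2l.
    apply: (cayley_decreasing (chi := fun=> 1) (B := B) _ cK sK _ (ltW t0)).
      by move=> s; exact: ler01.
    by move=> s s0 sg; have [_ h] := d s s0 sg; rewrite scale1r; exact: h.
  rewrite (trunc_fieldE b0) hc 2!scale1r 2!mx_of_coords.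
  rewrite (skew_partE (sK t (ltW t0))).
  exact: coords_derive.
Qed.

End Flow.

(** * Closed loops in the chart *)

Section LocalLaw.
Context {R : realType} {n m M : nat}.
Variables (S : 'I_m -> 'M[R[i]]_n) (f : 'I_m -> R) (T : R).
Hypotheses (hS : forall k, skew_hermitian (S k)) (hf : forall k, 0 < f k).
Hypothesis hT : 0 < T.
Implicit Types (a : nat -> 'M[R]_(m, M)).

Lemma solves_shift (L : nat) v v' X0 (X : R -> 'M[R[i]]_n) :
  (forall (t : R) x, 0 < t -> v (L%:R * T + t) x = v' t x) ->
  solves S T (L%:R * T) v X0 X ->
  solves S T 0 v' X0 (fun t => X (L%:R * T + t)).
Proof.
move=> vv' [h1 h2 h3 h4]; split.
- by rewrite addr0.
- by have := @continuous_from_shift _ _ _ _ (L%:R * T) h2; rewrite subrr.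
- by move=> t t0; apply: h3; rewrite lerDl.
- move=> t t0 tg; apply: cmx_is_derive_shift; rewrite -vv'//.
  apply: h4; first by rewrite ltrDl.
  move=> j; apply/eqP => e.
  have [jL|Lj] := leqP j L.
    have : j%:R * T <= L%:R * T by rewrite ler_pM2r// ler_nat.
    by rewrite -e leNgt ltrDl t0.
  have /eqP := tg (j - L)%N; apply.
  by rewrite natrB ?(ltnW Lj)// mulrBl -e addrAC subrr add0r.
Qed.

Lemma solves_unshift (L : nat) v v' X0 (X : R -> 'M[R[i]]_n) :
  (forall (t : R) x, 0 < t -> v (L%:R * T + t) x = v' t x) ->
  solves S T 0 v' X0 X ->
  solves S T (L%:R * T) v X0 (fun t => X (- (L%:R * T) + t)).
Proof.
move=> vv' [h1 h2 h3 h4]; split.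
- by rewrite addNr.
- by have := @continuous_from_shift _ _ _ _ (- (L%:R * T)) h2; rewrite sub0r opprK.
- by move=> t t0; apply: h3; rewrite addrC subr_ge0.
- move=> t t0 tg; apply: cmx_is_derive_shift.
  have s0 : 0 < - (L%:R * T) + t by rewrite addrC subr_gt0.
  have := vv' (- (L%:R * T) + t) (X (- (L%:R * T) + t)) s0.
  rewrite addrA subrr add0r => ->; apply: h4 => // j.
  apply/eqP => e; have /eqP := tg (j + L)%N; apply.
  by rewrite natrD mulrDl -e addrAC addNr add0r.
Qed.

(** All the frequencies are multiples of 2 pi / T, so only the indices of the
   coefficients are shifted. *)
Lemma ref_control_shift (L : nat) a (t : R) k : 0 <= t ->
  ref_control T a (L%:R * T + t) k = ref_control T (fun j => a (L + j)%N) t k.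
Proof.
move=> t0; have T0 : T != 0 by rewrite gt_eqF.
apply: eq_bigr => l _.
rewrite [X in a X](_ : _ = (L + Num.truncn (t / T))%N); last first.
  by rewrite mulrDl mulfK// truncnD ?natrK ?nnegrE ?divr_ge0 ?(ltW hT)// natr_nat.
congr (_ * _).
rewrite -[RHS](periodicn (@sinD2pi R) (l.+1 * L)); congr sin.
rewrite -[X in _ = _ + X]mulr_natl -[pi *+ 2]mulr_natl natrM.
by field.
Qed.

Lemma closed_loop_shift (L : nat) (Y0 Yg : 'M[R[i]]_n) a (Xb Y : R -> 'M[R[i]]_n) :
  closed_loop S f T (L%:R * T) Y0 Yg a Xb Y ->
  closed_loop S f T 0 Y0 Yg (fun j => a (L + j)%N)
    (fun t => Xb (L%:R * T + t)) (fun t => Y (L%:R * T + t)).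
Proof.
move=> [h1 h2 h3]; split.
- apply: solves_shift h1 => t x t0; apply/funext => k.
  exact: ref_control_shift (ltW t0).
- apply: solves_shift h2 => t x t0; apply/funext => k.
  by rewrite /local_law (ref_control_shift L a k (ltW t0)).
- by move=> t t0; apply: h3; rewrite lerDl.
Qed.

Lemma closed_loop_unshift (L : nat) (Y0 Yg : 'M[R[i]]_n) a (Xb Y : R -> 'M[R[i]]_n) :
  closed_loop S f T 0 Y0 Yg (fun j => a (L + j)%N) Xb Y ->
  closed_loop S f T (L%:R * T) Y0 Yg a
    (fun t => Xb (- (L%:R * T) + t)) (fun t => Y (- (L%:R * T) + t)).
Proof.
move=> [h1 h2 h3]; split.
- apply: solves_unshift h1 => t x t0; apply/funext => k.
  exact: ref_control_shift (ltW t0).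
- apply: solves_unshift h2 => t x t0; apply/funext => k.
  by rewrite /local_law (ref_control_shift L a k (ltW t0)) addKr.
- by move=> t t0; apply: h3; rewrite addrC subr_ge0.
Qed.

Lemma driftE (u : 'I_m -> R) (X : 'M[R[i]]_n) :
  \sum_k (u k)%:C *: (S k *m X) = drift S u *m X.
Proof.
by rewrite /drift mulmx_suml; apply: eq_bigr => k _; rewrite scalemxAl.
Qed.

Lemma driftD (u w : 'I_m -> R) : drift S (fun k => u k + w k) = drift S u + drift S w.
Proof.
rewrite /drift -big_split; apply: eq_bigr => k _.
by rewrite rmorphD scalerDl.
Qed.

Lemma drift_local_law a (Y0 Y : 'M[R[i]]_n) (Xb : R -> 'M[R[i]]_n) t :
  drift S (local_law S f T a Y0 Xb t Y) =
  drift S (ref_control T a t) + drift S (feedback S f (Xb t) (Y *m Y0^t*)).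
Proof. exact: driftD. Qed.

Lemma feedback_damping (Xb Z K : 'M[R[i]]_n) : Xb \is unitarymx ->
  skew_hermitian K -> Z *m (1%:M - K) = 1%:M + K ->
  Xb^t* *m drift S (feedback S f Xb (Xb *m Z)) *m Xb = damping S f Xb K.
Proof.
move=> uX hK ZK; rewrite /drift mulmx_sumr mulmx_suml; apply: eq_bigr => k _.
by rewrite (feedback_chart S f k uX hK ZK) -scalemxAr -scalemxAl.
Qed.

(** The open-loop term A acts on B and on P = B Z alike, and cancels in the
   derivative of Z = B^dagger P because A is skew-Hermitian. *)
Lemma moving_frame (A F B Z P : 'M[R[i]]_n) : skew_hermitian A -> P = B *m Z ->
  (A *m B)^t* *m P + B^t* *m ((A + F) *m P) = B^t* *m F *m B *m Z.
Proof.
move=> hA ->; rewrite adjM hA mulmxDl mulmxDr mulmxN mulNmx !mulmxA.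
by rewrite addrA addNr add0r.
Qed.

Lemma half_complex : (2^-1 : R)%:C = 2^-1 :> R[i].
Proof. by rewrite fmorphV rmorph_nat. Qed.

Lemma cayley_derive (Z : R -> 'M[R[i]]_n) (t : R) (D K : 'M[R[i]]_n) :
  Z t *m (1%:M - K) = 1%:M + K -> cmx_is_derive Z t (D *m Z t) ->
  cmx_is_derive (fun s => cayley (Z s)) t
    ((2^-1 : R)%:C *: ((1%:M - K) *m D *m (1%:M + K))).
Proof.
move=> ZK dZ; have u1 := chart_unit ZK.
have dZ1 := cmx_is_derive_add dZ (cmx_is_derive_cst 1%:M t).
have dW := cmx_is_derive_inv u1 dZ1.
have dK := cmx_is_derive_add (cmx_is_derive_cst 1%:M t)
  (cmx_is_derive_mull (- 1%:M) (cmx_is_derive_add dW dW)).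
have E : invmx (Z t + 1%:M) *m (D *m Z t + 0) *m invmx (Z t + 1%:M) *+ 2 =
    (2^-1 : R)%:C *: ((1%:M - K) *m D *m (1%:M + K)).
  rewrite addr0 (chart_inv ZK) -!mulmxA -[in LHS]scalemxAr -[in LHS]scalemxAr.
  rewrite -[in LHS]scalemxAr ZK -[in LHS]scalemxAl scalerA -scaler_nat scalerA.
  by congr (_ *: _); rewrite half_complex mulrA divff ?pnatr_eq0// mul1r.
rewrite -E; apply: (cmx_is_derive_ext (X := fun s => 1%:M + - 1%:M *m
  (invmx (Z s + 1%:M) + invmx (Z s + 1%:M)))).
  by move=> s; rewrite mulNmx mul1mx /cayley mulr2n.
by move: dK; rewrite add0r mulNmx mul1mx -opprD opprK mulr2n.
Qed.

Lemma cayley_inv_derive (K : R -> 'M[R[i]]_n) (t : R) (D : 'M[R[i]]_n) :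
  skew_hermitian (K t) ->
  cmx_is_derive K t ((2^-1 : R)%:C *: ((1%:M - K t) *m D *m (1%:M + K t))) ->
  cmx_is_derive (fun s => cayley_inv (K s)) t (D *m cayley_inv (K t)).
Proof.
move=> hK dK; have u := skew_sub_unit hK.
have ZK := cayley_invP hK; have dbl := chart_double ZK.
have c1 := cmx_is_derive_cst (1%:M : 'M[R[i]]_n) t.
have dKm : cmx_is_derive (fun s => 1%:M - K s) t
    (- ((2^-1 : R)%:C *: ((1%:M - K t) *m D *m (1%:M + K t)))).
  have := cmx_is_derive_add c1 (cmx_is_derive_mull (- 1%:M) dK).
  rewrite add0r mulNmx mul1mx; apply: cmx_is_derive_ext => s.
  by rewrite mulNmx mul1mx.
have := cmx_is_derive_mul (cmx_is_derive_add c1 dK) (cmx_is_derive_inv u dKm).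
set E := (2^-1 : R)%:C *: ((1%:M - K t) *m D *m (1%:M + K t)).
rewrite add0r !mulmxN mulNmx mulmxN opprK !mulmxA -/(cayley_inv (K t)).
have -> : E *m invmx (1%:M - K t) + cayley_inv (K t) *m E *m invmx (1%:M - K t) =
    (cayley_inv (K t) + 1%:M) *m E *m invmx (1%:M - K t).
  by rewrite addrC 2!mulmxDl mul1mx.
rewrite /E -scalemxAr (mulmxA _ _ (1%:M + K t)) (mulmxA _ (1%:M - K t)) dbl.
rewrite -scalemxAl -(mulmxA _ (1%:M + K t)) -/(cayley_inv (K t)).
rewrite -[1%:M *+ 2]scaler_nat -!scalemxAl scalerA half_complex mulVf ?pnatr_eq0//.
by rewrite scale1r mul1mx /cayley_inv mulmxA.
Qed.

Section ClosedLoopChart.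
Variables (a : nat -> 'M[R]_(m, M)) (Y0 Yg : 'M[R[i]]_n) (Xb Y : R -> 'M[R[i]]_n).
Hypothesis cl : closed_loop S f T 0 Y0 Yg a Xb Y.

Let Z t := (Xb t)^t* *m (Y t *m Y0^t*).
Let K t := cayley (Z t).

(** The product rule gives Z' = damping Z [moving_frame], and the Cayley
   transform turns this into the chart field [cayley_derive]. *)
Lemma chart_of_closed_loop : cmx_continuous_from 0 Xb /\ cmx_continuous_from 0 K /\
  (forall t : R, 0 <= t -> Xb t \is unitarymx) /\
  (forall t : R, 0 <= t -> skew_hermitian (K t)) /\
  forall t : R, 0 < t -> (forall j : nat, t != j%:R * T) ->
    cmx_is_derive Xb t (drift S (ref_control T a t) *m Xb t) /\
    cmx_is_derive K t (chart_field S f (Xb t) (K t)).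
Proof.
have [[_ cX uX dX] [_ cY uY dY] hW] := cl.
have cZ : cmx_continuous_from 0 Z.
  apply: continuous_from_mul; first exact: continuous_from_adj.
  by apply: continuous_from_mul => //; exact: continuous_from_cst.
have sK t : 0 <= t -> skew_hermitian (K t).
  by move=> t0; apply: cayley_skew; exact: hW.
split; first exact: cX.
split.
  apply: continuous_from_sub; first exact: continuous_from_cst.
  have hi : cmx_continuous_from 0 (fun t => invmx (Z t + 1%:M)).
    apply: continuous_from_inv => [|t t0].
      by apply: continuous_from_add => //; exact: continuous_from_cst.
    by apply: in_W_unit; exact: hW.
  rewrite (_ : (fun t => _ *+ 2) =
    fun t => invmx (Z t + 1%:M) + invmx (Z t + 1%:M)); last first.
    by apply/funext => t; rewrite mulr2n.
  exact: continuous_from_add.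
split; first exact: uX.
split; first exact: sK.
move=> t t0 tg; have t0' := ltW t0.
have dXt := dX t t0 tg; have dYt := dY t t0 tg.
rewrite driftE in dXt; rewrite driftE in dYt.
split; first exact: dXt.
have ZK : Z t *m (1%:M - K t) = 1%:M + K t by apply: cayleyP; exact: hW.
have YE : Y t *m Y0^t* = Xb t *m Z t.
  by rewrite /Z mulmxA unitarymxK ?mul1mx//; exact: uX.
have dZ : cmx_is_derive Z t (damping S f (Xb t) (K t) *m Z t).
  have dP := cmx_is_derive_mul (cmx_is_derive_adj dXt)
    (cmx_is_derive_mulr (Y0^t*) dYt).
  rewrite -(mulmxA (drift S _) (Y t)) in dP.
  rewrite drift_local_law (moving_frame _ (drift_skew hS _) YE) YE in dP.
  rewrite (feedback_damping (uX t t0') (sK t t0') ZK) in dP.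
  exact: dP.
exact: cayley_derive ZK dZ.
Qed.

End ClosedLoopChart.

(** At the starting time the reference is Yg Y0^dagger and Xi = 1, so Z is the
   adjoint of Yg Y0^dagger. *)
Definition chart_start (Y0 Yg : 'M[R[i]]_n) := cayley ((Yg *m Y0^t*)^t*).

Lemma in_W_adj (Z : 'M[R[i]]_n) : in_W Z -> in_W (Z^t*).
Proof.
move=> hZ; have u := in_W_unit hZ; have [uZ _] := hZ.
split; first exact: unitary_adj.
by rewrite -unitfE -unitmxE -[1%:M]adj1 -adjD map_unitmx unitmx_tr addrC.
Qed.

(** By uniqueness, the samples of a closed loop are given by the flow, so they
   depend on the coefficients only. *)
Lemma closed_loop_flow a (b c : R) (Y0 Yg : 'M[R[i]]_n) (Xb Y : R -> 'M[R[i]]_n) :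
  Y0 \is unitarymx -> 0 <= b -> (forall j k l, `|a j k l| <= c) ->
  1 + n%:R + sqnorm (chart_start Y0 Yg) <= b ^+ 2 ->
  closed_loop S f T 0 Y0 Yg a Xb Y ->
  forall J : nat,
    let x := flow S f T a b (Yg *m Y0^t*) (chart_start Y0 Yg) (J%:R * T) in
    skew_hermitian (mx_of false x) /\
    Y (J%:R * T) *m Y0^t* = mx_of true x *m cayley_inv (mx_of false x) /\
    mx_of true x = Xb (J%:R * T).
Proof.
move=> uY0 b0 ha hb cl J.
have [cX [cK [uX [sK d]]]] := chart_of_closed_loop cl.
have [[X0 _ _ _] [hY0 _ _ _] hW] := cl.
set K := fun t => cayley _ in cK sK d.
have K0 : K 0 = chart_start Y0 Yg by rewrite /K X0 hY0 (unitarymxK uY0) mulmx1.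
have t0 : 0 <= J%:R * T by rewrite mulr_ge0// ltW.
move=> x; have xE : x = coords (Xb (J%:R * T)) (K (J%:R * T)).
  have hb' : 1 + n%:R + sqnorm (K 0) <= b ^+ 2 by rewrite K0.
  have := @flow_unique _ _ _ _ S f T hf hT a b c Xb K b0 ha cX cK uX sK d hb' J.
  by rewrite K0 X0.
rewrite xE !mx_of_coords; split; first exact: sK.
have KE : cayley_inv (K (J%:R * T)) =
    (Xb (J%:R * T))^t* *m (Y (J%:R * T) *m Y0^t*).
  by rewrite (chart_cayley_inv (sK _ t0) (cayleyP (hW _ t0))).
by rewrite KE mulmxA (unitarymxK (uX _ t0)) mul1mx.
Qed.

(** The flow solves the chart dynamics for all times, since its norm cannot
   blow up; the inverse Cayley transform takes it back to the unitary group. *)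
Lemma closed_loop_exists a (c : R) (Y0 Yg : 'M[R[i]]_n) :
  Y0 \is unitarymx -> in_W (Yg *m Y0^t*) -> (forall j k l, `|a j k l| <= c) ->
  exists Xb Y, closed_loop S f T 0 Y0 Yg a Xb Y.
Proof.
move=> uY0 hW ha; set B0 := Yg *m Y0^t*; set K0 := chart_start Y0 Yg.
have hW' := in_W_adj hW; have uB0 : B0 \is unitarymx by case: hW.
have sK0 : skew_hermitian K0 by exact: cayley_skew.
pose b := 1 + n%:R + sqnorm K0.
(* As b is at least 1, it is at most its square. *)
have b1 : 1 <= b by rewrite /b -addrA lerDl addr_ge0// sqnorm_ge0.
have b0 : 0 <= b by exact: le_trans b1.
have hb : 1 + n%:R + sqnorm K0 <= b ^+ 2 by rewrite -/b expr2 ler_peMr.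
pose x := flow S f T a b B0 K0.
pose B t := mx_of true (x t); pose Q t := mx_of false (x t).
have [cB cQ] : cmx_continuous_from 0 B /\ cmx_continuous_from 0 Q
  := flow_continuous S f hT B0 K0 b0 ha.
have [B0E Q0E] : B 0 = B0 /\ Q 0 = K0 := flow0 S f T a b B0 K0.
have uB (t : R) : 0 <= t -> B t \is unitarymx.
  exact: (flow_unitary f hS hT K0 b0 ha uB0).
have sQ (t : R) : 0 <= t -> skew_hermitian (Q t).
  exact: (flow_skew f hS hT B0 b0 ha sK0).
have d (t : R) : 0 < t -> (forall j : nat, t != j%:R * T) ->
    cmx_is_derive B t (drift S (ref_control T a t) *m B t) /\
    cmx_is_derive Q t (chart_field S f (B t) (Q t)).
  exact: (flow_solution hS hf hT b0 ha uB0 sK0 hb).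
clearbody B Q; clear x.
pose Z t := cayley_inv (Q t).
have Z0 : Z 0 = B0^t* by rewrite /Z Q0E -(chart_cayley_inv sK0 (cayleyP hW')).
have ZQ (t : R) : 0 <= t -> Z t *m (1%:M - Q t) = 1%:M + Q t.
  by move=> t0; exact: (cayley_invP (sQ t t0)).
have dZ (t : R) : 0 < t -> (forall j : nat, t != j%:R * T) ->
    cmx_is_derive Z t (damping S f (B t) (Q t) *m Z t).
  move=> t0 tg; have [_ dQ] := d t t0 tg.
  exact: (cayley_inv_derive (sQ t (ltW t0)) dQ).
have cZ : cmx_continuous_from 0 Z.
  apply: continuous_from_mul.
    by apply: continuous_from_add; [exact: continuous_from_cst|exact: cQ].
  apply: continuous_from_inv => [|t t0]; last exact: (skew_sub_unit (sQ t t0)).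
  by apply: continuous_from_sub; [exact: continuous_from_cst|exact: cQ].
clearbody Z.
have YE t : B t *m Z t *m Y0 *m Y0^t* = B t *m Z t.
  by rewrite -mulmxA (unitarymxK uY0) mulmx1.
exists B, (fun t => B t *m Z t *m Y0); split.
- split=> [|||t t0 tg]; [exact: B0E|exact: cB|exact: uB|].
  by rewrite driftE; have [dB _] := d t t0 tg; exact: dB.
- split.
  + by rewrite B0E Z0 (unitarymxK uB0) mul1mx.
  + apply: continuous_from_mul; last exact: continuous_from_cst.
    exact: continuous_from_mul.
  + move=> t t0; have uZ := chart_unitary (sQ t t0) (ZQ t t0).
    exact: (mul_unitarymx (mul_unitarymx (uB t t0) uZ) uY0).
  + move=> t t0 tg; rewrite driftE; have [dB dQ] := d t t0 tg.
    have dY := cmx_is_derive_mulr Y0 (cmx_is_derive_mul dB (dZ t t0 tg)).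
    have lE := drift_local_law a Y0 (B t *m Z t *m Y0) B t; rewrite YE in lE.
    rewrite lE; set A := drift S (ref_control T a t) in dY *.
    set F := drift S _.
    have DE : B t *m damping S f (B t) (Q t) = F *m B t.
      rewrite -(feedback_damping (uB t (ltW t0)) (sQ t (ltW t0)) (ZQ t (ltW t0))).
      by rewrite -/F 2!mulmxA (unitarymxK (uB t (ltW t0))) mul1mx.
    rewrite (mulmxA (B t)) DE in dY.
    have E : (A + F) *m (B t *m Z t *m Y0) =
        (A *m B t *m Z t + F *m B t *m Z t) *m Y0.
      by rewrite mulmxDl mulmxDl !mulmxA.
    by rewrite E; exact: dY.
- move=> t t0; rewrite YE mulmxA (unitarymxVK (uB t t0)) mul1mx.
  exact: (chart_in_W (sQ t t0) (ZQ t t0)).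
Qed.

End LocalLaw.

(** * The intermediate target *)

Section Target.
Context {R : realType} {n : nat}.

(** A phase other than -1: the Cayley transform of the integer k. *)
Definition circle_point (k : nat) : R[i] := (1 +i* k%:R) / (1 -i* k%:R).

Lemma circle_den (k : nat) : ((1 : R) -i* k%:R) != 0 :> R[i].
Proof. by rewrite eq_complex /= oner_eq0. Qed.

Lemma circle_num (k : nat) : ((1 : R) +i* k%:R) != 0 :> R[i].
Proof. by rewrite eq_complex /= oner_eq0. Qed.

Lemma circle_conj (k : nat) : circle_point k * Num.conj (circle_point k) = 1.
Proof.
rewrite /circle_point rmorphM fmorphV /=.
have -> : Num.conj ((1 : R) +i* k%:R) = 1 -i* k%:R by [].
have -> : Num.conj ((1 : R) -i* k%:R) = 1 +i* k%:R.
  by apply: complex_ext => //=; rewrite opprK.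
by field; rewrite circle_den circle_num.
Qed.

Lemma circle_neqN1 (k : nat) : 1 + circle_point k != 0.
Proof.
have -> : 1 + circle_point k = 2 / (1 -i* k%:R).
  have -> : 2 = (1 -i* k%:R) + (1 +i* k%:R) :> R[i].
    by apply: complex_ext => /=; ring.
  by rewrite mulrDl divff ?circle_den.
by rewrite mulf_neq0 ?invr_eq0 ?circle_den// pnatr_eq0.
Qed.

Lemma circle_inj : injective circle_point.
Proof.
move=> k l /eqP; rewrite /circle_point eqr_div ?circle_den// => /eqP.
move=> /(congr1 (@complex.Im R)) /= h.
have {}h : (k%:R : R) = l%:R by move: h; lra.
by apply/eqP; rewrite -(eqr_nat R) h.
Qed.

(** For X1 = c X0 the second condition says that c is not a root of the
   characteristic polynomial of - Xg X0^dagger, which has at most n roots;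
   one of n + 1 distinct phases will do. *)
Lemma intermediate_target (X0 Xg : 'M[R[i]]_n) :
  X0 \is unitarymx -> Xg \is unitarymx ->
  exists X1, [/\ X1 \is unitarymx, in_W (X1 *m X0^t*) & in_W (Xg *m X1^t*)].
Proof.
move=> u0 ug; set U := Xg *m X0^t*.
have [k hk] : exists k, ~~ root (char_poly (- U)) (circle_point k).
  have : ~~ all (root (char_poly (- U))) (map circle_point (iota 0 n.+1)).
    apply/negP => h.
    have := max_poly_roots (monic_neq0 (char_poly_monic (- U))) h.
    rewrite size_char_poly size_map size_iota ltnn (map_inj_uniq circle_inj).
    by move=> /(_ (iota_uniq _ _)).
  by move=> /allPn[c /mapP[k _ ->] hc]; exists k.
set c := circle_point k in hk.
have cc : c * Num.conj c = 1 := circle_conj k.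
have c0 : c != 0 by apply/eqP => c0; move: cc; rewrite c0 mul0r => /eqP; rewrite eq_sym oner_eq0.
have adjc : (c *: X0)^t* = Num.conj c *: X0^t*.
  by apply/matrixP => i j; rewrite !mxE rmorphM.
have u1 : c *: X0 \is unitarymx.
  apply/unitarymxP; rewrite adjc -scalemxAl -scalemxAr scalerA cc scale1r.
  exact: unitarymxK.
exists (c *: X0); split; first exact: u1.
  split; first exact: (mul_unitarymx u1 (unitary_adj u0)).
  rewrite -scalemxAl unitarymxK// scalemx1 -raddfD det_scalar expf_neq0//.
  exact: circle_neqN1.
split; first exact: (mul_unitarymx ug (unitary_adj u1)).
rewrite adjc -scalemxAr -/U.
have -> : 1%:M + Num.conj c *: U = Num.conj c *: (c%:M - - U).
  by rewrite opprK scalerDr scale_scalar_mx mulrC cc.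
rewrite detZ mulf_neq0//; first by rewrite expf_neq0// conjC_eq0.
move: hk; rewrite /root /char_poly /char_poly_mx -horner_evalE -det_map_mx.
rewrite map_mxB /= map_scalar_mx /= horner_evalE hornerX.
rewrite -map_mx_comp (_ : map_mx _ (- U) = - U)//.
by apply/matrixP => i j; rewrite !mxE /= horner_evalE hornerC.
Qed.

End Target.

(** * Return of the reference at the sampling times *)

Section Sampling.
Context {R : realType} {n m M : nat}.
Variables (S : 'I_m -> 'M[R[i]]_n) (f : 'I_m -> R) (T : R).
Hypotheses (hS : forall k, skew_hermitian (S k)) (hT : 0 < T).
Implicit Types (a : nat -> 'M[R]_(m, M)) (X Y : R -> 'M[R[i]]_n).

Lemma ref_control_odd a (t : R) k : 0 < t < T ->
  ref_control T a (T - t) k = - ref_control T a t k.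
Proof.
move=> /andP[t0 tT]; have T0 : T != 0 by rewrite gt_eqF.
have tr (s : R) : 0 < s < T -> Num.truncn (s / T) = 0%N.
  move=> /andP[s0 sT]; apply: truncn_def.
  by rewrite divr_ge0 ?ltW//= ltr_pdivrMr// mul1r.
rewrite /ref_control -sumrN; apply: eq_bigr => l _.
rewrite tr; last by rewrite subr_gt0 tT gtrBl t0.
rewrite tr ?t0// -mulrN -sinN; congr (_ * _).
rewrite -[RHS](periodicn (@sinD2pi R) l.+1); congr sin.
by rewrite -[X in _ = _ + X]mulr_natl -[pi *+ 2]mulr_natl; field.
Qed.

Lemma is_derive_reflect (g : R -> R) (c t d : R) : is_derive (c - t) (1 : R) g d ->
  is_derive t (1 : R) (fun s => g (c - s)) (- d).
Proof.
move=> hg.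
have h : is_derive t (1 : R) (fun s : R => c - s) (0 - 1).
  exact: is_deriveB.
have := @is_derive1_comp R g (fun s : R => c - s) t d (0 - 1) hg h.
by rewrite sub0r mulrN1.
Qed.

Lemma cmx_is_derive_reflect X (c t : R) D : cmx_is_derive X (c - t) D ->
  cmx_is_derive (fun s => X (c - s)) t (- D).
Proof.
move=> hX i j; have [h1 h2] := hX i j; rewrite !mxE ReN ImN.
split; first exact: (@is_derive_reflect (fun s => complex.Re (X s i j))).
exact: (@is_derive_reflect (fun s => complex.Im (X s i j))).
Qed.

Lemma constant_on_segment X (c : R) : 0 <= c ->
  (forall t : R, 0 <= t <= c -> cmx_cvg (within `[0, c] (nbhs t)) X (X t)) ->
  (forall t : R, 0 < t < c -> cmx_is_derive X t 0) -> X c = X 0.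
Proof.
move=> c0 cX dX.
have aux (g : R -> R) : {within `[0, c], continuous g} ->
    (forall t : R, 0 < t < c -> is_derive t (1 : R) g 0) -> g c = g 0.
  move=> cg dg.
  have dg' t : t \in `]0, c[ -> is_derive t (1 : R) g ((fun=> 0) t).
    by rewrite in_itv/=; exact: dg.
  have [x _] := MVT_segment c0 dg' cg.
  by rewrite mul0r => /eqP; rewrite subr_eq0 => /eqP.
apply/matrixP => i j; apply: complex_ext.
  apply: (aux (fun s => complex.Re (X s i j))).
    by apply/subspace_continuousP => t /=; rewrite in_itv/= => /cX /(_ i j)[].
  by move=> t ht; have [] := dX t ht i j; rewrite mxE.
apply: (aux (fun s => complex.Im (X s i j))).
  by apply/subspace_continuousP => t /=; rewrite in_itv/= => /cX /(_ i j)[].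
by move=> t ht; have [] := dX t ht i j; rewrite mxE.
Qed.

Lemma cvg_reflect X (b c t : R) : cmx_continuous_from 0 X -> b <= c -> t <= b ->
  cmx_cvg (within `[0, b] (nbhs t)) (fun s => X (c - s)) (X (c - t)).
Proof.
move=> /cmx_continuous_fromP hX bc tb.
have ct : 0 <= c - t by rewrite subr_ge0 (le_trans tb).
have hc : c - s @[s --> within `[0, b] (nbhs t)] --> within `[0, +oo[ (nbhs (c - t)).
  have hn : c - s @[s --> nbhs t] --> c - t.
    by apply: cvgB; [exact: cvg_cst|exact: cvg_id].
  move=> P hP.
  have hP' : \forall s \near t, `[0, +oo[%classic (c - s) -> P (c - s).
    exact: (hn _ hP).
  change (\forall s \near t, `[0, b]%classic s -> P (c - s)).
  apply: filterS hP' => s /= h; rewrite in_itv/= => /andP[_ sb].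
  by apply: h; rewrite in_itv/= andbT subr_ge0 (le_trans sb).
move=> i j; have [h1 h2] := hX _ ct i j; split.
  exact: (@cvg_comp _ _ _ (fun s : R => c - s) (fun s => complex.Re (X s i j)) _ _ _ hc h1).
exact: (@cvg_comp _ _ _ (fun s : R => c - s) (fun s => complex.Im (X s i j)) _ _ _ hc h2).
Qed.

Lemma cvg_within_subset (A B : set R) X (t : R) l : A `<=` B ->
  cmx_cvg (within B (nbhs t)) X l -> cmx_cvg (within A (nbhs t)) X l.
Proof.
move=> AB hX i j; have [h1 h2] := hX i j.
have sub : within A (nbhs t) `=>` within B (nbhs t).
  move=> Q; change ((\forall s \near t, B s -> Q s) ->
    (\forall s \near t, A s -> Q s)).
  by apply: filterS => s h /AB; exact: h.
split; first by apply: cvg_trans h1; exact: cvg_app.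
by apply: cvg_trans h2; exact: cvg_app.
Qed.

Lemma continuous_from_later X (s t : R) : s <= t ->
  cmx_continuous_from s X -> cmx_continuous_from t X.
Proof.
move=> st /cmx_continuous_fromP hX; apply/cmx_continuous_fromP => r tr.
apply: cvg_within_subset (hX r (le_trans st tr)) => u /=.
by rewrite !in_itv/= !andbT; exact: le_trans.
Qed.

(** The controls are odd about T / 2, so X (t)^dagger X (T - t) is constant on
   [0, T / 2]; it is 1 at T / 2. *)
Lemma reference_period a (X0 : 'M[R[i]]_n) X :
  solves S T 0 (fun t _ => ref_control T a t) X0 X -> X T = X0.
Proof.
move=> [h0 cX uX dX]; rewrite -h0.
have T2 : 0 <= T / 2 by rewrite divr_ge0// ltW.
have T2T : T / 2 <= T by lra.
have off (t : R) : 0 < t < T -> forall j : nat, t != j%:R * T.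
  move=> /andP[t0 tT] j; apply/eqP => tj; move: t0 tT; rewrite tj.
  rewrite pmulr_lgt0// ltr0n -[X in _ < X]mul1r ltr_pM2r// ltrn1 ltnS leqn0.
  by case: j {tj}.
pose P t := (X t)^t* *m X (T - t).
have PE : P (T / 2) = P 0.
  apply: constant_on_segment => // [t /andP[t0 t2]|t /andP[t0 t2]].
    apply: cmx_cvg_mul; last exact: cvg_reflect.
    apply: cmx_cvg_adj; move/cmx_continuous_fromP : cX => /(_ t t0).
    apply: cvg_within_subset => s /=.
    by rewrite !in_itv/= andbT => /andP[].
  have tT : 0 < t < T by rewrite t0 (lt_le_trans t2).
  have tT' : 0 < T - t < T by rewrite subr_gt0 gtrBl andbC.
  have d1 := dX t t0 (off t tT).
  have d2 := dX (T - t) (proj1 (andP tT')) (off _ tT').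
  rewrite driftE in d1; rewrite driftE in d2.
  have E : drift S (ref_control T a (T - t)) = - drift S (ref_control T a t).
    rewrite /drift -sumrN; apply: eq_bigr => k _.
    by rewrite ref_control_odd// rmorphN scaleNr.
  rewrite E mulNmx in d2.
  have := cmx_is_derive_mul (cmx_is_derive_adj d1) (cmx_is_derive_reflect d2).
  by rewrite opprK adjM (drift_skew hS) mulmxN mulNmx mulmxA addNr.
have h2 : T - T / 2 = T / 2 by field.
have u2 := uX _ T2; have uT := uX _ (ltW hT).
move: PE; rewrite /P h2 subr0 (unitarymxVK u2) => PE.
by rewrite -[LHS]mul1mx -(unitarymxK (uX 0 (lexx 0))) -mulmxA -PE mulmx1.
Qed.

Lemma reference_periodic a (X0 : 'M[R[i]]_n) X (J : nat) :
  solves S T 0 (fun t _ => ref_control T a t) X0 X -> X (J%:R * T) = X0.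
Proof.
elim: J a X0 X => [|J IH] a X0 X hX; first by rewrite mul0r; case: hX.
have hT' := reference_period hX.
have hs : solves S T 0 (fun t _ => ref_control T (fun j => a (1 + j)%N) t) X0
    (fun t => X (1%:R * T + t)).
  apply: (solves_shift hT (v := fun t _ => ref_control T a t)).
    by move=> t x t0; apply/funext => k; exact: (ref_control_shift hT 1 a k (ltW t0)).
  rewrite mul1r; case: hX => [h1 h2 h3 h4]; split => //.
  - exact: continuous_from_later (ltW hT) h2.
  - by move=> t tT; apply: h3; rewrite (le_trans _ tT)// ltW.
  - by move=> t tT; apply: h4; rewrite (lt_trans _ tT).
by have := IH _ _ _ hs; rewrite -mulrDl nat1r.
Qed.

End Sampling.

(** * The two steps with deterministic laws *)

Section SampledLimits.
Context {R : realType} {n m M : nat}.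
Variables (S : 'I_m -> 'M[R[i]]_n) (f : 'I_m -> R) (T : R).
Hypotheses (hS : forall k, skew_hermitian (S k)) (hT : 0 < T).
Implicit Types (a : nat -> 'M[R]_(m, M)) (X Y Xb : R -> 'M[R[i]]_n).

Lemma closed_loop_reference (L J : nat) a (Y0 Yg : 'M[R[i]]_n) Xb Y :
  closed_loop S f T (L%:R * T) Y0 Yg a Xb Y ->
  Xb ((L + J)%:R * T) = Yg *m Y0^t*.
Proof.
move=> /(closed_loop_shift hT)[h _ _].
by have := reference_periodic hS hT J h; rewrite -mulrDl -natrD.
Qed.

(** At the sampling times the reference is R = Yg Y0^dagger, so Xi = R Z there
   and Xi tends to R with Z tending to 1. *)
Lemma sampled_error_limit (L : nat) a (Y0 Yg : 'M[R[i]]_n) Xb Y :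
  Y0 \is unitarymx -> Yg \is unitarymx ->
  closed_loop S f T (L%:R * T) Y0 Yg a Xb Y ->
  cmx_cvg (pinfty_nbhs R) (fun t => (Xb t)^t* *m (Y t *m Y0^t*)) 1%:M ->
  cmx_cvg \oo (fun j : nat => Y (j%:R * T) *m Y0^t*) (Yg *m Y0^t*).
Proof.
move=> u0 ug cl hZ.
have uR : Yg *m Y0^t* \is unitarymx := mul_unitarymx ug (unitary_adj u0).
have jT : j%:R * T @[j --> \oo] --> +oo.
  apply/cvgryPge => A; near=> j; rewrite -ler_pdivrMr//.
  by near: j; exact: nbhs_infty_ger.
have hZj : cmx_cvg \oo (fun j : nat =>
    (Xb (j%:R * T))^t* *m (Y (j%:R * T) *m Y0^t*)) 1%:M.
  move=> i k; have [h1 h2] := hZ i k; split.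
    exact: (@cvg_comp _ _ _ (fun j : nat => j%:R * T) (fun t => complex.Re (((Xb t)^t* *m (Y t *m Y0^t*)) i k)) _ _ _ jT h1).
  exact: (@cvg_comp _ _ _ (fun j : nat => j%:R * T) (fun t => complex.Im (((Xb t)^t* *m (Y t *m Y0^t*)) i k)) _ _ _ jT h2).
have Foo : Filter (\oo : set_system nat) by exact: _.
have hR := cmx_cvg_mul (FF := Foo) (cmx_cvg_cst (FF := Foo) (Yg *m Y0^t*)) hZj.
rewrite mulmx1 in hR; apply: cmx_cvg_near hR.
near=> j; have Lj : (L <= j)%N by near: j; exact: nbhs_infty_ge.
have := closed_loop_reference (j - L) cl; rewrite subnKC// => ->.
by rewrite mulmxA (unitarymxK uR) mul1mx.
Unshelve. all: by end_near.
Qed.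

Lemma sampled_state_limit (Y0 Yg : 'M[R[i]]_n) Y :
  Y0 \is unitarymx ->
  cmx_cvg \oo (fun j : nat => Y (j%:R * T) *m Y0^t*) (Yg *m Y0^t*) ->
  cmx_cvg \oo (fun j : nat => Y (j%:R * T)) Yg.
Proof.
have Foo : Filter (\oo : set_system nat) by exact: _.
move=> u0 h; have := cmx_cvg_mul (FF := Foo) h (cmx_cvg_cst (FF := Foo) Y0).
rewrite -mulmxA (unitarymxVK u0) mulmx1; apply: cmx_cvg_ext => j.
by rewrite -mulmxA (unitarymxVK u0) mulmx1.
Qed.

Lemma switched_limit (L : nat) X Y (Xg : 'M[R[i]]_n) :
  cmx_cvg \oo (fun j : nat => Y (j%:R * T)) Xg ->
  cmx_cvg \oo (fun j : nat => switched (L%:R * T) X Y (j%:R * T)) Xg.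
Proof.
apply: cmx_cvg_near; near=> j.
have Lj : (L <= j)%N by near: j; exact: nbhs_infty_ge.
by rewrite /switched ltr_pM2r// ltr_nat ltnNge Lj.
Unshelve. all: by end_near.
Qed.

(** W is open in the unitary group. *)
Lemma eventually_in_W (X : R -> 'M[R[i]]_n) (X1 Xg : 'M[R[i]]_n) :
  Xg \is unitarymx -> (forall t : R, 0 <= t -> X t \is unitarymx) ->
  in_W (Xg *m X1^t*) -> cmx_cvg \oo (fun j : nat => X (j%:R * T)) X1 ->
  exists L : nat, in_W (Xg *m (X (L%:R * T))^t*).
Proof.
move=> ug uX hW hX.
have hc : cmx_cvg \oo (fun j : nat => Xg *m (X (j%:R * T))^t* + 1%:M)
    (Xg *m X1^t* + 1%:M).
  apply: cmx_cvg_add; last exact: cmx_cvg_cst.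
  by apply: cmx_cvg_mul; [exact: cmx_cvg_cst|exact: cmx_cvg_adj].
have Foo : Filter (\oo : set_system nat) by exact: _.
have [L _ hL] := cmx_cvg_unit (FF := Foo) hc (in_W_unit hW).
exists L; have uL := hL L (leqnn L); split.
  apply: (mul_unitarymx ug (unitary_adj (uX _ _))).
  by rewrite mulr_ge0// ltW.
by rewrite -unitfE -unitmxE addrC.
Qed.

End SampledLimits.

Section Deterministic.
Context {R : realType} {n m : nat}.
Variables (S : 'I_m -> 'M[R[i]]_n) (T : R) (X0 X1 Xg : 'M[R[i]]_n).
Hypotheses (hS : forall k, skew_hermitian (S k)) (hT : 0 < T).
Hypotheses (u0 : X0 \is unitarymx) (u1 : X1 \is unitarymx)
  (ug : Xg \is unitarymx).

Lemma admissible_limit (f : 'I_m -> R) M (a : 'M[R]_(m, M)) (L : nat)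
    (Y0 Yg : 'M[R[i]]_n) Xb Y :
  Y0 \is unitarymx -> Yg \is unitarymx ->
  admissible S f T (L%:R * T) Y0 Yg a ->
  closed_loop S f T (L%:R * T) Y0 Yg (fun=> a) Xb Y ->
  cmx_cvg \oo (fun j : nat => Y (j%:R * T)) Yg.
Proof.
move=> uY0 uYg [_ had] cl; apply: (sampled_state_limit uY0).
exact: (sampled_error_limit hS hT uY0 uYg cl (had _ _ cl)).
Qed.

Lemma deterministic_stabilization (f1 : 'I_m -> R) M1 (a1 : 'M[R]_(m, M1)) :
  in_W (Xg *m X1^t*) -> admissible S f1 T 0 X0 X1 a1 ->
  (exists Xb X, closed_loop S f1 T 0 X0 X1 (fun=> a1) Xb X) /\
  forall Xb X, closed_loop S f1 T 0 X0 X1 (fun=> a1) Xb X ->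
    (exists L : nat, in_W (Xg *m (X (L%:R * T))^t*)) /\
    forall L : nat, in_W (Xg *m (X (L%:R * T))^t*) ->
    forall (f2 : 'I_m -> R) (M2 : nat) (a2 : 'M[R]_(m, M2)),
      admissible S f2 T (L%:R * T) (X (L%:R * T)) Xg a2 ->
      (exists Xb2 Y,
         closed_loop S f2 T (L%:R * T) (X (L%:R * T)) Xg (fun=> a2) Xb2 Y) /\
      forall Xb2 Y,
        closed_loop S f2 T (L%:R * T) (X (L%:R * T)) Xg (fun=> a2) Xb2 Y ->
        cmx_cvg \oo (fun j : nat => switched (L%:R * T) X Y (j%:R * T)) Xg.
Proof.
move=> hW ad1; split=> [|Xb X cl]; first by case: ad1.
have [_ [_ _ uX _] _] := cl.
have hX : cmx_cvg \oo (fun j : nat => X (j%:R * T)) X1.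
  by move: ad1 cl; rewrite -(mul0r T); exact: (@admissible_limit f1 M1 a1 0).
split; first exact: (eventually_in_W hT ug uX hW hX).
move=> L hL f2 M2 a2 ad2; split=> [|Xb2 Y cl2]; first by case: ad2.
apply: (switched_limit hT); apply: (admissible_limit _ ug ad2 cl2).
by apply: uX; rewrite mulr_ge0// ltW.
Qed.

End Deterministic.

(** * Independence of past and future *)

Section Independence.
Context {R : realType} {d : measure_display} {Om : measurableType d}.
Variable P : probability Om R.
Variable H : nat -> set (set Om).
Hypotheses (HT : forall j, H j setT) (HI : forall j, setI_closed (H j)).
Hypothesis (Hm : forall j, H j `<=` measurable).
Hypothesis indep : mutually_independent P H.

(** A pi-system generating the events that depend only on the sources selected
   by p. *)
Definition cylinders (p : pred nat) : set (set Om) :=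
  [set A | exists s E, [/\ uniq s, all p s, forall j, H j (E j) &
    A = \bigcap_(j in [set` s]) E j]].

Lemma cylinders_measurable p : cylinders p `<=` measurable.
Proof.
move=> _ [s [E [_ _ hE ->]]].
by apply: fin_bigcap_measurable => // j _; exact: Hm.
Qed.

Lemma cylindersT p : cylinders p setT.
Proof.
exists [::], (fun=> setT); split => //.
by rewrite set_nil bigcap_set0.
Qed.

Lemma sub_cylinders (p : pred nat) j : p j -> H j `<=` cylinders p.
Proof.
move=> pj A hA; exists [:: j], (fun k => if k == j then A else setT); split => //.
- by rewrite /= pj.
- by move=> k; case: eqP => // ->.
- apply/seteqP; split => w; last first.
    by move=> /(_ j); rewrite /= inE eqxx => /(_ isT).
  by move=> Aw k /=; rewrite inE => /eqP ->; rewrite eqxx.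
Qed.

Lemma cylinders_setI p : setI_closed (cylinders p).
Proof.
move=> _ _ [s [E [us ps hE ->]]] [s' [E' [us' ps' hE' ->]]].
exists (undup (s ++ s')), (fun j => (if j \in s then E j else setT) `&`
  (if j \in s' then E' j else setT)); split.
- exact: undup_uniq.
- by rewrite all_undup all_cat ps.
- by move=> j; apply: HI; case: ifP.
- apply/seteqP; split => w.
    move=> [h h'] j /=; rewrite mem_undup mem_cat => _; split.
      by case: ifP => // js; exact: h.
    by case: ifP => // js; exact: h'.
  move=> h; split => j /= js.
    by have := h j; rewrite /= mem_undup mem_cat js => /(_ isT)[].
  by have := h j; rewrite /= mem_undup mem_cat js orbT => /(_ isT)[].
Qed.

Lemma cylinders_indep p A B : cylinders p A -> cylinders (predC p) B ->
  P (A `&` B) = (P A * P B)%E.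
Proof.
move=> [s [E [us ps hE ->]]] [s' [E' [us' ps' hE' ->]]].
pose F j := if p j then E j else E' j.
have Fs j : j \in s -> F j = E j by move=> js; rewrite /F (allP ps j js).
have Fs' j : j \in s' -> F j = E' j.
  by move=> js; have /= := allP ps' j js; rewrite /F => /negbTE ->.
have hF j : H j (F j) by rewrite /F; case: ifP.
have -> : \bigcap_(j in [set` s]) E j = \bigcap_(j in [set` s]) F j.
  by apply: eq_bigcapr => j /= js; rewrite Fs.
have -> : \bigcap_(j in [set` s']) E' j = \bigcap_(j in [set` s']) F j.
  by apply: eq_bigcapr => j /= js; rewrite Fs'.
have uss : uniq (s ++ s').
  rewrite cat_uniq us us' andbT /=; apply/hasPn => j js'.
  by apply/negP => js; have /= := allP ps' j js'; rewrite (allP ps j js).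
have -> : \bigcap_(j in [set` s]) F j `&` \bigcap_(j in [set` s']) F j =
    \bigcap_(j in [set` s ++ s']) F j.
  apply/seteqP; split => w.
    by move=> [h h'] j /=; rewrite mem_cat => /orP[]; [exact: h|exact: h'].
  by move=> h; split => j /= js; apply: h; rewrite /= mem_cat js ?orbT.
rewrite (indep uss) => [|j _]; last exact: hF.
rewrite (indep us) => [|j _]; last exact: hF.
rewrite (indep us') => [|j _]; last exact: hF.
by rewrite big_cat.
Qed.

(** The pi-lambda theorem, applied to one side after the other. *)
Lemma sigma_indep p A B : <<s cylinders p >> A -> <<s cylinders (predC p) >> B ->
  P (A `&` B) = (P A * P B)%E.
Proof.
have ext q A' : measurable A' ->
    (forall B', cylinders q B' -> P (B' `&` A') = (P B' * P A')%E) ->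
    forall B', <<s cylinders q >> B' -> P (B' `&` A') = (P B' * P A')%E.
  move=> mA' h B' hB'.
  have fA : 0 <= fine (P A') by rewrite fine_ge0.
  have e C : mscale (NngNum fA) P C = (P C * P A')%E.
    by rewrite /mscale /= fineK ?fin_num_measure// muleC.
  rewrite -e; apply: (g_sigma_algebra_measure_unique (cylinders q) _ (fun=> setT)
    _ _ (mrestr P mA') (mscale (NngNum fA) P)) => //.
  - exact: cylinders_measurable.
  - by move=> _; exact: cylindersT.
  - by rewrite bigcup_const//; exists 0%N.
  - exact: cylinders_setI.
  - by move=> C hC; apply: etrans (esym (e C)); exact: h.
  - move=> _; suff : (P (setT `&` A') < +oo)%E by [].
    by rewrite setTI ltey_eq fin_num_measure.
have sm q C : <<s cylinders q >> C -> measurable C.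
  move=> hC; apply: (smallest_sub _ _ hC); last exact: cylinders_measurable.
  exact: sigma_algebra_measurable.
move=> hA hB; rewrite setIC muleC.
apply: (ext (predC p)) => //; first exact: sm hA.
move=> B' hB'; rewrite setIC muleC.
apply: (ext p) => //; first exact: cylinders_measurable hB'.
by move=> A' hA'; exact: cylinders_indep hA' hB'.
Qed.

End Independence.

Section DiagonalFubini.
Context {R : realType} {d : measure_display} {Om : measurableType d}.
Variable P : probability Om R.
Variables U V : set (set Om).
Hypotheses (Um : U `<=` measurable) (Vm : V `<=` measurable).
Hypothesis indep : forall A B, <<s U >> A -> <<s V >> B ->
  P (A `&` B) = (P A * P B)%E.

Let T1 := g_sigma_algebraType U.
Let T2 := g_sigma_algebraType V.

(** By independence the diagonal map pushes P to a product measure, for which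
   Fubini applies. C is an arbitrary set: it lies inside the measurable set
   of those w1 whose section is null, and it is this set that is used. *)
Lemma null_diagonal (E : set (T1 * T2)) (C : set Om) : measurable E ->
  (forall w1, C w1 -> P.-negligible (xsection E (w1 : T1) : set Om)) ->
  P.-negligible [set w : Om | C w /\ E ((w : T1), (w : T2))].
Proof.
move=> mE hC.
have sm W : W `<=` @measurable _ Om -> forall A, <<s W >> A -> @measurable _ Om A.
  move=> hW A hA; apply: (smallest_sub _ _ hA) => //.
  exact: sigma_algebra_measurable.
have m1 : measurable_fun [set: Om] (fun w : Om => w : T1).
  by move=> _ A hA; rewrite setTI; apply: (sm U).
have m2 : measurable_fun [set: Om] (fun w : Om => w : T2).
  by move=> _ A hA; rewrite setTI; apply: (sm V).
pose X1 : {mfun Om >-> T1} := mfun_Sub (mem_set m1).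
pose X2 : {mfun Om >-> T2} := mfun_Sub (mem_set m2).
have m12 : measurable_fun [set: Om] (fun w : Om => ((w : T1), (w : T2))).
  exact: measurable_fun_pair.
pose X12 : {mfun Om >-> (T1 * T2)%type} := mfun_Sub (mem_set m12).
have prodE A B : measurable A -> measurable B ->
    distribution P X12 (A `*` B) = (distribution P X1 A * distribution P X2 B)%E.
  by move=> mA mB; exact: indep.
pose N := [set w1 : T1 | distribution P X2 (xsection E w1) = 0%E].
have mN : measurable N.
  rewrite -[N]setTI.
  apply: (measurable_eqe measurableT
    (measurable_fun_xsection (distribution P X2) mE)).
  exact: measurable_cst.
pose E' := E `&` (N `*` setT).
have mE' : measurable E' by apply: measurableI => //; exact: measurableX.
have E'0 : distribution P X12 E' = 0%E.
  rewrite -(product_measure_unique prodE mE').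
  rewrite /product_measure1; apply: integral0_eq => w1 _ /=.
  have [hN|hN] := pselect (N w1).
    rewrite (_ : xsection E' w1 = xsection E w1)//.
    apply/seteqP; split => w; rewrite /xsection /= !inE; first by case.
    by move=> h; split.
  rewrite (_ : xsection E' w1 = set0)// -subset0 => w.
  by rewrite /xsection /= inE => -[_ [/hN]].
have mD : @measurable _ Om ((fun w : Om => ((w : T1), (w : T2))) @^-1` E').
  by rewrite -[X in measurable X]setTI; exact: (m12 measurableT E' mE').
exists ((fun w : Om => ((w : T1), (w : T2))) @^-1` E'); split => //.
move=> w [Cw Ew] /=; split => //; split => //=.
have mx : @measurable _ Om (xsection E (w : T1)).
  exact: (sm V Vm _ (@measurable_xsection _ _ T1 T2 E (w : T1) mE)).
by have /(negligibleP _ mx) := hC w Cw.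
Qed.

End DiagonalFubini.

(** * Measurable dependence on the coefficients *)

Section MeasurableFlow.
Context {R : realType} {d : measure_display} {W : measurableType d}.

Definition measurable_real (g : W -> R) := measurable_fun [set: W] g.

Lemma measurable_algebra : fun_algebra measurable_real.
Proof.
split=> [c|g h hg hh|g h hg hh]; first exact: measurable_cst.
  exact: measurable_funD.
exact: measurable_funM.
Qed.

Lemma clamp_measurable lo hi g : measurable_real g ->
  measurable_real (fun w => clamp lo hi (g w)).
Proof.
move=> hg; apply: measurable_maxr; first exact: measurable_cst.
by apply: measurable_minr => //; exact: measurable_cst.
Qed.

(** The inverse of 0 being 0, inversion on nonnegative numbers is the power
   function of exponent -1. *)
Lemma inv_measurable g : (forall w, 0 <= g w) -> measurable_real g ->
  measurable_real (fun w => (g w)^-1).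
Proof.
move=> g0 hg; under eq_fun do rewrite -powR_inv1//.
exact: (measurableT_comp (measurable_powR _)).
Qed.

(** [invmx] is the cofactor formula on the measurable set where the
   determinant is nonzero, and the identity elsewhere. *)
Lemma invmx_measurable p (A : W -> 'M[R[i]]_p) : mxfun measurable_real A ->
  mxfun measurable_real (fun w => invmx (A w)).
Proof.
move=> mA; have mD : measurable_real (fun w => normsq (\det (A w))).
  have [h1 h2] := cfun_det measurable_algebra mA.
  apply: (alg_add measurable_algebra);
    by under eq_fun do rewrite expr2; exact: (alg_mul measurable_algebra).
have mI : mxfun measurable_real (fun w => (\det (A w))^-1 *: \adj (A w)).
  apply: (mxfun_invdet measurable_algebra mA); apply: inv_measurable => // w.
  exact: normsq_ge0.
have mU : measurable_fun [set: W] (fun w => A w \in unitmx).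
  rewrite (_ : (fun _ => _) = fun w => 0 < normsq (\det (A w))).
    by apply: measurable_fun_ltr => //; exact: measurable_cst.
  by apply/funext => w; rewrite unitmxE unitfE lt0r normsq_ge0 andbT normsq_eq0.
move=> k l; have [h1 h2] := mI k l; have [h3 h4] := mA k l.
have split_if (g : R[i] -> R) : (fun w => g (invmx (A w) k l)) = (fun w =>
    if A w \in unitmx then g (((\det (A w))^-1 *: \adj (A w)) k l)
    else g (A w k l)).
  by apply/funext => w; rewrite /invmx; case: ifP.
by split; rewrite split_if; exact: measurable_fun_ifT mU _ _.
Qed.

Lemma cvg0_measurable (u : nat -> W -> R) : (forall J, measurable_real (u J)) ->
  measurable [set w | u ^~ w @ \oo --> (0 : R)].
Proof.
move=> mu.
rewrite (_ : [set w | _] = \bigcap_(p : nat) \bigcup_(q : nat) \bigcap_(J in [set J | (q <= J)%N])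
    [set w | `|u J w| <= p.+1%:R^-1]).
  apply: bigcapT_measurable => p; apply: bigcupT_measurable => q.
  apply: bigcap_measurable => [|J _]; first by exists q => /=.
  rewrite -[X in measurable X]setTI.
  have mn : measurable_real (fun w => `|u J w|).
    exact: (measurableT_comp (@normr_measurable _ _) (mu J)).
  apply: (measurable_fun_le measurableT mn); exact: measurable_cst.
apply/seteqP; split => [w /= /cvgrPdist_le h p _|w /= h].
  have e0 : 0 < p.+1%:R^-1 :> R by rewrite invr_gt0.
  have [q _ hq] := h _ e0; exists q => // J qJ.
  by have := hq J qJ; rewrite /= sub0r normrN.
apply/cvgrPdist_le => e e0.
have [p hp] : exists p : nat, p.+1%:R^-1 <= e.
  exists (Num.truncn e^-1); rewrite invf_ple ?posrE//.
  exact: ltW (truncnS_gt _).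
have [q _ hq] := h p I; exists q => // J qJ /=.
by rewrite sub0r normrN (le_trans _ hp)//; exact: hq.
Qed.

Lemma cmx_cvg0_measurable p (A : nat -> W -> 'M[R[i]]_p) :
  (forall J, mxfun measurable_real (A J)) ->
  measurable [set w | cmx_cvg \oo (A ^~ w) 0].
Proof.
move=> mA.
rewrite (_ : [set w | _] = \bigcap_(ij : 'I_p * 'I_p)
  ([set w | (fun J => complex.Re (A J w ij.1 ij.2)) @ \oo --> (0 : R)] `&`
   [set w | (fun J => complex.Im (A J w ij.1 ij.2)) @ \oo --> (0 : R)])).
  apply: fin_bigcap_measurable => // ij _.
  apply: measurableI.
    by apply: (cvg0_measurable (u := fun J w => complex.Re (A J w ij.1 ij.2))) => J; case: (mA J ij.1 ij.2).
  by apply: (cvg0_measurable (u := fun J w => complex.Im (A J w ij.1 ij.2))) => J; case: (mA J ij.1 ij.2).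
apply/seteqP; split => [w h [i j] _ /=|w h i j].
  by have := h i j; rewrite mxE.
by have /= := h (i, j) I; rewrite mxE.
Qed.

Section CayleyMeasurable.
Context {n : nat}.
Implicit Types Z K Y : W -> 'M[R[i]]_n.

Lemma cayley_measurable Z : mxfun measurable_real Z ->
  mxfun measurable_real (fun w => cayley (Z w)).
Proof.
move=> mZ; have c1 := mxfun_cst measurable_algebra (1%:M : 'M[R[i]]_n).
apply: (mxfun_sub measurable_algebra) => //.
under eq_fun do rewrite mulr2n.
have mi : mxfun measurable_real (fun w => invmx (Z w + 1%:M)).
  by apply: invmx_measurable; exact: (mxfun_add measurable_algebra).
exact: (mxfun_add measurable_algebra).
Qed.

Lemma cayley_inv_measurable K : mxfun measurable_real K ->
  mxfun measurable_real (fun w => cayley_inv (K w)).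
Proof.
move=> mK; have c1 := mxfun_cst measurable_algebra (1%:M : 'M[R[i]]_n).
apply: (mxfun_mul measurable_algebra); first exact: (mxfun_add measurable_algebra).
by apply: invmx_measurable; exact: (mxfun_sub measurable_algebra).
Qed.

Lemma chart_start_measurable Y Yg : mxfun measurable_real Y ->
  mxfun measurable_real (fun w => chart_start (Y w) Yg).
Proof.
move=> mY; apply: cayley_measurable; apply: (mxfun_adj measurable_algebra).
apply: (mxfun_mul measurable_algebra (M := fun=> Yg)).
  exact: (mxfun_cst measurable_algebra).
exact: (mxfun_adj measurable_algebra).
Qed.

End CayleyMeasurable.

Section Flow.
Context {n m M : nat}.
Variables (S : 'I_m -> 'M[R[i]]_n) (f : 'I_m -> R) (T : R).
Hypothesis hT : 0 < T.
Variables (a : nat -> W -> 'M[R]_(m, M)) (B0 K0 : W -> 'M[R[i]]_n) (b c : R).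
Hypotheses (b0 : 0 <= b) (ha : forall w j k l, `|a j w k l| <= c).
Hypotheses (mB : mxfun measurable_real B0) (mK : mxfun measurable_real K0).

(** The Euler polygons depend measurably on the parameters, by induction on
   the steps, and the flow is their limit. Up to time J T they involve the
   coefficients of the first J periods only. *)
Lemma flow_measurable J c' :
  (forall j k l, (j < J)%N -> measurable_real (fun w => a j w k l)) ->
  mxfun measurable_real (fun w => mx_of c'
    (flow S f T (a ^~ w) b (B0 w) (K0 w) (J%:R * T))).
Proof.
move=> ma.
suff h i : measurable_real (fun w => flow S f T (a ^~ w) b (B0 w) (K0 w) (J%:R * T) i).
  by move=> i j; split; under eq_fun do rewrite mxE /=; exact: h.
have t0 : 0 <= J%:R * T by rewrite mulr_ge0// ltW.
pose G w t := trunc_field S f b (ref_control T (a ^~ w) t).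
apply: (@measurable_fun_cvg _ _ _ _
  (fun N w => euler_at T (G w) N (coords (B0 w) (K0 w)) (J%:R * T) i)); last first.
  move=> w _; have [C C0 [h1 h2]] := trunc_field_bounded_lip S f T b0 (ha w).
  exact: (euler_limit_cvg hT C0 h1 h2).
move=> N; rewrite /euler_at -(mesh_pow _ N) mulfK ?gt_eqF ?mesh_gt0// natrK.
suff h k : (k <= J * 2 ^ N)%N -> forall i,
    measurable_real (fun w => euler T (G w) N (coords (B0 w) (K0 w)) k i).
  exact: h.
elim: k => [_ j|k IH kJ j] /=; first exact: alg_coords.
apply: (alg_add measurable_algebra); first exact: IH (ltnW kJ) j.
apply: (alg_mul measurable_algebra); first exact: alg_cst measurable_algebra _.
apply: (trunc_field_alg S f measurable_algebra) => [g|l|l].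
- exact: clamp_measurable.
- apply: (alg_sum measurable_algebra) => p; apply: (alg_mul measurable_algebra).
    rewrite -/(piece T (k%:R * mesh T N)) (piece_grid hT).
    by apply: ma; rewrite ltn_divLR ?expn_gt0.
  exact: alg_cst measurable_algebra _.
- by apply: clamp_measurable; exact: IH (ltnW kJ) l.
Qed.

End Flow.

End MeasurableFlow.

(** * Restart from a random state *)

Section Criterion.
Context {R : realType} {n m M : nat}.
Variables (S : 'I_m -> 'M[R[i]]_n) (f : 'I_m -> R) (T : R).
Hypotheses (hS : forall k, skew_hermitian (S k)) (hf : forall k, 0 < f k).
Hypothesis hT : 0 < T.

(** At the sampling times Xi = R (1 + K) (1 - K)^-1 with R = Yg Y0^dagger, and
   the Cayley transform is continuous at both ends. This restates convergence
   as a property of the flow, which makes sense for any parameters. *)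
Lemma sampled_limit_chart (L : nat) (a : nat -> 'M[R]_(m, M)) (b c : R)
    (Y0 Yg : 'M[R[i]]_n) Xb Y :
  Y0 \is unitarymx -> 0 <= b -> (forall j k l, `|a j k l| <= c) ->
  1 + n%:R + sqnorm (chart_start Y0 Yg) <= b ^+ 2 ->
  closed_loop S f T (L%:R * T) Y0 Yg a Xb Y ->
  cmx_cvg \oo (fun j : nat => Y (j%:R * T) *m Y0^t*) (Yg *m Y0^t*) <->
  cmx_cvg \oo (fun J : nat => mx_of false (flow S f T (fun j => a (L + j)%N) b
    (Yg *m Y0^t*) (chart_start Y0 Yg) (J%:R * T))) 0.
Proof.
move=> u0 b0 ha hb cl.
have Foo : Filter (\oo : set_system nat) by exact: _.
set K := fun J : nat => mx_of false _.
have uR : Yg *m Y0^t* \is unitarymx.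
  have [[<- _ uX _] _ _] := cl; apply: uX; exact: lexx.
have shiftP (U : nat -> 'M[R[i]]_n) A :
    cmx_cvg \oo (fun J => U (L + J)%N) A <-> cmx_cvg \oo U A.
  rewrite (_ : (fun J => _) = fun J => U (J + L)%N); last first.
    by apply/funext => J; rewrite addnC.
  by split=> h i j; have := h i j;
    rewrite (cvg_shiftn L (fun J => complex.Re (U J i j)))
      (cvg_shiftn L (fun J => complex.Im (U J i j))).
rewrite -shiftP.
have hK J : skew_hermitian (K J) /\
    Y ((L + J)%:R * T) *m Y0^t* = (Yg *m Y0^t*) *m cayley_inv (K J).
  have [h1 [h2 h3]] := closed_loop_flow hS hf hT u0 b0
    (fun j => ha (L + j)%N) hb (closed_loop_shift hT cl) J.
  split; first exact: h1.
  move: h2; rewrite h3 -!mulrDl -natrD (closed_loop_reference hS hT J cl).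
  exact.
split=> h.
  have := cmx_cvg_mul (FF := Foo) (cmx_cvg_cst (FF := Foo) ((Yg *m Y0^t*)^t*)) h.
  rewrite (unitarymxVK uR) => /(cayley_cvg0 (FF := Foo)).
  apply: cmx_cvg_ext => J; have [sK ->] := hK J.
  by rewrite mulmxA (unitarymxVK uR) mul1mx (chart_cayley (cayley_invP sK)).
have := cmx_cvg_mul (FF := Foo) (cmx_cvg_cst (FF := Foo) (Yg *m Y0^t*))
  (cayley_inv_cvg1 (FF := Foo) h).
by rewrite mulmx1; apply: cmx_cvg_ext => J; have [_ ->] := hK J.
Qed.

End Criterion.

Section UniformCoefficients.
Context {R : realType} {d : measure_display} {Om : measurableType d}.
Variable P : probability Om R.

(** The cube itself is one of the boxes, and its volume ratio is 1. *)
Lemma uniform_bounded m M (amax : R) (a : nat -> Om -> 'M[R]_(m, M)) : 0 < amax ->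
  (forall j, uniform_on_cube P amax (a j)) ->
  P.-negligible [set w | ~ forall j k l, `|a j w k l| <= amax / 2].
Proof.
move=> am0 ha.
pose c := amax / 2; have c0 : - c <= c by rewrite -subr_ge0 opprK addr_ge0// divr_ge0// ltW.
pose Q j := a j @^-1` mx_box (const_mx (- c)) (const_mx c).
have hQ j : P.-negligible (~` Q j).
  have [mj vj] := ha j.
  have mQ : measurable (Q j).
    rewrite (_ : Q j = \bigcap_(kl : 'I_m * 'I_M) [set w | `|a j w kl.1 kl.2| <= c]).
      apply: fin_bigcap_measurable => // kl _; rewrite -[X in measurable X]setTI.
      have mn : measurable_fun [set: Om] (fun w => `|a j w kl.1 kl.2|).
        exact: (measurableT_comp (@normr_measurable _ _) (mj _ _)).
      by apply: (measurable_fun_le measurableT mn); exact: measurable_cst.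
    apply/seteqP; split=> [w h [k l] _|w h k l] /=.
      by have := h k l; rewrite !mxE ler_norml.
    by have := h (k, l) I; rewrite !mxE /= ler_norml.
  exists (~` Q j); split; [exact: measurableC| |by []].
  have -> := probability_setC P mQ.
  rewrite vj => [|k l]; last by rewrite !mxE.
  rewrite (_ : mx_vol _ _ = amax ^+ (m * M)).
    by rewrite divff ?expf_neq0 ?gt_eqF// subee.
  rewrite /mx_vol; under eq_bigr do under eq_bigr do
    rewrite !mxE opprK -[c + c]mulr2n -mulr_natr divfK ?pnatr_eq0//.
  by rewrite !prodr_const !card_ord -exprM mulnC.
apply: negligibleS (negligible_bigcup hQ) => w /= h; apply: contrapT => h'; apply: h.
move=> j k l; have : Q j w by apply: contrapT => hj; apply: h'; exists j.
by move=> /(_ k l); rewrite !mxE ler_norml.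
Qed.

Lemma sigma_rv_measurable m' M' (A : Om -> 'M[R]_(m', M')) :
  (forall k l, measurable_fun [set: Om] (fun w => A w k l)) ->
  sigma_rv A `<=` measurable.
Proof.
move=> mA; apply: smallest_sub; first exact: sigma_algebra_measurable.
move=> _ [k [l [B [mB ->]]]]; rewrite -[X in measurable X]setTI.
exact: (mA k l measurableT B mB).
Qed.

Lemma sigma_algebra_setI (G : set (set Om)) : setI_closed <<s G >>.
Proof.
move=> A B hA hB; exact: (@measurableI _ (g_sigma_algebraType G)).
Qed.

Lemma entry_measurable (H : nat -> set (set Om)) (p : pred nat) j m M
    (A : Om -> 'M[R]_(m, M)) k l : (forall j, H j setT) -> p j ->
  H j = sigma_rv A ->
  @measurable_fun _ _ (g_sigma_algebraType (cylinders H p)) _ setT (fun w => A w k l).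
Proof.
move=> HT pj HA _ B mB; rewrite setTI; apply: sub_sigma_algebra.
apply: (sub_cylinders HT pj); rewrite HA; apply: sub_sigma_algebra.
by exists k, l, B.
Qed.

End UniformCoefficients.

Section Restart.
Context {R : realType} {d : measure_display} {Om : measurableType d}.
Variable P : probability Om R.
Context {n m M1 M : nat}.
Variables (S : 'I_m -> 'M[R[i]]_n) (f : 'I_m -> R) (T amax : R).
Hypotheses (hS : forall k, skew_hermitian (S k)) (hf : forall k, 0 < f k).
Hypotheses (hT : 0 < T) (amax0 : 0 < amax).
Variables (L : nat) (a1 : nat -> Om -> 'M[R]_(m, M1))
  (a2 : nat -> Om -> 'M[R]_(m, M)) (Xg : 'M[R[i]]_n).
Hypotheses
  (m1 : forall j k l, measurable_fun [set: Om] (fun w => a1 j w k l))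
  (u2 : forall j, uniform_on_cube P amax (a2 j)).

(** Step one consumes the coefficients a1 before time L T, step two the
   coefficients a2 afterwards. *)
Definition source (j : nat) : set (set Om) :=
  if (j < L)%N then sigma_rv (a1 j) else sigma_rv (a2 j).

Hypothesis indep : mutually_independent P source.

Definition past := cylinders source (fun j => (j < L)%N).
Definition future := cylinders source (fun j => ~~ (j < L)%N).

Lemma sourceT j : source j setT.
Proof.
by rewrite /source; case: ifP => _;
  exact: (@measurableT _ (g_sigma_algebraType _)).
Qed.

Lemma source_setI j : setI_closed (source j).
Proof.
by rewrite /source; case: ifP => _; exact: sigma_algebra_setI.
Qed.

Lemma source_measurable j : source j `<=` measurable.
Proof.
rewrite /source; case: ifP => _; apply: sigma_rv_measurable.
  exact: m1.
by case: (u2 j).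
Qed.

Variable y : Om -> 'M[R[i]]_n.
Hypothesis my : mxfun (@measurable_real R _ (g_sigma_algebraType past)) y.

(** For a fixed past in C almost every future leads to convergence, so that
   [null_diagonal] applies to the event that it fails. The integer rho is a
   cutoff radius that suits all the states y w1 with w1 in C, so one flow
   describes all these closed loops. *)
Lemma restart_null (rho : nat) (C : set Om) :
  (forall w1, C w1 -> [/\ y w1 \is unitarymx, in_W (Xg *m (y w1)^t*),
    1 + n%:R + sqnorm (chart_start (y w1) Xg) <= rho%:R ^+ 2 &
    {ae P, forall w, forall Xb Y,
      closed_loop S f T (L%:R * T) (y w1) Xg (a2 ^~ w) Xb Y ->
      cmx_cvg \oo (fun j : nat => Y (j%:R * T) *m (y w1)^t*)
        (Xg *m (y w1)^t*)}]) ->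
  P.-negligible [set w | C w /\ exists Xb Y,
    closed_loop S f T (L%:R * T) (y w) Xg (a2 ^~ w) Xb Y /\
    ~ cmx_cvg \oo (fun j : nat => Y (j%:R * T) *m (y w)^t*) (Xg *m (y w)^t*)].
Proof.
move=> hC; have nbd := uniform_bounded amax0 u2.
set N := [set w | ~ _] in nbd.
have c0 : 0 <= amax / 2 by rewrite divr_ge0// ltW.
pose at_ j w := clip (amax / 2) (a2 j w).
have atE w : ~ N w -> forall j, at_ j w = a2 j w.
  by move=> /contrapT h j; apply: clip_id => k l; exact: h.
pose T1 := g_sigma_algebraType past; pose T2 := g_sigma_algebraType future.
pose K (J : nat) (p : T1 * T2) : 'M[R[i]]_n := mx_of false
  (flow S f T (fun j => at_ (L + j)%N p.2) rho%:R (Xg *m (y p.1)^t*)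
    (chart_start (y p.1) Xg) (J%:R * T)).
(* The event that step two fails, for a past p.1 and a future p.2. *)
pose E : set (T1 * T2) := ~` [set p | cmx_cvg \oo (K ^~ p) 0].
have critP w1 w Xb Y : C w1 -> ~ N w ->
    closed_loop S f T (L%:R * T) (y w1) Xg (a2 ^~ w) Xb Y ->
    cmx_cvg \oo (fun j : nat => Y (j%:R * T) *m (y w1)^t*) (Xg *m (y w1)^t*) <->
    ~ E (w1, w).
  move=> Cw1 Nw cl; have [uy _ hb _] := hC _ Cw1.
  have /contrapT hbd := Nw.
  rewrite (sampled_limit_chart hS hf hT uy (ler0n _ rho) hbd hb cl).
  have -> : (fun j => a2 (L + j)%N w) = (fun j => at_ (L + j)%N w).
    by apply/funext => j; rewrite atE.
  rewrite -[X in cmx_cvg _ X 0]/(K ^~ (w1, w)).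
  by split=> [h|/contrapT]; [exact|].
have my1 : mxfun (@measurable_real R _ (T1 * T2)%type) (fun p => y p.1).
  by move=> i j; have [h1 h2] := my i j; split;
    [exact: (measurableT_comp h1 measurable_fst)
    |exact: (measurableT_comp h2 measurable_fst)].
have mE : measurable E.
  apply: measurableC; apply: cmx_cvg0_measurable => J.
  apply: (flow_measurable S f hT (c := amax / 2)); first exact: ler0n.
  - by move=> p j k l; exact: clip_norm.
  - apply: (mxfun_mul (@measurable_algebra R _ _) (M := fun=> Xg)).
      exact: (mxfun_cst (@measurable_algebra R _ _)).
    exact: (mxfun_adj (@measurable_algebra R _ _)).
  - exact: chart_start_measurable.
  - move=> j k l _; under eq_fun do rewrite mxE.
    have h : @measurable_real R _ T2 (fun w => a2 (L + j)%N w k l).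
      apply: (entry_measurable k l sourceT (j := (L + j)%N)).
        by rewrite -leqNgt leq_addr.
      by rewrite /source ltnNge leq_addr.
    exact: (clamp_measurable _ _ (measurableT_comp h measurable_snd)).
have pm p : cylinders source p `<=` measurable.
  exact: (cylinders_measurable source_measurable).
have pf_indep A B : <<s past >> A -> <<s future >> B ->
    P (A `&` B) = (P A * P B)%E.
  exact: (sigma_indep sourceT source_setI source_measurable indep).
(* For a fixed past in C, the closed loop exists and converges almost surely,
   so that almost every future lies outside the section of E. *)
have nD : P.-negligible [set w : Om | C w /\ E ((w : T1), (w : T2))].
  apply: (null_diagonal (pm _) (pm _) pf_indep mE) => w1 Cw1.
  have [uy hW _ hae] := hC _ Cw1.
  apply: negligibleS (negligibleU nbd hae) => w.
  rewrite /xsection /= inE => Ew; have [Nw|Nw] := pselect (N w); [by left|right].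
  move=> h.
  have /contrapT hbd := Nw.
  have [Xb [Y cl]] := closed_loop_exists hS hf hT uy hW (fun j => hbd (L + j)%N).
  have cl' := closed_loop_unshift hT (a := a2 ^~ w) cl.
  by have /(critP _ _ _ _ Cw1 Nw cl') := h _ _ cl'.
apply: negligibleS (negligibleU nbd nD) => w [Cw [Xb [Y [cl ncvg]]]].
have [Nw|Nw] := pselect (N w); [by left|right; split => //].
by apply: contrapT => nE; apply: ncvg; apply/(critP _ _ _ _ Cw Nw cl).
Qed.

End Restart.

(** * The two steps with stochastic laws *)

Section Stochastic.
Context {R : realType} {n m : nat}.
Variables (S : 'I_m -> 'M[R[i]]_n) (T : R) (X0 X1 Xg : 'M[R[i]]_n).
Hypotheses (hS : forall k, skew_hermitian (S k)) (hT : 0 < T).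
Hypotheses (u0 : X0 \is unitarymx) (ug : Xg \is unitarymx).
Context {d : measure_display} {Om : measurableType d}.
Variable P : probability Om R.
Variables (f1 f2 : 'I_m -> R) (amax1 amax2 : R) (M1 : nat)
  (a1 : nat -> Om -> 'M[R]_(m, M1)) (M2 : nat -> 'M[R[i]]_n -> nat)
  (a2 : forall M : nat, nat -> Om -> 'M[R]_(m, M)).
Hypotheses (hf1 : forall k, 0 < f1 k) (hf2 : forall k, 0 < f2 k)
  (am1 : 0 < amax1) (am2 : 0 < amax2)
  (uni1 : forall j, uniform_on_cube P amax1 (a1 j))
  (uni2 : forall M j, uniform_on_cube P amax2 (a2 M j)).

Let K0 := chart_start X0 X1.
Let b1 := 1 + n%:R + sqnorm K0.

Lemma radius_ge1 (A : 'M[R[i]]_n) : 1 <= 1 + n%:R + sqnorm A.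
Proof. by rewrite -addrA lerDl addr_ge0// sqnorm_ge0. Qed.

Definition step_one_flow (w : Om) (L : nat) :=
  flow S f1 T (fun j => clip (amax1 / 2) (a1 j w)) b1 (X1 *m X0^t*) K0 (L%:R * T).

(** The state X (L T) of step one as a function of the coefficients; clipping
   makes it meaningful, and measurable, everywhere. *)
Definition step_one_state (L : nat) (w : Om) : 'M[R[i]]_n :=
  mx_of true (step_one_flow w L) *m cayley_inv (mx_of false (step_one_flow w L)) *m X0.

Lemma step_one_stateE (L : nat) w Xb X :
  (forall j k l, `|a1 j w k l| <= amax1 / 2) ->
  closed_loop S f1 T 0 X0 X1 (a1 ^~ w) Xb X -> X (L%:R * T) = step_one_state L w.
Proof.
move=> ha cl.
have b1E : b1 <= b1 ^+ 2.
  have r1 : 1 <= b1 := radius_ge1 K0.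
  by rewrite expr2 ler_peMr// (le_trans ler01).
have b10 : 0 <= b1 := le_trans ler01 (radius_ge1 K0).
have [_ [h _]] := closed_loop_flow hS hf1 hT u0 b10 ha b1E cl L.
rewrite /step_one_state /step_one_flow.
have -> : (fun j => clip (amax1 / 2) (a1 j w)) = a1 ^~ w.
  by apply/funext => j; apply: clip_id => k l; exact: ha.
by rewrite -h -mulmxA (unitarymxVK u0) mulmx1.
Qed.

Lemma step_one_state_measurable (L M : nat) :
  mxfun (@measurable_real R _ (g_sigma_algebraType (past L a1 (a2 M)))) (step_one_state L).
Proof.
have c0 : 0 <= amax1 / 2 by rewrite divr_ge0// ltW.
have b10 : 0 <= b1 := le_trans ler01 (radius_ge1 K0).
set W := g_sigma_algebraType _.
have alg := @measurable_algebra R _ W.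
have mf c : mxfun (@measurable_real R _ W) (fun w => mx_of c (step_one_flow w L)).
  apply: (flow_measurable S f1 hT (c := amax1 / 2) b10).
  - by move=> w j k l; exact: clip_norm.
  - exact: (mxfun_cst alg).
  - exact: (mxfun_cst alg).
  - move=> j k l jL; under eq_fun do rewrite mxE.
    have aE : source L a1 (a2 M) j = sigma_rv (a1 j).
      by rewrite /source jL.
    apply: clamp_measurable.
    exact: (entry_measurable (p := fun j => (j < L)%N) k l
      (sourceT L a1 (a2 M)) jL aE).
apply: (mxfun_mul alg (N := fun=> X0)); last exact: (mxfun_cst alg).
by apply: (mxfun_mul alg) => //; exact: cayley_inv_measurable.
Qed.

(** The pasts are sorted by L, by the number M of harmonics chosen for the
   state X (L T) and by an integer bound rho on its chart; [restart_null]
   applies to each of these countably many classes. *)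
Lemma stochastic_stabilization :
  in_W (Xg *m X1^t*) ->
  sto_big_enough S f1 amax1 T 0 X0 X1 M1 ->
  (forall (L : nat) (Y0 : 'M[R[i]]_n),
     Y0 \is unitarymx -> in_W (Xg *m Y0^t*) ->
     sto_big_enough S f2 amax2 T (L%:R * T) Y0 Xg (M2 L Y0)) ->
  mutually_independent P (fun j => sigma_rv (a1 j)) ->
  (forall L M : nat,
     mutually_independent P (fun j =>
       if (j < L)%N then sigma_rv (a1 j) else sigma_rv (a2 M j))) ->
  {ae P, forall w,
    (exists Xb X, closed_loop S f1 T 0 X0 X1 (a1 ^~ w) Xb X) /\
    forall Xb X, closed_loop S f1 T 0 X0 X1 (a1 ^~ w) Xb X ->
      (exists L : nat, in_W (Xg *m (X (L%:R * T))^t*)) /\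
      forall L : nat, in_W (Xg *m (X (L%:R * T))^t*) ->
        let M := M2 L (X (L%:R * T)) in
        (exists Xb2 Y,
           closed_loop S f2 T (L%:R * T) (X (L%:R * T)) Xg (a2 M ^~ w) Xb2 Y) /\
        forall Xb2 Y,
          closed_loop S f2 T (L%:R * T) (X (L%:R * T)) Xg (a2 M ^~ w) Xb2 Y ->
          cmx_cvg \oo
            (fun j : nat => switched (L%:R * T) X Y (j%:R * T)) Xg}.
Proof.
move=> hW [_ sto1] sto2 ind1 ind2.
pose C (L M rho : nat) (w : Om) := let y := step_one_state L w in
  [/\ y \is unitarymx, in_W (Xg *m y^t*),
      1 + n%:R + sqnorm (chart_start y Xg) <= rho%:R ^+ 2 & M2 L y = M].
have nstep2 L M rho := restart_null hS hf2 hT am2 (fun j => proj1 (uni1 j))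
  (uni2 M) (ind2 L M) (step_one_state_measurable L M) (Xg := Xg) (rho := rho) (C := C L M rho).
have {nstep2} ae2 : {ae P, forall w, forall L M rho, C L M rho w ->
    forall Xb Y,
    closed_loop S f2 T (L%:R * T) (step_one_state L w) Xg (a2 M ^~ w) Xb Y ->
    cmx_cvg \oo (fun j : nat => Y (j%:R * T) *m (step_one_state L w)^t*)
      (Xg *m (step_one_state L w)^t*)}.
  apply: ae_foralln => L; apply: ae_foralln => M; apply: ae_foralln => rho.
  apply: negligibleS (nstep2 L M rho _) => [w /= h|w1 [uy hy hb hM]].
    have [Cw|nC] := pselect (C L M rho w); last by exfalso; exact: h.
    split => //; apply: contrapT => hn; apply: h => _ Xb Y cl.
    by apply: contrapT => nc; apply: hn; exists Xb, Y.
  split => //; have := sto2 L _ uy hy; rewrite hM => -[_ hsto].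
  have := hsto _ _ P (a2 M) (uni2 M) (ind2 0%N M).
  by apply: filterS => w [].
have bd1 : {ae P, forall w, forall j k l, `|a1 j w k l| <= amax1 / 2}.
  exact: (uniform_bounded am1 uni1).
have bd2 : {ae P, forall w, forall M j k l, `|a2 M j w k l| <= amax2 / 2}.
  by apply: ae_foralln => M; exact: (uniform_bounded am2 (uni2 M)).
have ae1 := sto1 _ _ P a1 uni1 ind1.
near=> w.
have h1 : forall j k l, `|a1 j w k l| <= amax1 / 2 by near: w.
have h2 : forall M j k l, `|a2 M j w k l| <= amax2 / 2 by near: w.
have [ex lim1] : (exists Xb X, closed_loop S f1 T 0 X0 X1 (a1 ^~ w) Xb X) /\
    forall Xb X, closed_loop S f1 T 0 X0 X1 (a1 ^~ w) Xb X ->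
    cmx_cvg \oo (fun j : nat => X (j%:R * T) *m X0^t*) (X1 *m X0^t*) by near: w.
have h3 : forall L M rho, C L M rho w -> forall Xb Y,
    closed_loop S f2 T (L%:R * T) (step_one_state L w) Xg (a2 M ^~ w) Xb Y ->
    cmx_cvg \oo (fun j : nat => Y (j%:R * T) *m (step_one_state L w)^t*)
      (Xg *m (step_one_state L w)^t*) by near: w.
split=> [|Xb X cl]; first exact: ex.
have [_ [_ _ uX _] _] := cl.
split.
  apply: (eventually_in_W hT ug uX hW).
  exact: (sampled_state_limit u0 (lim1 _ _ cl)).
move=> L hL; have uL : X (L%:R * T) \is unitarymx.
  by apply: uX; rewrite mulr_ge0// ltW.
have yE := step_one_stateE L h1 cl.
set y := X (L%:R * T) in hL uL yE *; move=> M; split=> [|Xb2 Y cl2].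
  have [Xb2 [Y cl2]] := closed_loop_exists hS hf2 hT uL hL
    (fun j => h2 M (L + j)%N).
  by do 2 eexists; exact: (closed_loop_unshift hT (a := a2 M ^~ w) cl2).
apply: (switched_limit hT); apply: (sampled_state_limit uL).
pose r := 1 + n%:R + sqnorm (chart_start y Xg).
have r1 : 1 <= r := radius_ge1 _.
have rrho : r <= (Num.truncn r).+1%:R ^+ 2.
  rewrite expr2; apply: (le_trans (ltW (truncnS_gt r))).
  by rewrite ler_peMr// ler1n.
have Cw : C L M (Num.truncn r).+1 w by rewrite /C /= -yE.
by have := h3 _ _ _ Cw; rewrite -yE; apply; exact: cl2.
Unshelve. all: by end_near.
Qed.

End Stochastic.

(** * Stabilization in two steps *)

Theorem theorem4 (R : realType) (n m : nat) (hn : (0 < n)%N)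
    (S : 'I_m -> 'M[R[i]]_n) (hS : forall k, skew_hermitian (S k))
    (hctrl : controllable S) (T : R) (hT : 0 < T)
    (X0 Xg : 'M[R[i]]_n) (hX0 : X0 \is unitarymx) (hXg : Xg \is unitarymx) :
  (exists X1 : 'M[R[i]]_n,
     [/\ X1 \is unitarymx, in_W (X1 *m X0^t*) & in_W (Xg *m X1^t*)]) /\
  forall X1 : 'M[R[i]]_n,
    X1 \is unitarymx -> in_W (X1 *m X0^t*) -> in_W (Xg *m X1^t*) ->
  (* deterministic laws *)
  (forall (f1 : 'I_m -> R) (M1 : nat) (a1 : 'M[R]_(m, M1)),
     (forall k, 0 < f1 k) ->
     det_big_enough S f1 T 0 X0 X1 M1 -> admissible S f1 T 0 X0 X1 a1 ->
     (exists Xb X, closed_loop S f1 T 0 X0 X1 (fun=> a1) Xb X) /\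
     forall Xb X, closed_loop S f1 T 0 X0 X1 (fun=> a1) Xb X ->
       (exists L : nat, in_W (Xg *m (X (L%:R * T))^t*)) /\
       forall L : nat, in_W (Xg *m (X (L%:R * T))^t*) ->
       forall (f2 : 'I_m -> R) (M2 : nat) (a2 : 'M[R]_(m, M2)),
         (forall k, 0 < f2 k) ->
         det_big_enough S f2 T (L%:R * T) (X (L%:R * T)) Xg M2 ->
         admissible S f2 T (L%:R * T) (X (L%:R * T)) Xg a2 ->
         (exists Xb2 Y,
            closed_loop S f2 T (L%:R * T) (X (L%:R * T)) Xg (fun=> a2) Xb2 Y) /\
         forall Xb2 Y,
           closed_loop S f2 T (L%:R * T) (X (L%:R * T)) Xg (fun=> a2) Xb2 Y ->
           cmx_cvg \oo (fun j : nat => switched (L%:R * T) X Y (j%:R * T)) Xg) /\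
  (* stochastic laws: M2 L Y0 is the number of harmonics chosen for the local
     law of (Y0, Xg) started at time L T, and a2 M the random coefficients used
     in step two when M harmonics are chosen *)
  (forall (d : measure_display) (Om : measurableType d) (P : probability Om R)
     (f1 f2 : 'I_m -> R) (amax1 amax2 : R)
     (M1 : nat) (a1 : nat -> Om -> 'M[R]_(m, M1))
     (M2 : nat -> 'M[R[i]]_n -> nat)
     (a2 : forall M : nat, nat -> Om -> 'M[R]_(m, M)),
     (forall k, 0 < f1 k) -> (forall k, 0 < f2 k) ->
     0 < amax1 -> 0 < amax2 ->
     sto_big_enough S f1 amax1 T 0 X0 X1 M1 ->
     (forall (L : nat) (Y0 : 'M[R[i]]_n),
        Y0 \is unitarymx -> in_W (Xg *m Y0^t*) ->
        sto_big_enough S f2 amax2 T (L%:R * T) Y0 Xg (M2 L Y0)) ->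
     (forall j, uniform_on_cube P amax1 (a1 j)) ->
     (forall M j, uniform_on_cube P amax2 (a2 M j)) ->
     mutually_independent P (fun j => sigma_rv (a1 j)) ->
     (forall L M : nat,
        mutually_independent P (fun j =>
          if (j < L)%N then sigma_rv (a1 j) else sigma_rv (a2 M j))) ->
     {ae P, forall w,
       (exists Xb X, closed_loop S f1 T 0 X0 X1 (a1 ^~ w) Xb X) /\
       forall Xb X, closed_loop S f1 T 0 X0 X1 (a1 ^~ w) Xb X ->
         (exists L : nat, in_W (Xg *m (X (L%:R * T))^t*)) /\
         forall L : nat, in_W (Xg *m (X (L%:R * T))^t*) ->
           let M := M2 L (X (L%:R * T)) in
           (exists Xb2 Y,
              closed_loop S f2 T (L%:R * T) (X (L%:R * T)) Xg
                (a2 M ^~ w) Xb2 Y) /\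
           forall Xb2 Y,
             closed_loop S f2 T (L%:R * T) (X (L%:R * T)) Xg
               (a2 M ^~ w) Xb2 Y ->
             cmx_cvg \oo
               (fun j : nat => switched (L%:R * T) X Y (j%:R * T)) Xg}).
Proof.
split=> [|X1 u1 hW0 hW1]; first exact: intermediate_target.
split.
  move=> f1 M1 a1 _ _ ad1.
  have [ex h] := deterministic_stabilization hS hT hX0 u1 hXg hW1 ad1.
  split=> [|Xb X cl]; first exact: ex.
  have [hL h2] := h Xb X cl.
  split=> [|L hWL f2 M2 a2 _ _ ad2]; first exact: hL.
  exact: h2 L hWL f2 M2 a2 ad2.
move=> d Om P f1 f2 amax1 amax2 M1 a1 M2 a2 hf1 hf2 am1 am2 sto1 sto2 un1 un2 i1 i2.
exact: (stochastic_stabilization hS hT hX0 hXg hf1 hf2 am1 am2 un1 un2 hW1 sto1 sto2 i1 i2).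
Qed.
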